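(* Let $T:(X_0,X_1)\to(Y_0,Y_1)$ be an operator between couples of complex Banach spaces and let $I\subset(0,1)$ be an interval of invertibility of $T$ with respect to the family of complex interpolation functors $F_\theta(A_0,A_1)=[A_0,A_1]_\theta$. Then for any $\theta_0,\theta_1\in I$ the inverse operators $T_{\theta_0}^{-1}$ and $T_{\theta_1}^{-1}$ agree on $[Y_0,Y_1]_{\theta_0}\cap[Y_0,Y_1]_{\theta_1}$.
   Context: An operator $T:\vec X\to\vec Y$ is a linear map $X_0+X_1\to Y_0+Y_1$ bounded $X_j\to Y_j$. Complex method: $\mathcal F(\vec X)$ is the space of bounded continuous $f:\bar S\to X_0+X_1$ on the closed strip $\bar S=\{0\le\mathrm{Re}\,z\le1\}$, analytic in the interior, with $t\mapsto f(j+it)$ bounded continuous into $X_j$, normed by $\max_j\sup_t\|f(j+it)\|_{X_j}$; $[\vec X]_\theta=\{f(\theta):f\in\mathcal F(\vec X)\}$ with the quotient norm. $T_\theta$ is the restriction $T:[X_0,X_1]_\theta\to[Y_0,Y_1]_\theta$. The set of $\theta\in(0,1)$ for which $T_\theta$ is invertible is open; an interval of invertibility is a connected component of this set. *)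

(* Defs.v *)
From HB Require Import structures.
From mathcomp Require Import all_boot all_order all_algebra.
From mathcomp Require Import complex.
From mathcomp Require Import all_classical all_reals all_analysis.
Import Order.TTheory GRing.Theory Num.Theory.
Import numFieldNormedType.Exports.
Set Implicit Arguments.
Unset Strict Implicit.
Unset Printing Implicit Defensive.
Local Open Scope classical_set_scope.
Local Open Scope ring_scope.
Local Open Scope complex_scope.

(* Real-valued norm of a vector in a normed space over C = R[i]
   (the library norm is R[i]-valued, with zero imaginary part). *)
Definition rnorm (R : realType) (V : normedModType R[i]) (x : V) : R :=
  complex.Re `|x|.

Definition cabs (R : realType) (z : R[i]) : R := complex.Re `|z|.

Record couple (R : realType) := Couple {
  amb : tvsType R[i];
  amb_hausdorff : hausdorff_space amb;
  sp0 : completeNormedModType R[i];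
  sp1 : completeNormedModType R[i];
  emb0 : {linear sp0 -> amb};
  emb1 : {linear sp1 -> amb};
  emb0_inj : injective emb0;
  emb1_inj : injective emb1;
  emb0_cont : continuous emb0;
  emb1_cont : continuous emb1 }.

Section CoupleDefs.
Context (R : realType) (X : couple R).
Local Notation W := (amb X).

Definition in_sum (w : W) : Prop :=
  exists (x0 : sp0 X) (x1 : sp1 X), emb0 X x0 + emb1 X x1 = w.

Definition sum_norm (w : W) : R :=
  inf [set r : R | exists (x0 : sp0 X) (x1 : sp1 X),
         emb0 X x0 + emb1 X x1 = w /\ r = rnorm x0 + rnorm x1].

Definition norm0 (w : W) : R := inf [set rnorm x | x in [set x : sp0 X | emb0 X x = w]].
Definition norm1 (w : W) : R := inf [set rnorm x | x in [set x : sp1 X | emb1 X x = w]].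

Definition strip : set R[i] := [set z | 0 <= complex.Re z <= 1].
Definition open_strip : set R[i] := [set z | 0 < complex.Re z < 1].

Definition calF (f : R[i] -> W) : Prop :=
  (forall z, strip z -> in_sum (f z)) /\
  (exists M : R, forall z, strip z -> sum_norm (f z) <= M) /\
  (forall z, strip z -> forall eps : R, 0 < eps -> exists2 delta : R, 0 < delta &
     forall z', strip z' -> cabs (z' - z) < delta -> sum_norm (f z' - f z) < eps) /\
  (forall z, open_strip z -> exists2 d : W, in_sum d &
     forall eps : R, 0 < eps -> exists2 delta : R, 0 < delta &
       forall h : R[i], h != 0 -> cabs h < delta -> strip (z + h) ->
         sum_norm (h^-1 *: (f (z + h) - f z) - d) < eps) /\
  (exists g0 : R -> sp0 X, (forall t, emb0 X (g0 t) = f (0 +i* t)) /\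
     continuous g0 /\ exists M : R, forall t, rnorm (g0 t) <= M) /\
  (exists g1 : R -> sp1 X, (forall t, emb1 X (g1 t) = f (1 +i* t)) /\
     continuous g1 /\ exists M : R, forall t, rnorm (g1 t) <= M).

Definition calF_norm (f : R[i] -> W) : R :=
  Num.max (sup [set norm0 (f (0 +i* t)) | t in [set: R]])
          (sup [set norm1 (f (1 +i* t)) | t in [set: R]]).

Definition cinterp (theta : R) : set W :=
  [set w | exists2 f, calF f & f theta%:C = w].

Definition cinterp_norm (theta : R) (w : W) : R :=
  inf [set calF_norm f | f in [set f | calF f /\ f theta%:C = w]].

End CoupleDefs.
Arguments in_sum {R} X _.
Arguments sum_norm {R} X _.
Arguments norm0 {R} X _.
Arguments norm1 {R} X _.
Arguments calF {R} X _.
Arguments calF_norm {R} X _.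
Arguments cinterp {R} X theta _.
Arguments cinterp_norm {R} X theta _.

(* An operator T : (X0,X1) -> (Y0,Y1): a linear map X0+X1 -> Y0+Y1
   (given as a function amb X -> amb Y whose values off X0+X1 are irrelevant)
   that maps X_j boundedly into Y_j. *)
Definition operator (R : realType) (X Y : couple R) (T : amb X -> amb Y) : Prop :=
  (forall (a : R[i]) (u v : amb X), in_sum X u -> in_sum X v ->
     T (a *: u + v) = a *: T u + T v) /\
  (exists T0 : sp0 X -> sp0 Y, (forall x, emb0 Y (T0 x) = T (emb0 X x)) /\
     exists c : R, forall x, rnorm (T0 x) <= c * rnorm x) /\
  (exists T1 : sp1 X -> sp1 Y, (forall x, emb1 Y (T1 x) = T (emb1 X x)) /\
     exists c : R, forall x, rnorm (T1 x) <= c * rnorm x).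

Definition invertible_at (R : realType) (X Y : couple R) (T : amb X -> amb Y)
  (theta : R) : Prop :=
  (forall x, cinterp X theta x -> cinterp Y theta (T x)) /\
  (exists c : R, forall x, cinterp X theta x ->
     cinterp_norm Y theta (T x) <= c * cinterp_norm X theta x) /\
  (forall x x', cinterp X theta x -> cinterp X theta x' -> T x = T x' -> x = x') /\
  (forall y, cinterp Y theta y -> exists2 x, cinterp X theta x & T x = y) /\
  (exists c : R, forall x, cinterp X theta x ->
     cinterp_norm X theta x <= c * cinterp_norm Y theta (T x)).

Definition invertibility_set (R : realType) (X Y : couple R) (T : amb X -> amb Y)
  : set R := [set theta | 0 < theta < 1 /\ invertible_at T theta].

Definition interval_of_invertibility (R : realType) (X Y : couple R)
  (T : amb X -> amb Y) (I : set R) : Prop :=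
  exists2 theta, invertibility_set T theta &
    I = connected_component (invertibility_set T) theta.

(* Main.v *)
(** Write [T_th] for the restriction of [T] to [[X]_th].  Cauchy's formula on the strip, with the
    kernel [ker z = 1 / (z (2 - z))], recovers an element [f] of the Calderon space from its
    boundary values; hence point evaluations are bounded, and [f / (z - th)] is again in the space
    as soon as [f th = 0].  Splitting the formula into its two boundary integrals writes
    [x] in [[X]_th] as [a + b], where [a] in [X_0] lies in [[X]_s] for [s < th] and [b] in [X_1]
    lies in [[X]_s] for [s > th].

    If [T_th] is invertible and [w] is in [Y_0] and [Y_1], dividing twice by [z - th] gives
    [w = T (f0 z) + (z - th) T (f1 z) + (z - th)^2 g2 z] with [x = f0 th = T_th^-1 w].  Since the
    lower bound for [T_th] persists for [s] near [th], every solution [a] in [[X]_s] of [T a = w]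
    is [x + (s - th) v + O((s - th)^2)] with [v = f0' th + f1 th]; and [v = 0] because [[X]_th] is
    invariant under vertical translation, so that [x] also solves the equation at [th + it].  Thus
    [s |-> T_s^-1 w] has zero derivative and is constant on [I].

    Finally, if [T x0 = T x1], split [x0 = a0 + b0] and [x1 = a1 + b1].  Then
    [w = T (a0 - a1) = T (b1 - b0)] is in both [Y_0] and [Y_1].  Letting [s] increase to [theta0]
    gives [a0 - a1 = T_theta0^-1 w], letting [s] decrease to [theta1] gives
    [b1 - b0 = T_theta1^-1 w], and these two are equal. *)

(* The spaces [[X]_s] vary with [s], so inverses are compared in the norm of [X_0 + X_1], and only
   on right-hand sides [w] in both [Y_0] and [Y_1]: such a [w] lies in every [[Y]_s] as the value of
   a constant function. One division by [z - th] would only make [s |-> T_s^-1 w] Lipschitz. The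
   second one exposes the derivative, which is complex linear: its vanishing in the imaginary
   direction, where the solution does not move, gives its vanishing in the real one. The factor
   [2 - z] of the kernel is there for decay: boundary values are merely bounded, and [1 / z] is not
   integrable along a vertical line. Its zero does no harm, since differences of points of the strip
   have real part at most [1]. Each boundary integral is analytic off its own line. A horizontal
   translation pushes that line out of the closed strip, and on the opposite side it moves the
   evaluation point outside the strip, where both boundary integrals coincide; hence membership in
   the Calderon space. The translation must be nonzero, so only [s < th] or [s > th] is reached, and
   the endpoints call for a limit. *)
Require Import Defs.
From HB Require Import structures.
From mathcomp Require Import all_boot all_order all_algebra.
From mathcomp Require Import complex.
From mathcomp Require Import all_classical all_reals all_analysis.
From mathcomp Require Import ring lra.
Import Order.TTheory GRing.Theory Num.Theory.
Import numFieldNormedType.Exports.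
Set Implicit Arguments.
Unset Strict Implicit.
Unset Printing Implicit Defensive.
Local Open Scope classical_set_scope.
Local Open Scope ring_scope.
Local Open Scope complex_scope.

(* The square-zero extension of [K] by [V] is a commutative ring containing [V], so [ring] proves
   identities between vectors. *)
Section Idealization.
Context (K : comNzRingType) (V : lmodType K).

Definition idealization : Type := (K * V)%type.
HB.instance Definition _ := GRing.Zmodule.copy idealization (K * V)%type.

Definition ideal_mul (x y : idealization) : idealization :=
  (x.1 * y.1, x.1 *: y.2 + y.1 *: x.2).
Definition ideal_one : idealization := (1, 0).

Lemma ideal_mulA : associative ideal_mul.
Proof.
move=> [a u] [b v] [c w]; congr pair => /=; first by rewrite mulrA.
by rewrite !scalerDr !scalerA -addrA [c * a]mulrC [c * b]mulrC.
Qed.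

Lemma ideal_mulC : commutative ideal_mul.
Proof. by move=> [a u] [b v]; congr pair; rewrite /= ?[a * b]mulrC // addrC. Qed.

Lemma ideal_mul1 : left_id ideal_one ideal_mul.
Proof. by move=> [a u]; congr pair; rewrite /= ?mul1r // scale1r scaler0 addr0. Qed.

Lemma ideal_mulDl : left_distributive ideal_mul +%R.
Proof.
move=> [a u] [b v] [c w]; congr pair => /=; first by rewrite mulrDl.
by rewrite scalerDl scalerDr addrACA.
Qed.

Lemma ideal_one_neq0 : ideal_one != 0.
Proof. by apply/eqP => -[] /eqP; rewrite oner_eq0. Qed.

HB.instance Definition _ := GRing.Zmodule_isComNzRing.Build idealization
  ideal_mulA ideal_mulC ideal_mul1 ideal_mulDl ideal_one_neq0.

Definition scal_id (a : K) : idealization := (a, 0).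
Definition vec_id (v : V) : idealization := (0, v).

Lemma scal_id_additive : {morph scal_id : x y / x - y}.
Proof. by move=> a b; congr pair; rewrite /= subr0. Qed.
HB.instance Definition _ := GRing.isZmodMorphism.Build K idealization scal_id scal_id_additive.

Lemma scal_id_mult : monoid_morphism scal_id.
Proof. by split=> // a b; congr pair; rewrite /= !scaler0 addr0. Qed.
HB.instance Definition _ := GRing.isMonoidMorphism.Build K idealization scal_id scal_id_mult.

Lemma vec_id_additive : {morph vec_id : x y / x - y}.
Proof. by move=> a b; congr pair; rewrite /= subr0. Qed.
HB.instance Definition _ := GRing.isZmodMorphism.Build V idealization vec_id vec_id_additive.

Lemma vec_idZ a v : vec_id (a *: v) = scal_id a * vec_id v.
Proof. by congr pair; rewrite /= ?mulr0 // scale0r addr0. Qed.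

Lemma vec_id_inj : injective vec_id.
Proof. by move=> u v []. Qed.

Lemma vec_idD u v : vec_id (u + v) = vec_id u + vec_id v.
Proof. exact: raddfD. Qed.

Lemma vec_idN v : vec_id (- v) = - vec_id v.
Proof. exact: raddfN. Qed.

Lemma vec_id0 : vec_id 0 = 0.
Proof. by []. Qed.

End Idealization.

Ltac modring := apply: vec_id_inj; rewrite ?(vec_idD, vec_idN, vec_idZ, vec_id0); ring.

(** * Vector-valued integrals *)

Section RealLine.
Context (R : realType).
Implicit Types (a b x y u v w d e : R).

Lemma eq_leW x y : x = y -> x <= y.
Proof. by move=> ->. Qed.

(** Compactness of [[a, b]] without coverings: the supremum of the [x] with [P a x] can always be
    passed. Uniform continuity, boundedness and the mean value inequalities are derived from it. *)
Lemma segment_ind (P : R -> R -> Prop) a b : a <= b ->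
  (forall x, a <= x <= b -> exists2 d, 0 < d & forall u v,
     a <= u -> u <= x -> x <= v -> v <= b -> x - d < u -> v < x + d -> P u v) ->
  (forall u v w, a <= u -> u <= v -> v <= w -> w <= b ->
     P u v -> P v w -> P u w) ->
  P a b.
Proof.
move=> leab loc glue.
pose S := [set x | a <= x <= b /\ P a x].
have Sa : S a.
  split; first by rewrite lexx.
  have [|d d0 Hd] := loc a; first by rewrite lexx.
  by apply: Hd => //; lra.
have ubS : has_ubound S by exists b => x [/andP[]].
have supS : has_sup S by split => //; exists a.
have as_ : a <= sup S by apply: ub_le_sup.
have sb : sup S <= b by apply: ge_sup; [exists a | move=> x [/andP[]]].
have [|d d0 Hd] := loc (sup S); first by rewrite as_.
have [x [/andP[ax xb] Pax] xs] := sup_adherent d0 supS.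
have lexs : x <= sup S by apply: ub_le_sup => //; split; rewrite ?ax ?xb.
have [bs|sb'] := leP b (sup S).
  apply: (glue _ x) => //; apply: Hd => //; lra.
pose v := Num.min b (sup S + d / 2).
have sv : sup S < v by rewrite lt_min sb' /=; lra.
have vb : v <= b by rewrite ge_min lexx.
have vd : v <= sup S + d / 2 by rewrite ge_min lexx orbT.
suff : v <= sup S by lra.
apply: ub_le_sup => //; split; first by rewrite vb andbT; lra.
apply: (glue _ x) => //; first by lra.
apply: Hd => //; lra.
Qed.

Lemma ler_addeps x y (c : R) : 0 <= c -> (forall e, 0 < e -> x <= y + e * c) -> x <= y.
Proof.
move=> c0 H; apply/ler_addgt0Pr => e e0.
have /H : 0 < e / (c + 1) by apply: divr_gt0; lra.
move=> /le_trans; apply; rewrite lerD2l mulrAC ler_pdivrMr; last lra.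
by rewrite ler_wpM2l //; lra.
Qed.

Lemma pow2_lt e : 0 < e -> exists n : nat, forall m, (n <= m)%N -> (2 : R) ^- m <= e.
Proof.
move=> e0; have [n Hn] : exists n : nat, e^-1 <= n%:R.
  by exists (Num.bound e^-1); rewrite ltW // archi_boundP // invr_ge0 ltW.
exists n => m nm.
have : e^-1 <= 2 ^+ m.
  apply: (le_trans Hn); apply: (@le_trans _ _ m%:R); first by rewrite ler_nat.
  by rewrite -natrX ler_nat ltnW // ltn_expl.
by move=> h; rewrite invf_ple // posrE exprn_gt0.
Qed.

End RealLine.

Section Modulus.
Context (R : realType).
Implicit Types (z : R[i]) (x y : R).

Lemma normr_cabs z : `|z| = (cabs z)%:C.
Proof. by rewrite /cabs normc_def. Qed.

Lemma cabsE z : cabs z = Num.sqrt (complex.Re z ^+ 2 + complex.Im z ^+ 2).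
Proof. by rewrite /cabs normc_def. Qed.

Lemma cabs_ge0 z : 0 <= cabs z. Proof. by rewrite cabsE sqrtr_ge0. Qed.

Lemma cabs0 : cabs (0 : R[i]) = 0. Proof. by rewrite /cabs normr0. Qed.

Lemma cabs1 : cabs (1 : R[i]) = 1. Proof. by rewrite /cabs normr1. Qed.

Lemma cabs_eq0 z : (cabs z == 0) = (z == 0).
Proof.
rewrite -(normr_eq0 z) normr_cabs; apply/eqP/eqP => [->//|].
by move/(congr1 (@complex.Re R)).
Qed.

Lemma cabs_gt0 z : (0 < cabs z) = (z != 0).
Proof. by rewrite lt_def cabs_ge0 andbT cabs_eq0. Qed.

Lemma cabsM z1 z2 : cabs (z1 * z2) = cabs z1 * cabs z2.
Proof. by apply: (@complexI R); rewrite rmorphM /= -!normr_cabs normrM. Qed.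

Lemma cabsN z : cabs (- z) = cabs z. Proof. by rewrite /cabs normrN. Qed.

Lemma cabsB z1 z2 : cabs (z1 - z2) = cabs (z2 - z1).
Proof. by rewrite -cabsN opprB. Qed.

Lemma cabsV z : cabs z^-1 = (cabs z)^-1.
Proof. by apply: (@complexI R); rewrite fmorphV /= -!normr_cabs normfV. Qed.

Lemma cabs_triangle z1 z2 : cabs (z1 + z2) <= cabs z1 + cabs z2.
Proof. by rewrite -lecR rmorphD /= -!normr_cabs ler_normD. Qed.

Lemma cabsR x : cabs x%:C = `|x|.
Proof. by rewrite cabsE /= expr0n addr0 sqrtr_sqr. Qed.

Lemma cabsI x : cabs (0 +i* x) = `|x|.
Proof. by rewrite cabsE /= expr0n add0r sqrtr_sqr. Qed.

Lemma Re_le_cabs z : `|complex.Re z| <= cabs z.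
Proof. by rewrite cabsE -sqrtr_sqr ler_wsqrtr // lerDl sqr_ge0. Qed.

Lemma Im_le_cabs z : `|complex.Im z| <= cabs z.
Proof. by rewrite cabsE -sqrtr_sqr ler_wsqrtr // lerDr sqr_ge0. Qed.

Lemma cabs_le z : cabs z <= `|complex.Re z| + `|complex.Im z|.
Proof.
rewrite {1}(_ : z = (complex.Re z)%:C + (0 +i* complex.Im z)).
  by rewrite (le_trans (cabs_triangle _ _)) // cabsR cabsI.
by case: z => a b /=; apply/eqP; rewrite eq_complex /= addr0 add0r !eqxx.
Qed.

End Modulus.

(* A Banach norm; completeness is only asked for geometrically converging sequences. *)
Record bnorm (R : realType) (V : lmodType R[i]) (N : V -> R) : Prop := Bnorm {
  bn_triangle : forall x y, N (x + y) <= N x + N y;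
  bn_scale : forall a x, N (a *: x) = cabs a * N x;
  bn_sep : forall x, N x = 0 -> x = 0;
  bn_complete : forall (u : nat -> V) (c : R),
    (forall n, N (u n.+1 - u n) <= c * 2 ^- n) ->
    exists l, forall e : R, 0 < e -> exists n0 : nat,
      forall n, (n0 <= n)%N -> N (u n - l) <= e }.

Section Integral.
Context (R : realType) (V : lmodType R[i]) (N : V -> R) (HN : bnorm N).
Implicit Types (a b x y u v w d e : R) (f g G H : R -> V).

Lemma bn0 : N 0 = 0.
Proof. by have := bn_scale HN 0 0; rewrite scaler0 cabs0 mul0r. Qed.

Lemma bnN p : N (- p) = N p.
Proof. by rewrite -scaleN1r (bn_scale HN) cabsN cabs1 mul1r. Qed.

Lemma bn_ge0 p : 0 <= N p.
Proof. by have := bn_triangle HN p (- p); rewrite subrr bnN bn0; lra. Qed.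

Lemma bnB p q : N (p - q) <= N p + N q.
Proof. by have := bn_triangle HN p (- q); rewrite bnN. Qed.

Lemma bn_sym p q : N (p - q) = N (q - p).
Proof. by rewrite -bnN opprB. Qed.

Lemma bn_trans q p r : N (p - r) <= N (p - q) + N (q - r).
Proof. by rewrite -{1}(subrK q p) -addrA; apply: bn_triangle. Qed.

Lemma bn_scaleR a p : N (a%:C *: p) = `|a| * N p.
Proof. by rewrite (bn_scale HN) cabsR. Qed.

Lemma bn_sum (I : Type) (r : seq I) (P : pred I) (F : I -> V) :
  N (\sum_(i <- r | P i) F i) <= \sum_(i <- r | P i) N (F i).
Proof.
elim/big_rec2: _ => [|i y1 y2 _ IH]; first by rewrite bn0.
exact: (le_trans (bn_triangle HN _ _)) (lerD _ _).
Qed.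

Lemma bn_eq p q : (forall e, 0 < e -> N (p - q) <= e) -> p = q.
Proof.
move=> h; apply/eqP; rewrite -subr_eq0; apply/eqP/(bn_sep HN)/eqP.
rewrite eq_le bn_ge0 andbT; apply/ler_addgt0Pr => e /h.
by rewrite add0r.
Qed.

Definition contI g a b := forall x, a <= x <= b -> forall e, 0 < e ->
  exists2 d, 0 < d & forall y, a <= y <= b -> `|y - x| < d -> N (g y - g x) <= e.

(** Differentiation is relative to [[a, b]]: at the endpoints the derivative is one-sided. *)
Definition prim g G a b := forall x, a <= x <= b -> forall e, 0 < e ->
  exists2 d, 0 < d & forall y, a <= y <= b -> `|y - x| < d ->
    N (G y - G x - (y - x)%:C *: g x) <= e * `|y - x|.

Lemma prim_sub g G a b u v : a <= u -> v <= b -> prim g G a b -> prim g G u v.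
Proof.
move=> au vb cg x /andP[ux xv] e e0.
have [|d d0 Hd] := cg x _ e e0; first by apply/andP; split; lra.
by exists d => // y /andP[uy yv]; apply: Hd; apply/andP; split; lra.
Qed.

Lemma contI_unif g a b : a <= b -> contI g a b -> forall e, 0 < e ->
  exists2 d, 0 < d & forall x y, a <= x <= b -> a <= y <= b -> `|y - x| < d ->
    N (g y - g x) <= e.
Proof.
move=> ab cg e e0.
pose P u v := exists2 d, 0 < d & forall x y, u <= x <= v -> a <= y <= b ->
  `|y - x| < d -> N (g y - g x) <= e.
suff : P a b by [].
apply: (@segment_ind R P) => //.
  move=> x xab; have [|d d0 Hd] := cg x xab (e / 2); first lra.
  exists (d / 2); first lra.
  move=> u v au ux xv vb xu vx; exists (d / 2); first lra.
  move=> s t /andP[us sv] tab st; apply: le_trans (bn_trans (g x) _ _) _.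
  have := Hd t tab; have := Hd s; rewrite (bn_sym (g s)).
  have H1 : `|s - x| < d by rewrite ltr_norml; apply/andP; split; lra.
  have H2 : `|t - x| < d.
    by move: st; rewrite !ltr_norml => /andP[? ?]; apply/andP; split; lra.
  have sab : a <= s <= b by apply/andP; split; lra.
  by move=> /(_ sab H1) ? /(_ H2) ?; lra.
move=> u v w au uv vw wb [d1 d10 H1] [d2 d20 H2].
exists (Num.min d1 d2); first by rewrite lt_min d10.
move=> x y /andP[ux xw] yab; rewrite lt_min => /andP[l1 l2].
have [xv|vx] := leP x v; first by apply: H1 => //; rewrite ux.
by apply: H2 => //; rewrite xw (ltW vx).
Qed.

(* The functional [l] is either the norm or minus the real part. *)
Lemma prim_le (l : V -> R) (phi : R -> R) g G a b : a <= b ->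
  (forall p q, l (p + q) <= l p + l q) ->
  (forall (c : R) p, 0 <= c -> l (c%:C *: p) = c * l p) ->
  (forall p, l p <= N p) ->
  prim g G a b ->
  (forall x, a <= x <= b -> forall e, 0 < e -> exists2 d, 0 < d &
     forall u v, a <= u -> u <= x -> x <= v -> v <= b -> x - d < u -> v < x + d ->
       (l (g x) - e) * (v - u) <= phi v - phi u) ->
  l (G b - G a) <= phi b - phi a.
Proof.
move=> ab lD lZ lN pG dphi.
apply: (@ler_addeps _ _ _ (b - a)); first lra.
move=> e e0.
(* The slack [e * (v - u)] is additive in the segment, so the estimate glues. *)
pose P u v := l (G v - G u) <= phi v - phi u + e * (v - u).
suff : P a b by [].
apply: (@segment_ind R P) => //; last first.
  move=> u v w _ _ _ _; rewrite /P => h1 h2.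
  rewrite -(subrK (G v) (G w)) -addrA; have := lD (G w - G v) (G v - G u); lra.
move=> x xab.
have [|d1 d10 H1] := pG x xab (e / 3); first lra.
have [|d2 d20 H2] := dphi x xab (e / 3); first lra.
exists (Num.min d1 d2); first by rewrite lt_min d10.
have m1 : Num.min d1 d2 <= d1 by rewrite ge_min lexx.
have m2 : Num.min d1 d2 <= d2 by rewrite ge_min lexx orbT.
move=> u v au ux xv vb xu vx; rewrite /P.
have -> : G v - G u = (v - u)%:C *: g x + ((G v - G x - (v - x)%:C *: g x)
   - (G u - G x - (u - x)%:C *: g x)) by modring.
have h2 := H2 u v au ux xv vb; have {}h2 := h2 ltac:(lra) ltac:(lra).
apply: (le_trans (lD _ _)); rewrite lZ; last lra.
have : l (G v - G x - (v - x)%:C *: g x - (G u - G x - (u - x)%:C *: g x)) <=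
  e / 3 * (v - x) + e / 3 * (x - u).
  apply: (le_trans (lN _)); apply: (le_trans (bnB _ _)); apply: lerD.
    have /H1 : a <= v <= b by apply/andP; split; lra.
    by rewrite ger0_norm; [apply; lra | lra].
  have /H1 : a <= u <= b by apply/andP; split; lra.
  by rewrite ler0_norm ?opprB; [apply; lra | lra].
have : 0 <= e * (v - u) by apply: mulr_ge0; lra.
move: h2; lra.
Qed.

Lemma prim_norm_le (phi : R -> R) g G a b : a <= b -> prim g G a b ->
  (forall x, a <= x <= b -> forall e, 0 < e -> exists2 d, 0 < d &
     forall u v, a <= u -> u <= x -> x <= v -> v <= b -> x - d < u -> v < x + d ->
       (N (g x) - e) * (v - u) <= phi v - phi u) ->
  N (G b - G a) <= phi b - phi a.
Proof.
move=> ab; apply: prim_le => //; first exact: bn_triangle HN.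
by move=> c p c0; rewrite bn_scaleR ger0_norm.
Qed.

Lemma prim_norm_cst (M : R) g G a b : a <= b -> prim g G a b ->
  (forall x, a <= x <= b -> N (g x) <= M) -> N (G b - G a) <= M * (b - a).
Proof.
move=> ab pG gM; rewrite mulrBr; apply: (@prim_norm_le (fun x => M * x)) pG _ => //.
move=> x xab e e0; exists 1 => // u v *; rewrite -mulrBr; apply: ler_wpM2r; first lra.
by have := gM x xab; lra.
Qed.

Lemma local_lipschitz (c d : R) G a b : a <= b -> 0 < d ->
  (forall x y, a <= x <= b -> a <= y <= b -> `|y - x| < d ->
     N (G y - G x) <= c * `|y - x|) -> N (G b - G a) <= c * (b - a).
Proof.
move=> ab d0 H.
pose P u v := N (G v - G u) <= c * (v - u).
suff : P a b by [].
apply: (@segment_ind R P) => //; last first.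
  move=> u v w _ _ _ _; rewrite /P => h1 h2.
  by have := bn_trans (G v) (G w) (G u); lra.
move=> x xab; exists (d / 2); first lra.
move=> u v au ux xv vb xu vx; rewrite /P -[in leRHS](ger0_norm (_ : 0 <= v - u)); last lra.
by apply: H; rewrite ?ger0_norm; try (apply/andP; split); lra.
Qed.

(** [D] is the length of the overlap of [[x, y]] and [[t, t']], so it is nonzero only when the two
    segments meet. *)
Lemma min_increment x y t t' : x <= y -> t <= t' ->
  let D := (Num.min y t' - Num.min y t) - (Num.min x t' - Num.min x t) in
  0 <= D /\ (D = 0 \/ t < y /\ x < t').
Proof.
move=> xy tt' D; rewrite /D.
have [ytt|] := leP y t; have [|] := leP y t'; have [|] := leP x t; have [|] := leP x t';
  move=> *; split; try lra; try (left; lra); right; split; lra.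
Qed.

(** The primitive of the step function equal to [g (t k)] between [t k] and [t k.+1]; truncation by
    [min] gives one formula for all [x]. *)
Definition step_prim g a b n x : V := let t k := a + k%:R * ((b - a) / n.+1%:R) in
  \sum_(k < n.+1) (Num.min x (t k.+1) - Num.min x (t k))%:C *: g (t k).

(** The left-hand side is a sum of [D k *: (g (t k) - g p)] whose weights are overlaps adding up to
    [y - x]. A nonzero weight forces [t k] within [d] of [p]: half of [d] is spent on [y - x], half
    on the mesh. *)
Lemma step_prim_est g a b n d e : a <= b -> 0 <= e ->
  (forall x y, a <= x <= b -> a <= y <= b -> `|y - x| < d -> N (g y - g x) <= e) ->
  (b - a) / n.+1%:R < d / 2 ->
  forall x y p, a <= x -> x <= p -> p <= y -> y <= b -> y - x < d / 2 ->
    N (step_prim g a b n y - step_prim g a b n x - (y - x)%:C *: g p) <= e * (y - x).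
Proof.
move=> ab e0 ug; set h := (b - a) / _ => hd x y p ax xp py yb yxd.
pose t k := a + k%:R * h.
have h0 : 0 <= h by apply: divr_ge0 => //; lra.
have tS k : t k.+1 = t k + h by rewrite /t -natr1; ring.
have tn : t n.+1 = b.
  by rewrite /t /h mulrC divfK ?pnatr_eq0 // addrC subrK.
have t_b k : (k <= n)%N -> a <= t k <= b.
  move=> kn; rewrite -tn /t lerDl mulr_ge0 //= lerD2l ler_wpM2r // ler_nat.
  exact: ltnW.
pose D k := (Num.min y (t k.+1) - Num.min y (t k)) - (Num.min x (t k.+1) - Num.min x (t k)).
have sumD : \sum_(k < n.+1) D k = y - x.
  rewrite sumrB -!(big_mkord xpredT (fun k => _ (t k.+1) - _ (t k))) !telescope_sumr // tn.
  have -> : t 0%N = a by rewrite /t mul0r addr0.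
  by rewrite !(@min_l _ _ _ b) ?(@min_r _ _ _ a); lra.
have -> : step_prim g a b n y - step_prim g a b n x - (y - x)%:C *: g p
  = \sum_(k < n.+1) (D k)%:C *: (g (t k) - g p).
  under [RHS]eq_bigr do rewrite scalerBr.
  rewrite sumrB -scaler_suml -(rmorph_sum (real_complex R)) /= sumD; congr (_ - _).
  rewrite /step_prim -sumrB; apply: eq_bigr => k _.
  by rewrite -scalerBl -rmorphB.
apply: (le_trans (bn_sum _ _ _)); rewrite -sumD mulr_sumr; apply: ler_sum => k _.
rewrite bn_scaleR mulrC.
have [D0 HD] := min_increment (t := t k) (t' := t k.+1) (le_trans xp py) ltac:(rewrite tS; lra).
rewrite [`|_|]ger0_norm //.
case: HD => [E|[tky xtk]]; first by rewrite /D E !mulr0.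
apply: ler_wpM2r => //; apply: ug.
- by rewrite (le_trans ax xp) (le_trans py yb).
- by apply: t_b; rewrite -ltnS.
- by rewrite ltr_norml; move: xtk; rewrite tS => ?; apply/andP; split; lra.
Qed.

(** Step primitives [U j] have derivative [g] up to [2^-j]. The difference of two of them is
    locally, hence globally, Lipschitz with constant [2 * 2^-j], so their increments converge
    geometrically and the limit has derivative [g]. *)
Lemma prim_exists g a b : a <= b -> contI g a b -> exists G, prim g G a b.
Proof.
move=> ab cg.
have step j : exists Gj, exists2 d, 0 < d & forall x y, a <= x <= b -> a <= y <= b ->
    `|y - x| < d -> N (Gj y - Gj x - (y - x)%:C *: g x) <= 2 ^- j * `|y - x|.
  have e0 : 0 < (2 : R) ^- j by rewrite invr_gt0 exprn_gt0.
  have [d d0 Hd] := contI_unif ab cg e0.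
  have [n Hn] : exists n : nat, (b - a) / n.+1%:R < d / 2.
    exists (Num.bound ((b - a) / (d / 2))).
    rewrite ltr_pdivrMr // mulrC -ltr_pdivrMr; last lra.
    apply: lt_trans (_ : _ < (Num.bound ((b - a) / (d / 2)))%:R) _.
      by apply: archi_boundP; apply: divr_ge0; lra.
    by rewrite ltr_nat.
  exists (step_prim g a b n); exists (d / 2); first lra.
  move=> x y /andP[ax xb] /andP[ay yb] yx.
  have [xy|yx'] := leP x y.
    rewrite ger0_norm in yx *; last lra.
    by apply: (step_prim_est ab (ltW e0) Hd Hn) => //; lra.
  rewrite ltr0_norm in yx *; last lra.
  have -> : step_prim g a b n y - step_prim g a b n x - (y - x)%:C *: g x =
     - (step_prim g a b n x - step_prim g a b n y - (x - y)%:C *: g x) by modring.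
  rewrite bnN opprB.
  by apply: (step_prim_est ab (ltW e0) Hd Hn) => //; lra.
have [U HU] := choice step.
have lip j m x y : (j <= m)%N -> a <= x -> x <= y -> y <= b ->
    N ((U m y - U j y) - (U m x - U j x)) <= 2 * 2 ^- j * (y - x).
  move=> jm ax xy yb.
  have [d1 d10 H1] := HU j; have [d2 d20 H2] := HU m.
  apply: (@local_lipschitz _ (Num.min d1 d2) (fun x => U m x - U j x)) => //.
    by rewrite lt_min d10.
  move=> s t /andP[xs sy] /andP[xt ty]; rewrite lt_min => /andP[l1 l2].
  have := H1 s t ltac:(apply/andP; split; lra) ltac:(apply/andP; split; lra) l1.
  have := H2 s t ltac:(apply/andP; split; lra) ltac:(apply/andP; split; lra) l2.
  have -> : U m t - U j t - (U m s - U j s) = (U m t - U m s - (t - s)%:C *: g s)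
     - (U j t - U j s - (t - s)%:C *: g s) by modring.
  have := bnB (U m t - U m s - (t - s)%:C *: g s) (U j t - U j s - (t - s)%:C *: g s).
  have : 2 ^- m * `|t - s| <= 2 ^- j * `|t - s|.
    by rewrite ler_wpM2r // lef_pV2 ?posrE ?exprn_gt0 // ler_eXn2l // ltr1n.
  lra.
have ex x : exists l, a <= x <= b -> forall e, 0 < e -> exists n0 : nat,
    forall n, (n0 <= n)%N -> N ((U n x - U n a) - l) <= e.
  have [xab|nxab] := boolP (a <= x <= b); last by exists 0.
  have [|l Hl] := @bn_complete _ _ _ HN (fun n => U n x - U n a) (2 * (b - a)).
    move=> n; move/andP: xab => [ax xb].
    have -> : U n.+1 x - U n.+1 a - (U n x - U n a) = (U n.+1 x - U n x) -
      (U n.+1 a - U n a) by modring.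
    apply: (le_trans (lip _ _ _ _ (leqnSn n) (lexx a) ax xb)).
    rewrite mulrAC ler_wpM2r ?invr_ge0 ?exprn_ge0 //; lra.
  by exists l.
have [G HG] := choice ex; exists G.
have GU j x y : a <= x -> x <= y -> y <= b ->
    N ((G y - U j y) - (G x - U j x)) <= 2 * 2 ^- j * (y - x).
  move=> ax xy yb; apply/ler_addgt0Pr => e e0.
  have [|n1 H1] := HG x _ (e / 2) ltac:(lra); first by apply/andP; split; lra.
  have [|n2 H2] := HG y _ (e / 2) ltac:(lra); first by apply/andP; split; lra.
  pose m := maxn j (maxn n1 n2).
  have jm : (j <= m)%N by rewrite leq_maxl.
  have h1 := H1 m ltac:(by rewrite /m !leq_max leqnn orbT).
  have h2 := H2 m ltac:(by rewrite /m !leq_max leqnn !orbT).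
  have := lip j m x y jm ax xy yb.
  have -> : G y - U j y - (G x - U j x) = (U m y - U j y - (U m x - U j x))
     + ((U m x - U m a - G x) - (U m y - U m a - G y)) by modring.
  have := bn_triangle HN (U m y - U j y - (U m x - U j x))
     ((U m x - U m a - G x) - (U m y - U m a - G y)).
  have := bnB (U m x - U m a - G x) (U m y - U m a - G y).
  lra.
move=> x xab e e0.
have e30 : 0 < e / 3 by lra.
have [j Hj] := pow2_lt e30.
have {}Hj := Hj j (leqnn j).
have [d d0 Hd] := HU j; exists d => // y yab yx.
have h1 := Hd x y xab yab yx.
have h2 : N ((G y - U j y) - (G x - U j x)) <= 2 * 2 ^- j * `|y - x|.
  move/andP: xab yab => [ax xb] /andP[ay yb].
  have [xy|yx'] := leP x y.
    by rewrite ger0_norm; [apply: GU|lra].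
  have -> : `|y - x| = x - y by rewrite ltr0_norm; lra.
  by rewrite bn_sym; apply: GU => //; apply: ltW.
have -> : G y - G x - (y - x)%:C *: g x = ((G y - U j y) - (G x - U j x)) +
  (U j y - U j x - (y - x)%:C *: g x) by modring.
apply: (le_trans (bn_triangle HN _ _)).
apply: (le_trans (lerD h2 h1)).
rewrite -mulrDl ler_wpM2r //; lra.
Qed.

Lemma prim_lin (c : R[i]) f g F G a b : prim f F a b -> prim g G a b ->
  prim (fun t => c *: f t + g t) (fun t => c *: F t + G t) a b.
Proof.
move=> pF pG x xab e e0.
have c1 : 0 < cabs c + 1 by have := cabs_ge0 c; lra.
have e1 : 0 < e / 2 / (cabs c + 1) by apply: divr_gt0 => //; lra.
have e2 : 0 < e / 2 by lra.
have [d1 d10 H1] := pF x xab _ e1; have [d2 d20 H2] := pG x xab _ e2.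
exists (Num.min d1 d2); first by rewrite lt_min d10.
move=> y yab; rewrite lt_min => /andP[l1 l2].
have -> : c *: F y + G y - (c *: F x + G x) - (y - x)%:C *: (c *: f x + g x) =
  c *: (F y - F x - (y - x)%:C *: f x) + (G y - G x - (y - x)%:C *: g x) by modring.
apply: (le_trans (bn_triangle HN _ _)); rewrite (bn_scale HN).
have := H2 y yab l2; have h1 := H1 y yab l1.
have : cabs c * N (F y - F x - (y - x)%:C *: f x) <= e / 2 * `|y - x|.
  apply: (@le_trans _ _ ((cabs c + 1) * (e / 2 / (cabs c + 1) * `|y - x|))).
    by apply: ler_pM => //; rewrite ?cabs_ge0 ?bn_ge0 //; lra.
  by rewrite mulrA [_ * (_ / _)]mulrC divfK // gt_eqF.
lra.
Qed.

(* [Int g a b] is [0] if [g] has no primitive on [[a, b]]. *)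
Definition Int g a b : V := xget 0 [set v | exists2 G, prim g G a b & v = G b - G a].

Lemma Int_prim g G a b : a <= b -> prim g G a b -> Int g a b = G b - G a.
Proof.
move=> ab pG; rewrite /Int; case: xgetP => [v _ [H pH ->]|/(_ (G b - G a))]; last first.
  by case; exists G.
have := prim_lin (-1) pG pH => p0.
have : N ((- 1 *: G b + H b) - (- 1 *: G a + H a)) <= 0 * (b - a).
  by apply: prim_norm_cst p0 _ => // x _; rewrite scaleN1r addNr bn0.
rewrite mul0r => le0.
have /(bn_sep HN)/eqP : N (- 1 *: G b + H b - (- 1 *: G a + H a)) = 0.
  by apply/eqP; rewrite eq_le le0 bn_ge0.
rewrite !scaleN1r subr_eq0 => /eqP E.
have -> : H b = G b + (- G b + H b) by modring.
by rewrite E; modring.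
Qed.

Lemma Int_ex g a b : a <= b -> contI g a b ->
  exists2 G, prim g G a b & Int g a b = G b - G a.
Proof.
move=> ab cg; have [G pG] := prim_exists ab cg.
by exists G => //; apply: Int_prim.
Qed.

Lemma Int_lin (c : R[i]) f g a b : a <= b -> contI f a b -> contI g a b ->
  Int (fun t => c *: f t + g t) a b = c *: Int f a b + Int g a b.
Proof.
move=> ab /(Int_ex ab)[F pF ->] /(Int_ex ab)[G pG ->].
rewrite (Int_prim ab (prim_lin c pF pG)); modring.
Qed.

Lemma Int_cat g a b c : a <= b -> b <= c -> contI g a c ->
  Int g a c = Int g a b + Int g b c.
Proof.
move=> ab bc cg; have ac := le_trans ab bc; have [G pG ->] := Int_ex ac cg.
rewrite (Int_prim ab (prim_sub (lexx _) bc pG)) (Int_prim bc (prim_sub ab (lexx _) pG)).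
modring.
Qed.

Lemma Int_le (M : R) g a b : a <= b -> contI g a b ->
  (forall x, a <= x <= b -> N (g x) <= M) -> N (Int g a b) <= M * (b - a).
Proof. by move=> ab /(Int_ex ab)[G pG ->]; apply: prim_norm_cst. Qed.

Lemma Int_shift (s : R) g a b : a <= b -> contI g (a + s) (b + s) ->
  Int (fun t => g (t + s)) a b = Int g (a + s) (b + s).
Proof.
move=> ab cg; have [|G pG ->] := Int_ex _ cg; first lra.
rewrite (@Int_prim _ (fun t => G (t + s))) // => x xab e e0.
have [|d d0 Hd] := pG (x + s) _ e e0; first by rewrite !lerD2r.
exists d => // y yab yx; have := Hd (y + s).
by rewrite !lerD2r (_ : y + s - (x + s) = y - x); [apply|ring].
Qed.

Lemma Int_aff (p q : V) a b : a <= b ->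
  Int (fun t => p + t%:C *: q) a b = (b - a)%:C *: p + ((b ^+ 2 - a ^+ 2) / 2)%:C *: q.
Proof.
move=> ab; rewrite (@Int_prim _ (fun t => t%:C *: p + (t ^+ 2 / 2)%:C *: q)) //.
  have -> : (b ^+ 2 - a ^+ 2) / 2 = b ^+ 2 / 2 - a ^+ 2 / 2 by field.
  modring.
move=> x xab e e0; have q1 : 0 < N q + 1 by have := bn_ge0 q; lra.
exists (e / (N q + 1)); first exact: divr_gt0.
move=> y yab yx.
have -> : y%:C *: p + (y ^+ 2 / 2)%:C *: q - (x%:C *: p + (x ^+ 2 / 2)%:C *: q) -
  (y - x)%:C *: (p + x%:C *: q) = ((y - x) ^+ 2 / 2)%:C *: q.
  have -> : (y - x) ^+ 2 / 2 = y ^+ 2 / 2 - x ^+ 2 / 2 - (y - x) * x by field.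
  modring.
rewrite bn_scaleR normrM normrX [`|2^-1|]ger0_norm ?invr_ge0 // expr2 -!mulrA mulrC.
rewrite ler_wpM2r //; move: yx; rewrite ltr_pdivlMr // => yx.
apply: le_trans (ltW yx); apply: ler_wpM2l => //; have := bn_ge0 q; lra.
Qed.

Lemma contI_lin (c : R[i]) f g a b : contI f a b -> contI g a b ->
  contI (fun t => c *: f t + g t) a b.
Proof.
move=> cf cg x xab e e0.
have c1 : 0 < cabs c + 1 by have := cabs_ge0 c; lra.
have e1 : 0 < e / 2 / (cabs c + 1) by apply: divr_gt0 => //; lra.
have e2 : 0 < e / 2 by lra.
have [d1 d10 H1] := cf x xab _ e1; have [d2 d20 H2] := cg x xab _ e2.
exists (Num.min d1 d2); first by rewrite lt_min d10.
move=> y yab; rewrite lt_min => /andP[l1 l2].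
have -> : c *: f y + g y - (c *: f x + g x) = c *: (f y - f x) + (g y - g x) by modring.
apply: (le_trans (bn_triangle HN _ _)); rewrite (bn_scale HN).
have := H2 y yab l2; have h1 := H1 y yab l1.
have : cabs c * N (f y - f x) <= e / 2.
  apply: (@le_trans _ _ ((cabs c + 1) * (e / 2 / (cabs c + 1)))).
    by apply: ler_pM => //; rewrite ?cabs_ge0 ?bn_ge0 //; lra.
  by rewrite [_ * (_ / _)]mulrC divfK // gt_eqF.
lra.
Qed.

Lemma contI_bounded g a b : a <= b -> contI g a b ->
  exists2 M, 0 <= M & forall x, a <= x <= b -> N (g x) <= M.
Proof.
move=> ab cg.
pose P u v := exists2 M, 0 <= M & forall x, u <= x <= v -> N (g x) <= M.
suff : P a b by [].
apply: (@segment_ind R P) => //.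
  move=> x xab; have [d d0 Hd] := cg x xab 1 ltr01; exists d => // u v au ux xv vb xu vx.
  exists (N (g x) + 1); first by have := bn_ge0 (g x); lra.
  move=> y /andP[uy yv]; have := bn_triangle HN (g y - g x) (g x); rewrite subrK.
  have := Hd y ltac:(apply/andP; split; lra) ltac:(rewrite ltr_norml; apply/andP; split; lra).
  lra.
move=> u v w au uv vw wb [M1 M10 H1] [M2 M20 H2]; exists (M1 + M2); first lra.
move=> x /andP[ux xw]; have [xv|vx] := leP x v.
  by have := H1 x ltac:(by rewrite ux xv); lra.
by have := H2 x ltac:(by rewrite xw (ltW vx)); lra.
Qed.

Lemma contI_scale (c : R -> R[i]) f a b : a <= b ->
  (forall x, a <= x <= b -> forall e, 0 < e -> exists2 d, 0 < d &
     forall y, a <= y <= b -> `|y - x| < d -> cabs (c y - c x) <= e) ->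
  contI f a b -> contI (fun t => c t *: f t) a b.
Proof.
move=> ab cc cf x xab e e0; have [M M0 HM] := contI_bounded ab cf.
have c1 : 0 < cabs (c x) + 1 by have := cabs_ge0 (c x); lra.
have M1 : 0 < M + 1 by lra.
have e2 : 0 < e / 2 / (M + 1) by apply: divr_gt0 => //; lra.
have e3 : 0 < e / 2 / (cabs (c x) + 1) by apply: divr_gt0 => //; lra.
have [d1 d10 H1] := cf x xab _ e3.
have [d2 d20 H2] := cc x xab _ e2.
exists (Num.min d1 d2); first by rewrite lt_min d10.
move=> y yab; rewrite lt_min => /andP[l1 l2].
have h1 := H1 y yab l1; have h2 := H2 y yab l2.
have -> : c y *: f y - c x *: f x = (c y - c x) *: f y + c x *: (f y - f x) by modring.
apply: (le_trans (bn_triangle HN _ _)); rewrite !(bn_scale HN).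
have : cabs (c y - c x) * N (f y) <= e / 2 / (M + 1) * (M + 1).
  by apply: ler_pM; rewrite ?cabs_ge0 ?bn_ge0 //; have := HM y yab; lra.
have : cabs (c x) * N (f y - f x) <= (cabs (c x) + 1) * (e / 2 / (cabs (c x) + 1)).
  by apply: ler_pM; rewrite ?cabs_ge0 ?bn_ge0 //; lra.
rewrite divfK ?gt_eqF // [_ * (_ / _)]mulrC divfK ?gt_eqF //; lra.
Qed.

End Integral.

Lemma Int_map (R : realType) (V W : lmodType R[i]) (N : V -> R) (N' : W -> R)
    (HN : bnorm N) (HN' : bnorm N') (L : V -> W) (c : R) (g : R -> V) (a b : R) :
  (forall (k : R[i]) p q, L (k *: p + q) = k *: L p + L q) ->
  (forall p, N' (L p) <= c * N p) -> a <= b -> contI N g a b ->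
  L (Int N g a b) = Int N' (L \o g) a b.
Proof.
move=> Ll Lc ab /(Int_ex HN ab)[G pG ->].
have L0 : L 0 = 0.
  by have := Ll 1 0 0; rewrite !scale1r addr0 => /eqP; rewrite -[X in X == _]addr0
    (inj_eq (addrI _)) => /eqP.
have LZ k p : L (k *: p) = k *: L p by rewrite -[k *: p]addr0 Ll L0 addr0.
have LB p q : L (p - q) = L p - L q.
  by rewrite -scaleN1r addrC Ll scaleN1r addrC.
rewrite LB (@Int_prim _ _ _ HN' _ (L \o G)) //= => x xab e e0.
have c1 : 0 < `|c| + 1 by have := normr_ge0 c; lra.
have [d d0 Hd] := pG x xab (e / (`|c| + 1)) ltac:(exact: divr_gt0).
exists d => // y yab yx; have h := Hd y yab yx.
rewrite -!(LB, LZ); apply: (le_trans (Lc _)).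
apply: (@le_trans _ _ ((`|c| + 1) * (e / (`|c| + 1) * `|y - x|))).
  apply: (@le_trans _ _ ((`|c| + 1) * N (G y - G x - (y - x)%:C *: g x))).
    by apply: ler_wpM2r; [exact: bn_ge0|have := ler_norm c; lra].
  by apply: ler_wpM2l => //; lra.
by rewrite mulrA [_ * (_ / _)]mulrC divfK // gt_eqF.
Qed.

Lemma nested_segments (R : realType) (x w : nat -> R) :
  (forall n, 0 <= w n) -> (forall n, x n <= x n.+1) ->
  (forall n, x n.+1 + w n.+1 <= x n + w n) ->
  exists p, forall n, x n <= p <= x n + w n.
Proof.
move=> w0 xS xwS.
have xle n m : (n <= m)%N -> x n <= x m.
  by move=> /subnK <-; elim: (m - n)%N => // k; rewrite addSn => /le_trans; apply.
have xwle n m : (n <= m)%N -> x m + w m <= x n + w n.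
  by move=> /subnK <-; elim: (m - n)%N => // k; rewrite addSn => IH; apply: le_trans IH.
have xw n m : x n <= x m + w m.
  have [nm|mn] := leqP n m.
    by apply: (le_trans (xle _ _ nm)); have := w0 m; lra.
  by apply: le_trans (xwle _ _ (ltnW mn)); have := w0 n; lra.
have ne : range x !=set0 by exists (x 0%N); exists 0%N.
have ub m : ubound (range x) (x m + w m) by move=> _ [n _ <-].
exists (sup (range x)) => n; rewrite ub_le_sup //=; last by exists n.
  by apply: ge_sup.
by exists (x 0%N + w 0%N).
Qed.

(** * Cauchy's theorem on rectangles *)

Section Rectangles.
Context (R : realType) (V : lmodType R[i]) (N : V -> R) (HN : bnorm N).
Implicit Types (a b c d e x y u v : R) (z p : R[i]) (H : R[i] -> V) (D : set R[i]).

Definition ccont H D := forall z, D z -> forall e, 0 < e ->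
  exists2 r, 0 < r & forall z', D z' -> cabs (z' - z) < r -> N (H z' - H z) <= e.

(** Differentiability relative to [D]: at a boundary point only increments staying in [D] are
    tested. *)
Definition cdiff H D z := exists q : V, forall e, 0 < e ->
  exists2 r, 0 < r & forall z', D z' -> cabs (z' - z) < r ->
    N (H z' - H z - (z' - z) *: q) <= e * cabs (z' - z).

Definition box a b c d : set R[i] :=
  [set z | (a <= complex.Re z <= b) && (c <= complex.Im z <= d)].

(** The integral of [H dz] counterclockwise along the boundary of the box. *)
Definition rect H a b c d : V :=
  Int N (fun s => H (s +i* c)) a b - Int N (fun s => H (s +i* d)) a b
  + 'i%C *: (Int N (fun t => H (b +i* t)) c d - Int N (fun t => H (a +i* t)) c d).

Lemma cdiff_cont H D z : cdiff H D z -> forall e, 0 < e ->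
  exists2 r, 0 < r & forall z', D z' -> cabs (z' - z) < r -> N (H z' - H z) <= e.
Proof.
move=> [q Hq] e e0; have [r r0 Hr] := Hq 1 ltr01.
have q1 : 0 < N q + 1 by have := bn_ge0 HN q; lra.
exists (Num.min r (e / (N q + 1))); first by rewrite lt_min r0 divr_gt0.
move=> z' Dz'; rewrite lt_min ltr_pdivlMr // => /andP[l1 l2].
have := Hr z' Dz' l1; rewrite mul1r.
have := bn_triangle HN (H z' - H z - (z' - z) *: q) ((z' - z) *: q).
by rewrite subrK (bn_scale HN); move: l2; rewrite mulrDr mulr1; lra.
Qed.

Lemma ccont_sub H D D' : D' `<=` D -> ccont H D -> ccont H D'.
Proof.
move=> sub cH z Dz e e0; have [r r0 Hr] := cH z (sub _ Dz) e e0.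
by exists r => // z' /sub; apply: Hr.
Qed.

Lemma cdiff_sub H D D' z : D' `<=` D -> cdiff H D z -> cdiff H D' z.
Proof.
move=> sub [q Hq]; exists q => e e0; have [r r0 Hr] := Hq e e0.
by exists r => // z' /sub; apply: Hr.
Qed.

Lemma box_sub a b c d a' b' c' d' : a <= a' -> b' <= b -> c <= c' -> d' <= d ->
  box a' b' c' d' `<=` box a b c d.
Proof.
by move=> ? ? ? ? z /= /andP[/andP[? ?] /andP[? ?]]; apply/andP; split; apply/andP; split; lra.
Qed.

Lemma contI_h H a b c d y : c <= y <= d -> ccont H (box a b c d) ->
  contI N (fun s => H (s +i* y)) a b.
Proof.
move=> ycd cH x xab e e0; have [|r r0 Hr] := cH (x +i* y) _ e e0; first by rewrite /box /= xab.
exists r => // s sab sx; apply: Hr; first by rewrite /box /= sab.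
by rewrite (_ : _ - _ = (s - x)%:C) ?cabsR //; apply/eqP; rewrite eq_complex /= subrr !eqxx.
Qed.

Lemma contI_v H a b c d x : a <= x <= b -> ccont H (box a b c d) ->
  contI N (fun t => H (x +i* t)) c d.
Proof.
move=> xab cH y ycd e e0; have [|r r0 Hr] := cH (x +i* y) _ e e0; first by rewrite /box /= xab.
exists r => // s scd sy; apply: Hr; first by rewrite /box /= xab.
by rewrite (_ : _ - _ = 0 +i* (s - y)) ?cabsI //; apply/eqP; rewrite eq_complex /= subrr !eqxx.
Qed.

Lemma rect_hcat H a b b' c d : a <= b -> b <= b' -> c <= d -> ccont H (box a b' c d) ->
  rect H a b' c d = rect H a b c d + rect H b b' c d.
Proof.
move=> ab bb' cd cH; rewrite /rect.
rewrite (Int_cat HN ab bb' (contI_h (y := c) _ cH)) ?lexx //.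
rewrite (Int_cat HN ab bb' (contI_h (y := d) _ cH)) ?lexx ?andbT //.
modring.
Qed.

Lemma rect_vcat H a b c c' d : a <= b -> c <= c' -> c' <= d -> ccont H (box a b c d) ->
  rect H a b c d = rect H a b c c' + rect H a b c' d.
Proof.
move=> ab cc cd cH; rewrite /rect.
rewrite (Int_cat HN cc cd (contI_v (x := a) _ cH)) ?lexx //.
rewrite (Int_cat HN cc cd (contI_v (x := b) _ cH)) ?lexx ?andbT //.
modring.
Qed.

Lemma rect_le M H a b c d : a <= b -> c <= d -> ccont H (box a b c d) ->
  (forall z, box a b c d z -> N (H z) <= M) ->
  N (rect H a b c d) <= M * (2 * (b - a) + 2 * (d - c)).
Proof.
move=> ab cd cH HM; rewrite /rect.
have h1 : N (Int N (fun s => H (s +i* c)) a b) <= M * (b - a).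
  apply: (Int_le HN ab (contI_h _ cH)); rewrite ?lexx // => x xab.
  by apply: HM; rewrite /box /= xab lexx.
have h2 : N (Int N (fun s => H (s +i* d)) a b) <= M * (b - a).
  apply: (Int_le HN ab (contI_h _ cH)); rewrite ?lexx ?andbT // => x xab.
  by apply: HM; rewrite /box /= xab lexx andbT.
have h3 : N (Int N (fun t => H (b +i* t)) c d) <= M * (d - c).
  apply: (Int_le HN cd (contI_v _ cH)); rewrite ?lexx ?andbT // => x xab.
  by apply: HM; rewrite /box /= xab lexx ?andbT.
have h4 : N (Int N (fun t => H (a +i* t)) c d) <= M * (d - c).
  apply: (Int_le HN cd (contI_v _ cH)); rewrite ?lexx // => x xab.
  by apply: HM; rewrite /box /= xab lexx ?andbT.
set A := Int _ _ _ _ in h1 *; set B := Int _ _ _ _ in h2 *.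
set E := Int _ _ _ _ in h3 *; set F := Int _ _ _ _ in h4 *.
have := bn_triangle HN (A - B) ('i%C *: (E - F)); rewrite (bn_scale HN).
rewrite (_ : cabs 'i%C = 1) ?mul1r; last by rewrite cabsI normr1.
have := bnB HN A B; have := bnB HN E F; lra.
Qed.

Lemma rect_aff (p q : V) a b c d : a <= b -> c <= d ->
  rect (fun z => p + z *: q) a b c d = 0.
Proof.
move=> ab cd; rewrite /rect.
have hE y : Int N (fun s => p + (s +i* y) *: q) a b =
    (b - a)%:C *: (p + ('i%C * y%:C) *: q) + ((b ^+ 2 - a ^+ 2) / 2)%:C *: q.
  rewrite -(Int_aff HN) //; congr Int; apply/funext => s.
  have -> : s +i* y = s%:C + 'i%C * y%:C.
    by apply/eqP; rewrite eq_complex /=; apply/andP; split; apply/eqP; ring.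
  modring.
have vE x : Int N (fun t => p + (x +i* t) *: q) c d =
    (d - c)%:C *: (p + x%:C *: q) + ((d ^+ 2 - c ^+ 2) / 2)%:C *: ('i%C *: q).
  rewrite -(Int_aff HN) //; congr Int; apply/funext => s.
  have -> : x +i* s = x%:C + 'i%C * s%:C.
    by apply/eqP; rewrite eq_complex /=; apply/andP; split; apply/eqP; ring.
  modring.
rewrite !hE !vE; modring.
Qed.

Lemma rect_subaff (p q : V) H a b c d : a <= b -> c <= d -> ccont H (box a b c d) ->
  rect (fun z => H z - (p + z *: q)) a b c d = rect H a b c d.
Proof.
move=> ab cd cH; rewrite -[RHS]subr0 -(rect_aff p q ab cd) /rect.
have cA : ccont (fun z => p + z *: q) (box a b c d).
  move=> z _ e e0; have q1 : 0 < N q + 1 by have := bn_ge0 HN q; lra.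
  exists (e / (N q + 1)); first exact: divr_gt0.
  move=> z' _; rewrite ltr_pdivlMr // => l.
  have -> : p + z' *: q - (p + z *: q) = (z' - z) *: q by modring.
  rewrite (bn_scale HN); apply: le_trans (ltW l); apply: ler_wpM2l; last lra.
  exact: cabs_ge0.
have I1 y : c <= y <= d -> Int N (fun s => H (s +i* y) - (p + (s +i* y) *: q)) a b =
   - 1 *: Int N (fun s => p + (s +i* y) *: q) a b + Int N (fun s => H (s +i* y)) a b.
  move=> ycd; rewrite -(Int_lin HN) //; [|exact: contI_h cA|exact: contI_h cH].
  by congr Int; apply/funext => s; modring.
have I2 x : a <= x <= b -> Int N (fun s => H (x +i* s) - (p + (x +i* s) *: q)) c d =
   - 1 *: Int N (fun s => p + (x +i* s) *: q) c d + Int N (fun s => H (x +i* s)) c d.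
  move=> ycd; rewrite -(Int_lin HN) //; [|exact: contI_v cA|exact: contI_v cH].
  by congr Int; apply/funext => s; modring.
rewrite !I1 ?I2 ?lexx ?ab ?cd //; modring.
Qed.

Lemma rect_quarter H a b c d e : a <= b -> c <= d -> ccont H (box a b c d) ->
  4 * e < N (rect H a b c d) -> exists x y,
  [/\ a <= x, x + (b - a) / 2 <= b, c <= y, y + (d - c) / 2 <= d &
      e < N (rect H x (x + (b - a) / 2) y (y + (d - c) / 2))].
Proof.
move=> ab cd cH big.
pose m := a + (b - a) / 2; pose n := c + (d - c) / 2.
have am : a <= m by rewrite /m; lra.
have mb : m <= b by rewrite /m; lra.
have cn : c <= n by rewrite /n; lra.
have nd : n <= d by rewrite /n; lra.
have mE : m + (b - a) / 2 = b by rewrite /m; lra.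
have nE : n + (d - c) / 2 = d by rewrite /n; lra.
apply: contrapT => no.
have small x y : a <= x -> x + (b - a) / 2 <= b -> c <= y -> y + (d - c) / 2 <= d ->
    N (rect H x (x + (b - a) / 2) y (y + (d - c) / 2)) <= e.
  move=> ax xb cy yd; rewrite leNgt; apply/negP => lt; apply: no.
  by exists x, y.
move: big; rewrite (rect_hcat am mb cd cH).
rewrite (rect_vcat am cn nd); last by apply: ccont_sub cH; apply: box_sub; lra.
rewrite (rect_vcat mb cn nd); last by apply: ccont_sub cH; apply: box_sub; lra.
have h1 := small a c (lexx _) mb (lexx _) nd.
have h2 := small m c am ltac:(lra) (lexx _) nd.
have h3 := small a n (lexx _) mb cn ltac:(lra).
have h4 := small m n am ltac:(lra) cn ltac:(lra).
rewrite mE in h2 h4; rewrite nE in h3 h4.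
rewrite -!/m -!/n in h1 h2 h3 h4.
have := bn_triangle HN (rect H a m c n + rect H a m n d) (rect H m b c n + rect H m b n d).
have := bn_triangle HN (rect H a m c n) (rect H a m n d).
have := bn_triangle HN (rect H m b c n) (rect H m b n d).
lra.
Qed.

(** Bisection: some quarter keeps a quarter of the integral while the sides are halved, so the lower
    bound [e * (L / 2 ^+ n) ^+ 2] survives. At the common point the affine approximation of [H]
    integrates to zero, and the remainder is too small for that bound. *)
Lemma goursat H a b c d : a <= b -> c <= d ->
  (forall z, box a b c d z -> cdiff H (box a b c d) z) -> rect H a b c d = 0.
Proof.
move=> ab cd dH.
have cH : ccont H (box a b c d) by move=> z Dz; apply: cdiff_cont; apply: dH.
pose L := (b - a) + (d - c).
have L0 : 0 <= L by rewrite /L; lra.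
apply: (bn_sep HN); apply/eqP; rewrite eq_le bn_ge0 // andbT.
apply: (@ler_addeps _ _ _ (L ^+ 2)); first exact: sqr_ge0.
move=> e e0; rewrite add0r leNgt; apply/negP => big.
pose w n := (b - a) / 2 ^+ n; pose h n := (d - c) / 2 ^+ n.
have pw n : 0 < (2 : R) ^+ n by rewrite exprn_gt0.
have w0 n : 0 <= w n by apply: divr_ge0; [lra|exact: ltW].
have h0 n : 0 <= h n by apply: divr_ge0; [lra|exact: ltW].
have wS n : w n.+1 = w n / 2 by rewrite /w exprS invfM [2^-1 * _]mulrC mulrA.
have hS n : h n.+1 = h n / 2 by rewrite /h exprS invfM [2^-1 * _]mulrC mulrA.
pose bad n (q : R * R) := [/\ a <= q.1, q.1 + w n <= b, c <= q.2, q.2 + h n <= d &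
  e * (L / 2 ^+ n) ^+ 2 < N (rect H q.1 (q.1 + w n) q.2 (q.2 + h n))].
have nxt (nq : nat * (R * R)) : exists q', bad nq.1 nq.2 -> bad nq.1.+1 q' /\
   [/\ nq.2.1 <= q'.1, q'.1 + w nq.1.+1 <= nq.2.1 + w nq.1,
      nq.2.2 <= q'.2 & q'.2 + h nq.1.+1 <= nq.2.2 + h nq.1].
  (* Where the current rectangle is not [bad], the successor is the arbitrary [(0, 0)], which makes
     the choice function total. *)
  case: nq => n [x y]; have [[/= ax xb cy yd lt]|nbad] := pselect (bad n (x, y)); last by exists (0, 0).
  have [| | | |x' [y' [xx' xb' yy' yd' lt']]] :=
    @rect_quarter H x (x + w n) y (y + h n) (e * (L / 2 ^+ n.+1) ^+ 2).
  - by have := w0 n; lra.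
  - by have := h0 n; lra.
  - by apply: ccont_sub cH; apply: box_sub; lra.
  - apply: le_lt_trans lt; rewrite [2 ^+ n.+1]exprS invfM; move: (_ ^- n) => k.
    by apply: eq_leW; field.
  move: xb' yd' lt'; rewrite ![_ + _ n - _]addrC !addKr -wS -hS => xb' yd' lt'.
  exists (x', y') => _; split; split=> //=; lra.
have [f Hf] := choice nxt.
pose s := fix s n := if n is m.+1 then f (m, s m) else (a, c).
have sbad n : bad n (s n).
  elim: n => [|n IH]; last by have [] := Hf (n, s n) IH.
  by rewrite /bad /w /h expr0 !divr1 /=; split; rewrite ?lexx // addrC subrK ?lexx // addrC subrK.
have sS n := (Hf (n, s n) (sbad n)).2.
have [px Hpx] : exists p : R, forall n, (s n).1 <= p <= (s n).1 + w n.
  by apply: nested_segments => // n; have [] := sS n.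
have [py Hpy] : exists p : R, forall n, (s n).2 <= p <= (s n).2 + h n.
  by apply: nested_segments => // n; have [] := sS n.
have pD : box a b c d (px +i* py).
  by have := Hpx 0%N; have := Hpy 0%N; rewrite /box /= /w /h expr0 !divr1 ![_ + (_ - _)]addrC !subrK => -> ->.
(* [e / 2] because the perimeter is [2 * (w n + h n)] and every point of the small rectangle is
   within [w n + h n = L / 2 ^+ n] of [p]: the product is the bound to be contradicted. *)
have [q Hq] := dH _ pD; have [|r r0 Hr] := Hq (e / 2); first lra.
have [n Hn] : exists n, L / 2 ^+ n < r.
  have r1 : 0 < r / (L + 1) by apply: divr_gt0; lra.
  have [n /(_ n (leqnn n))] := pow2_lt r1; rewrite ler_pdivlMr; last lra.
  by move=> hn; exists n; have := pw n; rewrite -invr_gt0; move: hn; rewrite mulrC; lra.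
have [ax xb cy yd lt] := sbad n.
have sub : box (s n).1 ((s n).1 + w n) (s n).2 ((s n).2 + h n) `<=` box a b c d.
  exact: box_sub.
have cHn := ccont_sub sub cH.
move: lt; apply/negP; rewrite -leNgt.
pose p0 := px +i* py.
have wn := w0 n; have hn := h0 n.
have le1 : (s n).1 <= (s n).1 + w n by lra.
have le2 : (s n).2 <= (s n).2 + h n by lra.
rewrite -(rect_subaff (H p0 - p0 *: q) q le1 le2 cHn).
have wh : w n + h n = L / 2 ^+ n by rewrite /w /h /L [RHS]mulrDl.
apply: (le_trans (@rect_le (e / 2 * (L / 2 ^+ n)) _ _ _ _ _ le1 le2 _ _)).
- move=> z Dz e' e'0; have [r1 r10 H1] := cHn z Dz (e' / 2) ltac:(lra).
  have q1 : 0 < N q + 1 by have := bn_ge0 HN q; lra.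
  exists (Num.min r1 (e' / 2 / (N q + 1))).
    by rewrite lt_min r10 divr_gt0 //; lra.
  move=> z' Dz'; rewrite lt_min ltr_pdivlMr // => /andP[l1 l2].
  have -> : H z' - (H p0 - p0 *: q + z' *: q) - (H z - (H p0 - p0 *: q + z *: q)) =
    (H z' - H z) - (z' - z) *: q by modring.
  have := bnB HN (H z' - H z) ((z' - z) *: q); rewrite (bn_scale HN).
  have := H1 z' Dz' l1; have := cabs_ge0 (z' - z); nra.
- move=> z Dz.
  have zp : cabs (z - p0) <= L / 2 ^+ n.
    apply: (le_trans (cabs_le _)); rewrite -wh; case: z Dz => zx zy; rewrite /box /= => /andP[/andP[? ?] /andP[? ?]].
    have /andP[? ?] := Hpx n; have /andP[? ?] := Hpy n.
    rewrite /p0 /=; apply: lerD; rewrite ler_norml; apply/andP; split; lra.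
  have -> : H z - (H p0 - p0 *: q + z *: q) = H z - H p0 - (z - p0) *: q by modring.
  apply: (le_trans (Hr z (sub _ Dz) (le_lt_trans zp Hn))).
  by apply: ler_wpM2l => //; lra.
- by rewrite ![_ + _ n - _]addrC !addKr -mulrDr wh; move: (L / _) => k; apply: eq_leW; field.
Qed.

Lemma vert_unif H a b c d x0 : a <= x0 <= b -> c <= d -> ccont H (box a b c d) ->
  forall e, 0 < e -> exists2 r, 0 < r & forall x t, a <= x <= b -> `|x - x0| < r ->
    c <= t <= d -> N (H (x +i* t) - H (x0 +i* t)) <= e.
Proof.
move=> x0ab cd cH e e0.
pose P u v := exists2 r, 0 < r & forall x t, a <= x <= b -> `|x - x0| < r ->
    u <= t <= v -> N (H (x +i* t) - H (x0 +i* t)) <= e.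
suff : P c d by [].
apply: (@segment_ind R P) => //; last first.
  move=> u v w _ uv vw _ [r1 r10 H1] [r2 r20 H2].
  exists (Num.min r1 r2); first by rewrite lt_min r10.
  move=> x t xab; rewrite lt_min => /andP[l1 l2] /andP[ut tw].
  have [tv|vt] := leP t v; first by apply: H1 => //; rewrite ut.
  by apply: H2 => //; rewrite tw (ltW vt).
move=> t0 t0cd; have [|r r0 Hr] := cH (x0 +i* t0) _ (e / 2) ltac:(lra).
  by rewrite /box /= x0ab.
exists (r / 2); first lra.
move=> u v cu ut tv vd tu vt; exists (r / 2); first lra.
move=> x t xab xx /andP[ut' t'v].
have tt : `|t - t0| < r / 2 by rewrite ltr_norml; apply/andP; split; lra.
have tcd : c <= t <= d by apply/andP; split; lra.
have h1 : N (H (x +i* t) - H (x0 +i* t0)) <= e / 2.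
  apply: Hr; first by rewrite /box /= xab.
  by apply: le_lt_trans (cabs_le _) _ => /=; lra.
have h2 : N (H (x0 +i* t) - H (x0 +i* t0)) <= e / 2.
  apply: Hr; first by rewrite /box /= x0ab.
  by apply: le_lt_trans (cabs_le _) _ => /=; rewrite subrr normr0; lra.
by have := bn_trans HN (H (x0 +i* t0)) (H (x +i* t)) (H (x0 +i* t)); rewrite (bn_sym HN (H (x0 +i* t0))); lra.
Qed.

(** The horizontal sides are short, and the vertical ones are traversed in opposite directions and
    nearly cancel by [vert_unif]. *)
Lemma rect_thin H a b c d x0 : a <= x0 <= b -> c <= d -> ccont H (box a b c d) ->
  forall e, 0 < e -> exists2 r, 0 < r & forall u v, a <= u -> u <= v -> v <= b ->
    `|u - x0| < r -> `|v - x0| < r -> N (rect H u v c d) <= e.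
Proof.
move=> x0ab cd cH e e0.
have ab : a <= b by case/andP: x0ab; apply: le_trans.
have ccd : c <= c <= d by rewrite lexx.
have dcd : c <= d <= d by rewrite lexx andbT.
have [M1 M10 HM1] := contI_bounded HN ab (contI_h ccd cH).
have [M2 M20 HM2] := contI_bounded HN ab (contI_h dcd cH).
have k0 : 0 < e / (8 * (d - c + 1)) by apply: divr_gt0; lra.
have [r1 r10 H1] := vert_unif x0ab cd cH k0.
have m0 : 0 < e / (4 * (M1 + M2 + 1)) by apply: divr_gt0; lra.
exists (Num.min r1 (e / (4 * (M1 + M2 + 1)))); first by rewrite lt_min r10.
move=> u v au uv vb; rewrite !lt_min => /andP[u1 u2] /andP[v1 v2].
have sub : box u v c d `<=` box a b c d by apply: box_sub; lra.
have cHs := ccont_sub sub cH.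
have I1 : N (Int N (fun s => H (s +i* c)) u v) <= M1 * (v - u).
  apply: (Int_le HN uv (contI_h _ cHs)); rewrite ?lexx // => x /andP[ux xv].
  by apply: HM1; apply/andP; split; lra.
have I2 : N (Int N (fun s => H (s +i* d)) u v) <= M2 * (v - u).
  apply: (Int_le HN uv (contI_h _ cHs)); rewrite ?lexx ?andbT // => x /andP[ux xv].
  by apply: HM2; apply/andP; split; lra.
have cu : contI N (fun t => H (u +i* t)) c d by apply: (contI_v _ cHs); rewrite lexx.
have cv : contI N (fun t => H (v +i* t)) c d by apply: (contI_v _ cHs); rewrite lexx andbT.
have I3 : N (Int N (fun t => - 1 *: H (u +i* t) + H (v +i* t)) c d)
    <= 2 * (e / (8 * (d - c + 1))) * (d - c).
  apply: (Int_le HN cd); first exact: contI_lin.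
  move=> t tcd; rewrite scaleN1r addrC.
  have := bn_trans HN (H (x0 +i* t)) (H (v +i* t)) (H (u +i* t)).
  have h1 := H1 u t ltac:(apply/andP; split; lra) u1 tcd.
  have h2 := H1 v t ltac:(apply/andP; split; lra) v1 tcd.
  rewrite (bn_sym HN (H (x0 +i* t))); lra.
rewrite (Int_lin HN) // scaleN1r addrC in I3.
have vu : v - u <= 2 * (e / (4 * (M1 + M2 + 1))).
  by move: u2 v2; rewrite !ltr_norml => /andP[? ?] /andP[? ?]; lra.
have J1 : (M1 + M2) * (v - u) <= e / 2.
  apply: (@le_trans _ _ ((M1 + M2 + 1) * (2 * (e / (4 * (M1 + M2 + 1)))))).
    by apply: ler_pM => //; lra.
  have [nz1 nz2] : M1 + M2 + 1 != 0 /\ (4 : R) != 0 by split; apply: lt0r_neq0; lra.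
  by apply: eq_leW; field; rewrite nz1.
have J2 : 2 * (e / (8 * (d - c + 1))) * (d - c) <= e / 4.
  apply: (@le_trans _ _ (2 * (e / (8 * (d - c + 1))) * (d - c + 1))).
    by apply: ler_wpM2l; lra.
  have nz1 : d - c + 1 != 0 by apply: lt0r_neq0; lra.
  by apply: eq_leW; field.
rewrite /rect; set A := Int _ _ _ _ in I1 *; set B := Int _ _ _ _ in I2 *.
set E := _ - Int _ _ _ _ in I3 *.
have := bn_triangle HN (A - B) ('i%C *: E); rewrite (bn_scale HN).
rewrite (_ : cabs 'i%C = 1) ?mul1r; last by rewrite cabsI normr1.
have := bnB HN A B; lra.
Qed.

(** Thin rectangles are cut off at the left and right ends; their integrals are small, and [goursat]
    applies in between. This admits functions that are merely continuous on the two vertical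
    sides. *)
Lemma rect_interior H a b c d : a <= b -> c <= d -> ccont H (box a b c d) ->
  (forall z, box a b c d z -> a < complex.Re z < b -> cdiff H (box a b c d) z) ->
  rect H a b c d = 0.
Proof.
move=> ab cd cH dH.
apply: (bn_sep HN); apply/eqP; rewrite eq_le bn_ge0 // andbT.
apply/ler_addgt0Pr => e e0; rewrite add0r.
have [|r1 r10 H1] := rect_thin (x0 := a) _ cd cH (e := e / 2) ltac:(lra); first by rewrite lexx.
have [|r2 r20 H2] := rect_thin (x0 := b) _ cd cH (e := e / 2) ltac:(lra); first by rewrite lexx andbT.
have [->|ab'] := eqVneq a b; first by apply: (le_trans (H2 b b _ _ _ _ _)); rewrite ?subrr ?normr0; lra.
have {}ab' : a < b by rewrite lt_neqAle ab' ab.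
pose k := Num.min (Num.min r1 r2) (b - a) / 3.
have k0 : 0 < Num.min (Num.min r1 r2) (b - a) by rewrite !lt_min r10 r20; lra.
have k1 : Num.min (Num.min r1 r2) (b - a) <= r1 by rewrite !ge_min lexx.
have k2 : Num.min (Num.min r1 r2) (b - a) <= r2 by rewrite !ge_min lexx orbT.
have k3 : Num.min (Num.min r1 r2) (b - a) <= b - a by rewrite !ge_min lexx orbT.
have kpos : 0 < k by rewrite /k; lra.
have E1 : a <= a + k by lra.
have E2 : a + k <= b - k by rewrite /k; lra.
have E3 : b - k <= b by rewrite /k; lra.
have s1 : box (a + k) b c d `<=` box a b c d by apply: box_sub; lra.
have s2 : box (a + k) (b - k) c d `<=` box a b c d by apply: box_sub; lra.
rewrite (rect_hcat E1 (le_trans E2 E3) cd cH) (rect_hcat E2 E3 cd (ccont_sub s1 cH)).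
rewrite (@goursat H (a + k) (b - k)) // ?add0r; last first.
  move=> z Dz; apply: (cdiff_sub s2); apply: dH; first exact: s2.
  by case/andP: Dz => /andP[? ?] _; apply/andP; split; lra.
apply: (le_trans (bn_triangle HN _ _)).
have := H1 a (a + k) (lexx _) E1 ltac:(lra).
rewrite subrr normr0 addrC addKr ger0_norm; last by rewrite /k; lra.
have := H2 (b - k) b ltac:(lra) E3 (lexx _).
rewrite subrr normr0 [b - k]addrC addrK normrN ger0_norm; last by rewrite /k; lra.
have kr1 : k < r1 by rewrite /k; lra.
have kr2 : k < r2 by rewrite /k; lra.
by move=> /(_ kr2 r20) ? /(_ r10 kr1) ?; lra.
Qed.

(** Cutting along an exceptional vertical line turns it into a side of both pieces, where continuity
    is enough. Whole lines are exempted instead of points, so that cuts in one direction suffice. *)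
Lemma rect_except H (E : seq R) a b c d : a <= b -> c <= d -> ccont H (box a b c d) ->
  (forall z, box a b c d z -> a < complex.Re z < b -> complex.Re z \notin E ->
     cdiff H (box a b c d) z) ->
  rect H a b c d = 0.
Proof.
move=> + cd; elim: E a b => [|s E IH] a b ab cH dH.
  by apply: rect_interior => // z Dz zab; apply: dH.
have [/andP[as_ sb]|nsab] := boolP (a < s < b); last first.
  apply: IH => // z Dz zab zE; apply: dH => //.
  by rewrite inE negb_or zE andbT; apply: contraNneq nsab => <-.
have s1 : box a s c d `<=` box a b c d by apply: box_sub; lra.
have s2 : box s b c d `<=` box a b c d by apply: box_sub; lra.
rewrite (rect_hcat (ltW as_) (ltW sb) cd cH) !IH ?addr0 //; try exact: ltW.
- exact: ccont_sub cH.
- move=> z Dz /andP[sz zb] zE; apply: (cdiff_sub s2); apply: dH; first exact: s2.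
    by rewrite zb andbT; lra.
  by rewrite inE negb_or zE andbT gt_eqF.
- exact: ccont_sub cH.
- move=> z Dz /andP[sz zb] zE; apply: (cdiff_sub s1); apply: dH; first exact: s1.
    by rewrite sz /=; lra.
  by rewrite inE negb_or zE andbT lt_eqF.
Qed.

End Rectangles.

(** * The Cauchy kernel and improper integrals *)

Section Decay.
Context (R : realType).
Implicit Types (x y s t u v d e : R).

Definition decay t : R := (1 + `|t|) ^- 2.

(* A bounded function growing at least as fast as a primitive of [decay]. *)
Definition sigmoid t : R := t / (1 + `|t|).

Lemma norm1_gt0 t : 0 < 1 + `|t|. Proof. by have := normr_ge0 t; lra. Qed.

Lemma sigmoid_incr x y : x <= y ->
  (y - x) / ((1 + `|x|) * (1 + `|y|)) <= sigmoid y - sigmoid x.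
Proof.
move=> xy; have x1 := norm1_gt0 x; have y1 := norm1_gt0 y.
have -> : sigmoid y - sigmoid x =
    (y * (1 + `|x|) - x * (1 + `|y|)) / ((1 + `|x|) * (1 + `|y|)).
  by rewrite /sigmoid; field; rewrite !gt_eqF.
rewrite ler_wpM2r // ?invr_ge0 ?mulr_ge0 ?(ltW x1) ?(ltW y1) //.
have [x0|x0] := leP 0 x; have [y0|y0] := leP 0 y;
  rewrite ?(ger0_norm x0) ?(ger0_norm y0) ?(ltr0_norm x0) ?(ltr0_norm y0); nra.
Qed.

Lemma sigmoid_le1 t : `|sigmoid t| <= 1.
Proof.
rewrite /sigmoid normrM normfV (gtr0_norm (norm1_gt0 t)) ler_pdivrMr ?norm1_gt0 //; lra.
Qed.

Lemma sigmoid_tail s u : 0 < s -> 1 - sigmoid (s - u) <= 4 * (1 + `|u|) / s.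
Proof.
move=> s0; have u0 := normr_ge0 u; have uu := ler_norm u.
have [h|h] := leP (2 * `|u|) s.
  rewrite /sigmoid ger0_norm; last lra.
  have p : 0 < 1 + (s - u) by lra.
  have -> : 1 - (s - u) / (1 + (s - u)) = (1 + (s - u))^-1 by field; rewrite gt_eqF.
  rewrite ler_pdivlMr // mulrC ler_pdivrMr //; nra.
rewrite ler_pdivlMr //.
have := sigmoid_le1 (s - u); rewrite ler_norml => /andP[l _]; nra.
Qed.

Lemma sigmoidN t : sigmoid (- t) = - sigmoid t.
Proof. by rewrite /sigmoid normrN mulNr. Qed.

(** The growth condition of [prim_norm_le] for a translate of [sigmoid]. With [s = 1 + |x - u| >= 1]
    and [d <= min 1 (e / 3)], the loss [2 s d + d^2] is at most [3 s d <= e s]; this is the origin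
    of [e / 3]. *)
Lemma decay_local u x e : 0 < e -> exists2 d, 0 < d & forall v w : R,
  v <= x -> x <= w -> x - d < v -> w < x + d ->
  (decay (x - u) - e) * (w - v) <= sigmoid (w - u) - sigmoid (v - u).
Proof.
move=> e0; exists (Num.min 1 (e / 3)); first by rewrite lt_min; apply/andP; split; lra.
set d := Num.min _ _.
have d1 : d <= 1 by rewrite ge_min lexx.
have d3 : d <= e / 3 by rewrite ge_min lexx orbT.
move=> v w vx xw xv wx.
apply: le_trans (sigmoid_incr (_ : v - u <= w - u)); last lra.
have -> : w - u - (v - u) = w - v by ring.
rewrite mulrC ler_wpM2l //; first lra.
set s := 1 + `|x - u|.
have s1 : 1 <= s by rewrite /s; have := normr_ge0 (x - u); lra.
have near y : `|y - x| < d -> 1 + `|y - u| <= s + d.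
  move=> yx; have := ler_normD (y - x) (x - u); rewrite addrA subrK /s; lra.
have hv : 1 + `|v - u| <= s + d.
  by apply: near; rewrite ltr_norml; apply/andP; split; lra.
have hw : 1 + `|w - u| <= s + d.
  by apply: near; rewrite ltr_norml; apply/andP; split; lra.
have d0 : 0 < d by lra.
apply: (@le_trans _ _ ((s + d) * (s + d))^-1); last first.
  rewrite lef_pV2 ?posrE ?mulr_gt0 ?norm1_gt0 //; try lra.
  by apply: ler_pM => //; rewrite ltW // norm1_gt0.
rewrite /decay -/s lerBlDr -lerBlDl.
have -> : s ^- 2 - ((s + d) * (s + d))^-1 = (2 * s * d + d ^+ 2) / (s ^+ 2 * (s + d) ^+ 2).
  by field; apply/andP; split; apply: lt0r_neq0; lra.
rewrite ler_pdivrMr; last by rewrite mulr_gt0 // exprn_gt0 //; lra.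
have q1 : s <= s ^+ 2 by rewrite expr2 ler_peMl //; lra.
have q2 : 1 <= (s + d) ^+ 2 by rewrite exprn_ege1 //; lra.
apply: (@le_trans _ _ (e * s)).
  rewrite expr2; nra.
apply: ler_wpM2l; first exact: ltW.
apply: (le_trans q1); rewrite ler_peMr // sqr_ge0 //.
Qed.

End Decay.

Section Improper.
Context (R : realType) (V : lmodType R[i]) (N : V -> R) (HN : bnorm N).
Implicit Types (a b e s t A : R) (f g : R -> V) (p q : V).

Definition decays g A s := (forall a b, contI N g a b) /\ forall t, N (g t) <= A * decay (t - s).

(** Both ends go to infinity independently, which makes the value invariant under translation of the
    parameter. *)
Definition is_impr g p := forall e, 0 < e -> exists2 M : R, 0 < M &
  forall a b, a <= - M -> M <= b -> N (Int N g a b - p) <= e.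

Definition impr g : V := xget 0 [set p | is_impr g p].

Lemma decays_ge0 g A s : decays g A s -> 0 <= A.
Proof.
move=> [_ /(_ s)]; rewrite subrr /decay normr0 addr0 expr1n invr1 mulr1.
by apply: le_trans; apply: bn_ge0.
Qed.

Lemma Int_decay g A s a b : a <= b -> decays g A s ->
  N (Int N g a b) <= A * (sigmoid (b - s) - sigmoid (a - s)).
Proof.
move=> ab dg; have A0 := decays_ge0 dg; case: dg => cg dg.
have [G pG ->] := Int_ex HN ab (cg a b); rewrite mulrBr.
apply: (prim_norm_le HN (phi := fun t => A * sigmoid (t - s)) ab pG) => x xab e e0.
have A1 : 0 < A + 1 by lra.
have [d d0 Hd] := decay_local s x (divr_gt0 e0 A1); exists d => // u v au ux xv vb xu vx.
rewrite -mulrBr.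
apply: le_trans (ler_wpM2l A0 (Hd u v ux xv xu vx)); rewrite mulrA ler_wpM2r //; first lra.
rewrite mulrBr; apply: lerB => //.
by rewrite mulrCA ger_pMr // ler_pdivrMr // mul1r; lra.
Qed.

Lemma Int_decay2 g A s a b : a <= b -> decays g A s -> N (Int N g a b) <= 2 * A.
Proof.
move=> ab dg; apply: (le_trans (Int_decay ab dg)); rewrite mulrC.
apply: ler_wpM2r; first exact: decays_ge0 dg.
have := sigmoid_le1 (b - s); have := sigmoid_le1 (a - s).
by rewrite !ler_norml => /andP[? ?] /andP[? ?]; lra.
Qed.

Lemma Int_tail g A s a b M : 0 < M -> a <= - M -> M <= b -> decays g A s ->
  N (Int N g a b - Int N g (- M) M) <= 8 * A * (1 + `|s|) / M.
Proof.
move=> M0 aM Mb dg.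
have MM : - M <= M by lra.
rewrite (Int_cat HN aM (le_trans MM Mb) (dg.1 _ _)) (Int_cat HN MM Mb (dg.1 _ _)).
set x := Int _ _ _ _; set y := Int _ _ _ _; set z := Int _ _ _ _.
have -> : x + (y + z) - y = x + z by modring.
apply: (le_trans (bn_triangle HN _ _)).
have A0 := decays_ge0 dg.
have hz : N z <= A * (4 * (1 + `|s|) / M).
  apply: (le_trans (Int_decay Mb dg)); apply: ler_wpM2l => //.
  have := sigmoid_tail s M0; have := sigmoid_le1 (b - s).
  by rewrite ler_norml => /andP[_ ?]; lra.
have hx : N x <= A * (4 * (1 + `|s|) / M).
  apply: (le_trans (Int_decay aM dg)); apply: ler_wpM2l => //.
  have := sigmoid_tail (- s) M0; have := sigmoid_le1 (a - s); rewrite normrN opprK.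
  have -> : - M - s = - (M + s) by ring.
  by rewrite sigmoidN ler_norml => /andP[? _]; lra.
have -> : 8 * A * (1 + `|s|) / M = 2 * (A * (4 * (1 + `|s|) / M)).
  by field; rewrite gt_eqF.
lra.
Qed.

(** By [Int_tail] the integrals over [[-2^n, 2^n]] move by at most a constant times [2^-n], exactly
    the rate accepted by [bn_complete]. *)
Lemma is_impr_exists g A s : decays g A s -> exists p, is_impr g p.
Proof.
move=> dg; have A0 := decays_ge0 dg.
have pw n : 0 < (2 : R) ^+ n by rewrite exprn_gt0.
pose K := 8 * A * (1 + `|s|).
have K0 : 0 <= K by rewrite /K mulr_ge0 ?mulr_ge0 // ltW // norm1_gt0.
have [|p Hp] := @bn_complete _ _ _ HN (fun n => Int N g (- 2 ^+ n) (2 ^+ n)) K.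
  move=> n; apply: (Int_tail (pw n) _ _ dg); rewrite exprS; have := pw n; lra.
exists p => e e0; have e2 : 0 < e / 2 by lra.
have [n0 H0] := Hp _ e2.
have K1 : 0 < K + 1 by lra.
have [n1 H1] := pow2_lt (divr_gt0 e2 K1).
pose n := maxn n0 n1; exists (2 ^+ n); first exact: pw.
move=> a b an nb; have := Int_tail (pw n) an nb dg.
have := H0 n (leq_maxl _ _); have := H1 n (leq_maxr _ _); rewrite ler_pdivlMr // => h1 h0 ht.
have := bn_trans HN (Int N g (- 2 ^+ n) (2 ^+ n)) (Int N g a b) p.
have : K / 2 ^+ n <= e / 2.
  by apply: le_trans h1; rewrite mulrC ler_wpM2l ?invr_ge0 ?(ltW (pw n)) //; lra.
rewrite -/K in ht; lra.
Qed.

Lemma is_impr_unique g p q : is_impr g p -> is_impr g q -> p = q.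
Proof.
move=> gp gq; apply: (bn_eq HN) => e e0.
have [M M0 HM] := gp (e / 2) ltac:(lra); have [M' M'0 HM'] := gq (e / 2) ltac:(lra).
have h1 := HM (- (M + M')) (M + M') ltac:(lra) ltac:(lra).
have h2 := HM' (- (M + M')) (M + M') ltac:(lra) ltac:(lra).
have := bn_trans HN (Int N g (- (M + M')) (M + M')) p q.
by rewrite (bn_sym HN p (Int _ _ _ _)); lra.
Qed.

Lemma impr_eq g p : is_impr g p -> impr g = p.
Proof.
move=> gp; rewrite /impr; case: xgetP => [q _ gq|/(_ p)//].
exact: is_impr_unique gq gp.
Qed.

Lemma imprP g A s : decays g A s -> is_impr g (impr g).
Proof. by move=> /is_impr_exists[p gp]; rewrite (impr_eq gp). Qed.

Lemma impr_le g A s : decays g A s -> N (impr g) <= 2 * A.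
Proof.
move=> dg; apply/ler_addgt0Pr => e e0; have [M M0 HM] := imprP dg e0.
have := HM (- M) M ltac:(lra) ltac:(lra).
have := bn_triangle HN (Int N g (- M) M) (- (Int N g (- M) M - impr g)).
rewrite bnN // opprB addrC subrK.
have := Int_decay2 (_ : - M <= M) dg; move=> /(_ ltac:(lra)); lra.
Qed.

Lemma is_impr_lin (c : R[i]) f g p q : (forall a b, contI N f a b) ->
  (forall a b, contI N g a b) -> is_impr f p -> is_impr g q ->
  is_impr (fun t => c *: f t + g t) (c *: p + q).
Proof.
move=> cf cg fp gq e e0; have c1 : 0 < cabs c + 1 by have := cabs_ge0 c; lra.
have e2 : 0 < e / 2 by lra.
have [M M0 HM] := fp _ (divr_gt0 e2 c1); have [M' M'0 HM'] := gq _ e2.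
exists (M + M'); first lra.
move=> a b aM Mb; have ab : a <= b by lra.
rewrite (Int_lin HN) //.
have -> : c *: Int N f a b + Int N g a b - (c *: p + q) =
  c *: (Int N f a b - p) + (Int N g a b - q) by modring.
apply: (le_trans (bn_triangle HN _ _)); rewrite (bn_scale HN).
have h1 := HM a b ltac:(lra) ltac:(lra); have h2 := HM' a b ltac:(lra) ltac:(lra).
move: h1; rewrite ler_pdivlMr // mulrDr mulr1 mulrC; have := bn_ge0 HN (Int N f a b - p); lra.
Qed.

Lemma is_impr_shift s g p : (forall a b, contI N g a b) -> is_impr g p ->
  is_impr (fun t => g (t + s)) p.
Proof.
move=> cg gp e e0; have [M M0 HM] := gp e e0.
have s0 := normr_ge0 s; have sn := ler_norm s; have sn' := ler_norm (- s); rewrite normrN in sn'.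
exists (M + `|s|); first lra.
move=> a b aM Mb; rewrite (Int_shift HN) //; last lra.
by apply: HM; lra.
Qed.

End Improper.

Lemma is_impr_map (R : realType) (V W : lmodType R[i]) (N : V -> R) (N' : W -> R)
    (HN : bnorm N) (HN' : bnorm N') (L : V -> W) (c : R) (g : R -> V) p :
  (forall (k : R[i]) p q, L (k *: p + q) = k *: L p + L q) ->
  (forall p, N' (L p) <= c * N p) -> (forall a b, contI N g a b) ->
  is_impr N g p -> is_impr N' (L \o g) (L p).
Proof.
move=> Ll Lc cg gp e e0.
have c1 : 0 < `|c| + 1 by have := normr_ge0 c; lra.
have [M M0 HM] := gp _ (divr_gt0 e0 c1); exists M => // a b aM Mb.
rewrite -(Int_map HN HN' Ll Lc _ (cg a b)); last lra.
have -> : L (Int N g a b) - L p = L (Int N g a b - p).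
  by rewrite -(scaleN1r p) addrC -scaleN1r -Ll addrC.
apply: (le_trans (Lc _)).
have h := HM a b aM Mb; move: h; rewrite ler_pdivlMr //.
have := bn_ge0 HN (Int N g a b - p); have := ler_norm c; nra.
Qed.

(** * Estimates for the kernel *)

Section Kernel.
Context (R : realType).
Implicit Types (z w h : R[i]) (d e s t : R).

Lemma real_fast_complete (u : nat -> R) (c : R) :
  (forall n, `|u n.+1 - u n| <= c * 2 ^- n) ->
  exists l, forall n, `|u n - l| <= 2 * c * 2 ^- n.
Proof.
move=> Hu.
have pw n : 0 < (2 : R) ^- n by rewrite invr_gt0 exprn_gt0.
have pS n : (2 : R) ^- n.+1 = 2 ^- n / 2 by rewrite exprS invfM mulrC.
have c0 : 0 <= c by have := le_trans (normr_ge0 _) (Hu 0%N); rewrite expr0 invr1 mulr1.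
have cp n : 0 <= c * 2 ^- n by rewrite mulr_ge0 // ltW.
have [n|n|n|l Hl] := @nested_segments R (fun n => u n - 2 * c * 2 ^- n)
  (fun n => 4 * c * 2 ^- n).
- by have := cp n; lra.
- by have := Hu n; rewrite ler_norml pS => /andP[? ?]; lra.
- by have := Hu n; rewrite ler_norml pS => /andP[? ?]; lra.
exists l => n; have /andP[h1 h2] := Hl n; rewrite ler_norml; apply/andP; split; lra.
Qed.

Lemma bnorm_complex : @bnorm R R[i]^o (@cabs R).
Proof.
split.
- exact: cabs_triangle.
- by move=> a x; rewrite -cabsM.
- by move=> x /eqP; rewrite cabs_eq0 => /eqP.
move=> u c Hu.
have [n|x Hx] := @real_fast_complete (fun n => complex.Re (u n)) c.
  by apply: le_trans (Hu n); apply: le_trans (Re_le_cabs _); case: (u n) (u n.+1) => ? ? [].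
have [n|y Hy] := @real_fast_complete (fun n => complex.Im (u n)) c.
  by apply: le_trans (Hu n); apply: le_trans (Im_le_cabs _); case: (u n) (u n.+1) => ? ? [].
exists (x +i* y) => e e0.
have c1 : 0 < 4 * `|c| + 1 by have := normr_ge0 c; lra.
have [n0 Hn0] := pow2_lt (divr_gt0 e0 c1).
exists n0 => n nn; have := Hn0 n nn; rewrite ler_pdivlMr // => h.
apply: (le_trans (cabs_le _)).
have := Hx n; have := Hy n; have : 0 < (2 : R) ^- n by rewrite invr_gt0 exprn_gt0.
case: (u n) => p q /=; have := ler_norm c; nra.
Qed.

(** The pole at [0] is the Cauchy pole, with residue [1 / 2]. The factor [2 - z] makes the kernel
    decay quadratically along vertical lines, and its zero lies beyond all differences of points of
    the strip. *)
Definition ker z : R[i] := (z * (2 - z))^-1.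

(* The line of integration stays at distance [d] from the poles [0] and [2] of [ker]. *)
Definition away d s := d <= `|s| /\ d <= `|2 - s|.

Lemma Re2 z : complex.Re (2 - z) = 2 - complex.Re z.
Proof. by case: z => a b; rewrite -[2 : R[i]](rmorph_nat (real_complex R)) /=. Qed.

Lemma Im2 z : complex.Im (2 - z) = - complex.Im z.
Proof. by case: z => a b; rewrite -[2 : R[i]](rmorph_nat (real_complex R)) /= sub0r. Qed.

Lemma cabs_ge_decay d z : 0 < d -> d <= 1 -> d <= `|complex.Re z| ->
  cabs z^-1 <= 2 / d / (1 + `|complex.Im z|).
Proof.
move=> d0 d1 dz; rewrite cabsV.
have i0 := normr_ge0 (complex.Im z).
have h1 := le_trans dz (Re_le_cabs z); have h2 := Im_le_cabs z.
rewrite ler_pdivlMr ?norm1_gt0 // mulrC ler_pdivrMr; last lra.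
by rewrite mulrAC ler_pdivlMr //; nra.
Qed.

Lemma cabs_inv_le d z : 0 < d -> d <= cabs z -> cabs z^-1 <= d^-1.
Proof. by move=> d0 h; rewrite cabsV lef_pV2 ?posrE //; lra. Qed.

Lemma cabs_neq0 d z : 0 < d -> d <= cabs z -> z != 0.
Proof. by move=> d0 h; rewrite -cabs_gt0; lra. Qed.

Lemma awayP d z : away d (complex.Re z) -> d <= cabs z /\ d <= cabs (2 - z).
Proof. by move=> [h1 h2]; rewrite -Re2 in h2; split; apply: le_trans (Re_le_cabs _). Qed.

Lemma kerE d z : 0 < d -> d <= cabs z -> d <= cabs (2 - z) ->
  ker z = 2^-1 * (z^-1 + (2 - z)^-1).
Proof.
move=> d0 h1 h2; have n1 := cabs_neq0 d0 h1; have n2 := cabs_neq0 d0 h2.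
by rewrite /ker; field; rewrite n1 n2.
Qed.

Lemma ker_Im z : 1 <= `|complex.Im z| -> cabs (ker z) <= `|complex.Im z|^-1.
Proof.
move=> h; rewrite /ker invfM cabsM.
have i0 : 0 < `|complex.Im z| by lra.
have := cabs_inv_le i0 (Im_le_cabs z).
have := cabs_inv_le ltr01 (_ : 1 <= cabs (2 - z)); rewrite invr1 => h2 h1.
rewrite -[leRHS]mulr1; apply: ler_pM; rewrite ?cabs_ge0 // h2 //.
by apply: le_trans (Im_le_cabs _); rewrite Im2 normrN.
Qed.

Lemma ker_decay d z : 0 < d -> d <= 1 -> away d (complex.Re z) ->
  cabs (ker z) <= 4 / d ^+ 2 * decay (complex.Im z).
Proof.
move=> d0 d1 [h1 h2]; rewrite /ker invfM cabsM; rewrite -Re2 in h2.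
have := cabs_ge_decay d0 d1 h1; have := cabs_ge_decay d0 d1 h2.
rewrite Im2 normrN => a1 a2.
apply: (le_trans (ler_pM (cabs_ge0 _) (cabs_ge0 _) a2 a1)).
rewrite /decay; apply: eq_leW; field.
by rewrite !gt_eqF // norm1_gt0.
Qed.

Lemma cabs_half : cabs (2^-1 : R[i]) = 2^-1.
Proof.
by rewrite -[2 : R[i]](rmorph_nat (real_complex R)) cabsV /= cabsR ger0_norm.
Qed.

Lemma inv_lip d z w : 0 < d -> d <= cabs z -> d <= cabs w ->
  cabs (w^-1 - z^-1) <= cabs (w - z) / d ^+ 2.
Proof.
move=> d0 hz hw; have nz := cabs_neq0 d0 hz; have nw := cabs_neq0 d0 hw.
have -> : w^-1 - z^-1 = (z - w) * (w^-1 * z^-1) by field; rewrite nz nw.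
rewrite cabsM cabsB ler_wpM2l ?cabs_ge0 // cabsM expr2 invfM.
by apply: ler_pM; rewrite ?cabs_ge0 ?cabs_inv_le.
Qed.

Lemma ker_lip d z w : 0 < d -> d <= cabs z -> d <= cabs (2 - z) ->
  d <= cabs w -> d <= cabs (2 - w) -> cabs (ker w - ker z) <= cabs (w - z) / d ^+ 2.
Proof.
move=> d0 z1 z2 w1 w2; rewrite (kerE d0 z1 z2) (kerE d0 w1 w2).
rewrite -mulrBr cabsM cabs_half.
have := inv_lip d0 z1 w1; have := inv_lip d0 z2 w2.
have -> : 2 - w - (2 - z) = z - w by ring.
rewrite [cabs (z - w)]cabsB => h1 h2.
have := cabs_triangle (w^-1 - z^-1) ((2 - w)^-1 - (2 - z)^-1).
have -> : w^-1 - z^-1 + ((2 - w)^-1 - (2 - z)^-1) = w^-1 + (2 - w)^-1 - (z^-1 + (2 - z)^-1) by ring.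
lra.
Qed.

(** Minus the derivative of [ker], that is, the derivative of [w |-> ker (z - w)] taken at the
    argument [z - w]. *)
Definition dker z : R[i] := 2^-1 * (z ^- 2 - (2 - z) ^- 2).

Lemma dker_decay d z : 0 < d -> d <= 1 -> away d (complex.Re z) ->
  cabs (dker z) <= 4 / d ^+ 2 * decay (complex.Im z).
Proof.
move=> d0 d1 [h1 h2]; rewrite -Re2 in h2; rewrite /dker cabsM cabs_half.
have a1 := cabs_ge_decay d0 d1 h1; have a2 := cabs_ge_decay d0 d1 h2.
rewrite Im2 normrN in a2.
have sq x : cabs x^-1 <= 2 / d / (1 + `|complex.Im z|) ->
    cabs (x ^- 2) <= 4 / d ^+ 2 * decay (complex.Im z).
  move=> hx; rewrite -exprVn expr2 cabsM.
  apply: (le_trans (ler_pM (cabs_ge0 _) (cabs_ge0 _) hx hx)).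
  rewrite /decay; apply: eq_leW; field.
  by rewrite !gt_eqF // norm1_gt0.
have := cabs_triangle (z ^- 2) (- (2 - z) ^- 2); rewrite cabsN.
have := sq _ a1; have := sq _ a2; lra.
Qed.

Lemma dker_lip d z w : 0 < d -> away d (complex.Re z) -> away d (complex.Re w) ->
  cabs (dker w - dker z) <= cabs (w - z) * (2 / d ^+ 3).
Proof.
move=> d0 /awayP[z1 z2] /awayP[w1 w2]; rewrite /dker.
have sq x y : d <= cabs x -> d <= cabs y ->
    cabs (y ^- 2 - x ^- 2) <= cabs (y - x) * (2 / d ^+ 3).
  move=> hx hy; rewrite -!exprVn subr_sqr cabsM.
  have l1 := inv_lip d0 hx hy.
  have l2 := cabs_triangle y^-1 x^-1.
  have l3 := cabs_inv_le d0 hx; have l4 := cabs_inv_le d0 hy.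
  apply: (@le_trans _ _ (cabs (y - x) / d ^+ 2 * (2 / d))).
    apply: ler_pM; rewrite ?cabs_ge0 //; apply: (le_trans l2); lra.
  by apply: eq_leW; field; rewrite gt_eqF.
have := sq _ _ z1 w1; have := sq _ _ z2 w2.
have -> : 2 - w - (2 - z) = z - w by ring.
rewrite [cabs (z - w)]cabsB.
have -> : 2^-1 * (w ^- 2 - (2 - w) ^- 2) - 2^-1 * (z ^- 2 - (2 - z) ^- 2) =
  2^-1 * ((w ^- 2 - z ^- 2) - ((2 - w) ^- 2 - (2 - z) ^- 2)) by ring.
rewrite cabsM cabs_half.
have := cabs_triangle (w ^- 2 - z ^- 2) (- ((2 - w) ^- 2 - (2 - z) ^- 2)); rewrite cabsN.
lra.
Qed.

Lemma away_half d s t : away d s -> `|t| <= d / 2 -> away (d / 2) (s - t).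
Proof.
move=> [h1 h2] ht; split.
  by have := ler_normD (s - t) t; rewrite subrK; lra.
have := ler_normD (2 - (s - t)) (- t); rewrite normrN.
have -> : 2 - (s - t) - t = 2 - s by ring.
lra.
Qed.

(** The remainder is computed exactly. In each of its two terms, two factors are inverses at the
    centre and supply the quadratic decay, so the bound can be integrated along a line; the third is
    an inverse at the displaced point, bounded by [2 / d] since [cabs h <= d / 2]. *)
Lemma ker_taylor d z h : 0 < d -> d <= 1 -> away d (complex.Re z) -> cabs h <= d / 2 ->
  cabs (ker (z - h) - ker z - h * dker z) <=
    cabs h ^+ 2 * (8 / d ^+ 3) * decay (complex.Im z).
Proof.
move=> d0 d1 az hd.
have d2 : 0 < d / 2 by lra.
have azh : away (d / 2) (complex.Re (z - h)).
  have -> : complex.Re (z - h) = complex.Re z - complex.Re h by case: z {az} => ? ?; case: h {hd}.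
  by apply: away_half => //; apply: le_trans (Re_le_cabs _) hd.
have [y1 y2] := awayP az; have [w1 w2] := awayP azh.
rewrite (kerE d0 y1 y2) (kerE d2 w1 w2) /dker.
have n1 := cabs_neq0 d0 y1; have n2 := cabs_neq0 d0 y2.
have n3 := cabs_neq0 d2 w1; have n4 := cabs_neq0 d2 w2.
case: az => z1 z2; rewrite -Re2 in z2.
have -> : 2^-1 * ((z - h)^-1 + (2 - (z - h))^-1) - 2^-1 * (z^-1 + (2 - z)^-1) -
   h * (2^-1 * (z ^- 2 - (2 - z) ^- 2)) =
   h ^+ 2 * (2^-1 * (z^-1 * z^-1 * (z - h)^-1 + (2 - z)^-1 * (2 - z)^-1 * (2 - (z - h))^-1)).
  by field; rewrite n1 n2 n3 n4.
rewrite cabsM [h ^+ 2]expr2 cabsM -expr2 cabsM cabs_half -[leRHS]mulrA.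
apply: ler_wpM2l; first exact: sqr_ge0.
have a1 := cabs_ge_decay d0 d1 z1; have a2 := cabs_ge_decay d0 d1 z2.
rewrite Im2 normrN in a2.
have b1 := cabs_inv_le d2 w1; have b2 := cabs_inv_le d2 w2.
have cube x y : cabs x^-1 <= 2 / d / (1 + `|complex.Im z|) -> cabs y^-1 <= (d / 2)^-1 ->
    cabs (x^-1 * x^-1 * y^-1) <= 8 / d ^+ 3 * decay (complex.Im z).
  move=> hx hy; rewrite !cabsM.
  have hxx := ler_pM (cabs_ge0 _) (cabs_ge0 _) hx hx.
  apply: (le_trans (ler_pM _ (cabs_ge0 _) hxx hy)); first by rewrite mulr_ge0 ?cabs_ge0.
  rewrite /decay; apply: eq_leW; field.
  by rewrite !gt_eqF // norm1_gt0.
have := cube _ _ a1 b1; have := cube _ _ a2 b2.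
have := cabs_triangle (z^-1 * z^-1 * (z - h)^-1) ((2 - z)^-1 * (2 - z)^-1 * (2 - (z - h))^-1).
lra.
Qed.

End Kernel.

(** * Cauchy integrals over a vertical line *)

Section CauchyIntegral.
Context (R : realType) (V : lmodType R[i]) (N : V -> R) (HN : bnorm N).
Implicit Types (a b c d e s t A B : R) (w z h : R[i]) (g : R -> V).

Lemma decays_scale (K : R -> R[i]) A B L s g :
  (forall t t', cabs (K t' - K t) <= `|t' - t| * L) ->
  (forall t, cabs (K t) <= A * decay (t - s)) ->
  (forall a b, contI N g a b) -> (forall t, N (g t) <= B) ->
  decays N (fun t => K t *: g t) (A * B) s.
Proof.
move=> lipK decK cg gB; split=> [a b|t]; last first.
  rewrite (bn_scale HN) mulrAC; apply: ler_pM; rewrite ?cabs_ge0 ?bn_ge0 //.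
have [ab|ba] := leP a b; last by move=> x /andP[? ?]; lra.
apply: (contI_scale HN ab) => // x _ e e0.
have L1 : 0 < `|L| + 1 by have := normr_ge0 L; lra.
exists (e / (`|L| + 1)); first exact: divr_gt0.
move=> y _; rewrite ltr_pdivlMr // => h; apply: (le_trans (lipK _ _)).
by have := ler_norm L; have := normr_ge0 (y - x); nra.
Qed.

(** The integral is in [dt] and not in [dz = i dt]; the missing factor is absorbed into the constant
    [kappa]. *)
Definition cint c g w : V := impr N (fun t => ker (c +i* t - w) *: g t).

Lemma Re_line c t w : complex.Re (c +i* t - w) = c - complex.Re w.
Proof. by case: w. Qed.

Lemma Im_line c t w : complex.Im (c +i* t - w) = t - complex.Im w.
Proof. by case: w. Qed.

Lemma line_sub c t t' w : c +i* t' - w - (c +i* t - w) = 0 +i* (t' - t).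
Proof.
by case: w => x y; apply/eqP; rewrite eq_complex /=; apply/andP; split; apply/eqP; ring.
Qed.

Lemma cint_decays c g w d B : 0 < d -> d <= 1 -> away d (c - complex.Re w) ->
  (forall a b, contI N g a b) -> (forall t, N (g t) <= B) ->
  decays N (fun t => ker (c +i* t - w) *: g t) (4 / d ^+ 2 * B) (complex.Im w).
Proof.
move=> d0 d1 aw cg gB; apply: (decays_scale (L := (d ^+ 2)^-1)) => //.
  move=> t t'; rewrite -cabsI -(line_sub c t t' w).
  have [z1 z2] := @awayP _ d (c +i* t - w) ltac:(by rewrite Re_line).
  have [w1 w2] := @awayP _ d (c +i* t' - w) ltac:(by rewrite Re_line).
  exact: ker_lip.
by move=> t; rewrite -(Im_line c); apply: ker_decay => //; rewrite Re_line.
Qed.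

Lemma dcint_decays c g w d B : 0 < d -> d <= 1 -> away d (c - complex.Re w) ->
  (forall a b, contI N g a b) -> (forall t, N (g t) <= B) ->
  decays N (fun t => dker (c +i* t - w) *: g t) (4 / d ^+ 2 * B) (complex.Im w).
Proof.
move=> d0 d1 aw cg gB; apply: (decays_scale (L := 2 / d ^+ 3)) => //.
  by move=> t t'; rewrite -cabsI -(line_sub c t t' w); apply: dker_lip => //; rewrite Re_line.
by move=> t; rewrite -(Im_line c); apply: dker_decay => //; rewrite Re_line.
Qed.

Lemma cint_le c g w d B : 0 < d -> d <= 1 -> away d (c - complex.Re w) ->
  (forall a b, contI N g a b) -> (forall t, N (g t) <= B) ->
  N (cint c g w) <= 8 / d ^+ 2 * B.
Proof.
move=> d0 d1 aw cg gB; apply: (le_trans (impr_le HN (cint_decays d0 d1 aw cg gB))).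
by rewrite !mulrA -natrM.
Qed.

(** Differentiation under the integral sign: the remainder from [ker_taylor] still decays
    quadratically, so integrating it costs only a factor [2]. *)
Lemma cint_diff c g w d B : 0 < d -> d <= 1 -> away d (c - complex.Re w) ->
  (forall a b, contI N g a b) -> (forall t, N (g t) <= B) ->
  exists q, forall w', cabs (w' - w) <= d / 2 ->
    N (cint c g w' - cint c g w - (w' - w) *: q) <= cabs (w' - w) ^+ 2 * (16 / d ^+ 3 * B).
Proof.
move=> d0 d1 aw cg gB.
exists (impr N (fun t => dker (c +i* t - w) *: g t)) => w' ww'.
have d2 : 0 < d / 2 by lra.
have d21 : d / 2 <= 1 by lra.
have aw' : away (d / 2) (c - complex.Re w').
  have -> : c - complex.Re w' = c - complex.Re w - complex.Re (w' - w).
    by case: (w) (w') => ? ? [? ?] /=; ring.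
  by apply: away_half => //; apply: le_trans (Re_le_cabs _) ww'.
have D1 := cint_decays d0 d1 aw cg gB.
have D2 := cint_decays d2 d21 aw' cg gB.
have D3 := dcint_decays d0 d1 aw cg gB.
have I1 := imprP HN D1; have I2 := imprP HN D2; have I3 := imprP HN D3.
have I4 := is_impr_lin HN (- 1) D1.1 D2.1 I1 I2.
have C4 a b := contI_lin HN (- 1) (D1.1 a b) (D2.1 a b).
have I5 := is_impr_lin HN (- (w' - w)) D3.1 C4 I3 I4.
have C5 a b := contI_lin HN (- (w' - w)) (D3.1 a b) (C4 a b).
have -> : cint c g w' - cint c g w - (w' - w) *: impr N (fun t => dker (c +i* t - w) *: g t) =
  - (w' - w) *: impr N (fun t => dker (c +i* t - w) *: g t) + (- 1 *: cint c g w + cint c g w').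
  by modring.
rewrite -(impr_eq HN I5).
apply: (le_trans (impr_le HN (_ : decays N _ (cabs (w' - w) ^+ 2 * (8 / d ^+ 3) * B) (complex.Im w)))).
  split=> // t /=.
  have -> : - (w' - w) *: (dker (c +i* t - w) *: g t) +
      (-1 *: (ker (c +i* t - w) *: g t) + ker (c +i* t - w') *: g t) =
    (ker (c +i* t - w - (w' - w)) - ker (c +i* t - w) - (w' - w) * dker (c +i* t - w)) *: g t.
    have -> : c +i* t - w - (w' - w) = c +i* t - w' by ring.
    modring.
  rewrite (bn_scale HN) mulrAC; apply: ler_pM; rewrite ?cabs_ge0 ?bn_ge0 //.
  by rewrite -(Im_line c); apply: ker_taylor => //; rewrite Re_line.
apply: eq_leW; ring.
Qed.

End CauchyIntegral.

(** * Shifting the line of integration *)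

Section Shift.
Context (R : realType) (V : lmodType R[i]) (N : V -> R) (HN : bnorm N).
Implicit Types (a b c d e s t A B : R) (w z h : R[i]) (g : R -> V) (H : R[i] -> V).

Definition vstrip a b : set R[i] := [set z | a <= complex.Re z <= b].

(** Cauchy's theorem on the boxes of height [2 M]: the horizontal sides contribute [O(1 / M)] and
    the vertical ones tend to the two line integrals. *)
Lemma line_shift H a b (E : seq R) A M1 va vb : a <= b -> 0 < M1 ->
  ccont N H (vstrip a b) ->
  (forall z, a < complex.Re z < b -> complex.Re z \notin E -> cdiff N H (vstrip a b) z) ->
  (forall z, a <= complex.Re z <= b -> M1 <= `|complex.Im z| ->
     N (H z) <= A / `|complex.Im z|) ->
  is_impr N (fun t => H (a +i* t)) va -> is_impr N (fun t => H (b +i* t)) vb -> va = vb.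
Proof.
move=> ab M10 cH dH decH ia ib; apply: (bn_eq HN) => e e0.
have [Ma Ma0 HMa] := ia (e / 3) ltac:(lra); have [Mb Mb0 HMb] := ib (e / 3) ltac:(lra).
have A1 : 0 < 6 * `|A| * (b - a) / e + 1.
  suff : 0 <= 6 * `|A| * (b - a) / e by lra.
  by apply: divr_ge0; [apply: mulr_ge0; [have := normr_ge0 A|]|]; lra.
(* The last summand brings each horizontal side below [e / 6]. The others bring the vertical sides
   within [e / 3] of their limits and the horizontal ones into the range of the decay hypothesis. *)
pose M := Ma + Mb + M1 + (6 * `|A| * (b - a) / e + 1).
have M0 : 0 < M by rewrite /M; lra.
have MM : - M <= M by lra.
have ha := HMa (- M) M ltac:(rewrite /M; lra) ltac:(rewrite /M; lra).
have hb := HMb (- M) M ltac:(rewrite /M; lra) ltac:(rewrite /M; lra).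
have sub : box a b (- M) M `<=` vstrip a b by move=> z /andP[].
have cHM := ccont_sub sub cH.
have R0 : rect N H a b (- M) M = 0.
  apply: (rect_except HN (E := E)) => // z Dz zab zE.
  by apply: cdiff_sub sub _; apply: dH.
have hM (y : R) : `|y| = M -> N (Int N (fun s => H (s +i* y)) a b) <= `|A| / M * (b - a).
  move=> yM; apply: (Int_le HN ab).
    by apply: (contI_h _ cHM); rewrite -ler_norml yM.
  move=> x xab; have := decH (x +i* y) xab; rewrite /= yM => h.
  apply: (le_trans (h _)); first by rewrite /M; lra.
  by rewrite ler_wpM2r ?invr_ge0 ?(ltW M0) // ler_norm.
have h1 := hM M ltac:(by rewrite ger0_norm // ltW).
have h2 := hM (- M) ltac:(by rewrite normrN ger0_norm // ltW).
have small : `|A| / M * (b - a) <= e / 6.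
  rewrite mulrAC ler_pdivrMr //.
  have : 6 * `|A| * (b - a) / e <= M by rewrite /M; lra.
  by rewrite ler_pdivrMr // mulrC; lra.
move: R0; rewrite /rect.
set x := Int _ _ _ _ in h2 *; set y := Int _ _ _ _ in h1 *.
set vB := Int _ _ _ _ in hb *; set vA := Int _ _ _ _ in ha * => R0.
have eN : N (vB - vA) = N (x - y).
  have : 'i%C *: (vB - vA) = - (x - y) by apply/eqP; rewrite -addr_eq0 addrC R0.
  move=> /(congr1 N); rewrite (bn_scale HN) (bnN HN).
  by rewrite (_ : cabs 'i%C = 1) ?mul1r //; rewrite cabsI normr1.
have := bnB HN x y; rewrite -eN.
have := bn_trans HN vA va vb; have := bn_trans HN vB vA vb.
rewrite (bn_sym HN va vA) (bn_sym HN vA vB).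
have : 3 * (e / 6) = e / 2 by field.
lra.
Qed.

Lemma cdiff_local H H' D z r : 0 < r -> (forall z', cabs (z' - z) < r -> H z' = H' z') ->
  cdiff N H D z -> cdiff N H' D z.
Proof.
move=> r0 E [q Hq]; exists q => e e0; have [r1 r10 Hr] := Hq e e0.
exists (Num.min r r1); first by rewrite lt_min r0.
move=> z' Dz'; rewrite lt_min => /andP[l1 l2].
rewrite -!E //; last by rewrite subrr cabs0.
exact: Hr.
Qed.

Lemma cdiff_addc H D z p : cdiff N H D z -> cdiff N (fun z => H z + p) D z.
Proof.
move=> [q Hq]; exists q => e e0; have [r r0 Hr] := Hq e e0; exists r => // z' Dz' l.
by have -> : H z' + p - (H z + p) = H z' - H z; [modring|exact: Hr].
Qed.

Lemma cdiff_scale (K : R[i] -> R[i]) H D z : D z ->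
  @cdiff R R[i]^o (@cabs R) K D z -> cdiff N H D z -> cdiff N (fun z => K z *: H z) D z.
Proof.
move=> Dz dK dH; case: (dK) => k Hk; case: (dH) => q Hq.
exists (k *: H z + K z *: q) => e e0.
have [r1 r10 H1] := cdiff_cont HN dH (e := 1) ltr01.
have m1 : 0 < N (H z) + 1 by have := bn_ge0 HN (H z); lra.
have m2 : 0 < cabs k + 1 by have := cabs_ge0 k; lra.
have m3 : 0 < cabs (K z) + 1 by have := cabs_ge0 (K z); lra.
have e3 : 0 < e / 3 by lra.
have [r2 r20 H2] := Hk _ (divr_gt0 e3 m1).
have [r3 r30 H3] := cdiff_cont HN dH (divr_gt0 e3 m2).
have [r4 r40 H4] := Hq _ (divr_gt0 e3 m3).
exists (Num.min (Num.min r1 r2) (Num.min r3 r4)); first by rewrite !lt_min r10 r20 r30.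
move=> z' Dz'; rewrite !lt_min => /andP[/andP[l1 l2] /andP[l3 l4]].
have {H1}h1 := H1 z' Dz' l1; have {H2}h2 := H2 z' Dz' l2.
have {H3}h3 := H3 z' Dz' l3; have {H4}h4 := H4 z' Dz' l4.
have -> : K z' *: H z' - K z *: H z - (z' - z) *: (k *: H z + K z *: q) =
  (K z' - K z - (z' - z) * k) *: H z' + ((z' - z) * k) *: (H z' - H z) +
  K z *: (H z' - H z - (z' - z) *: q) by modring.
apply: (le_trans (bn_triangle HN _ _)).
apply: (le_trans (lerD (bn_triangle HN _ _) (lexx _))).
rewrite !(bn_scale HN) cabsM.
set x := cabs (z' - z) in h2 h4 *; have x0 : 0 <= x by exact: cabs_ge0.
have b1 : cabs (K z' - K z - (z' - z) * k) * N (H z') <= e / 3 * x.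
  have nH : N (H z') <= N (H z) + 1.
    by have := bn_triangle HN (H z' - H z) (H z); rewrite subrK; lra.
  apply: (le_trans (ler_pM (cabs_ge0 _) (bn_ge0 HN _) h2 nH)).
  by rewrite mulrAC divfK // gt_eqF.
have b2 : x * cabs k * N (H z' - H z) <= e / 3 * x.
  rewrite -mulrA mulrC; apply: ler_wpM2r => //.
  by move: h3; rewrite ler_pdivlMr // mulrDr mulr1 mulrC; have := bn_ge0 HN (H z' - H z); lra.
have b3 : cabs (K z) * N (H z' - H z - (z' - z) *: q) <= e / 3 * x.
  move: h4; rewrite mulrAC ler_pdivlMr // mulrDr mulr1 mulrC.
  by have := bn_ge0 HN (H z' - H z - (z' - z) *: q); lra.
lra.
Qed.

Definition ccat H D z := forall e, 0 < e ->
  exists2 r, 0 < r & forall z', D z' -> cabs (z' - z) < r -> N (H z' - H z) <= e.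

Lemma ccat_scale (K : R[i] -> R[i]) H D z L r0 : 0 < r0 ->
  (forall z', D z' -> cabs (z' - z) < r0 -> cabs (K z' - K z) <= cabs (z' - z) * L) ->
  ccat H D z -> ccat (fun z => K z *: H z) D z.
Proof.
move=> r00 HK cH e e0.
have [r1 r10 H1] := cH 1 ltr01.
have m1 : 0 < N (H z) + 1 by have := bn_ge0 HN (H z); lra.
have m3 : 0 < cabs (K z) + 1 by have := cabs_ge0 (K z); lra.
have L1 : 0 < `|L| + 1 by have := normr_ge0 L; lra.
have e2 : 0 < e / 2 by lra.
have [r2 r20 H2] := cH _ (divr_gt0 e2 m3).
exists (Num.min (Num.min r0 r1) (Num.min r2 (e / 2 / ((`|L| + 1) * (N (H z) + 1))))).
  by rewrite !lt_min r10 r20 r00 /= divr_gt0 // mulr_gt0.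
move=> z' Dz'; rewrite !lt_min => /andP[/andP[l1 l2] /andP[l3]].
rewrite ltr_pdivlMr ?mulr_gt0 // => l4.
have h1 := H1 z' Dz' l2; have h2 := H2 z' Dz' l3; have hK := HK z' Dz' l1.
have -> : K z' *: H z' - K z *: H z = (K z' - K z) *: H z' + K z *: (H z' - H z) by modring.
apply: (le_trans (bn_triangle HN _ _)); rewrite !(bn_scale HN).
have nH : N (H z') <= N (H z) + 1.
  by have := bn_triangle HN (H z' - H z) (H z); rewrite subrK; lra.
have b1 : cabs (K z' - K z) * N (H z') <= e / 2.
  have hK' : cabs (K z' - K z) <= cabs (z' - z) * (`|L| + 1).
    by apply: (le_trans hK); apply: ler_wpM2l; [exact: cabs_ge0|have := ler_norm L; lra].
  apply: (le_trans (ler_pM (cabs_ge0 _) (bn_ge0 HN _) hK' nH)).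
  by rewrite -mulrA ltW.
have b2 : cabs (K z) * N (H z' - H z) <= e / 2.
  move: h2; rewrite ler_pdivlMr // mulrDr mulr1 mulrC.
  by have := bn_ge0 HN (H z' - H z); lra.
lra.
Qed.

End Shift.

(** * Line integrals of the kernel and the normalizing constant *)

Section Kappa.
Context (R : realType).
Implicit Types (a b c d e s t A B : R) (w z h : R[i]).
Local Notation HC := (@bnorm_complex R).
Local Notation C := (R[i]^o).

Definition Jline c : C := impr (V := C) (@cabs R) (fun t => ker (c +i* t)).

Lemma Jline_decays c d : 0 < d -> d <= 1 -> away d c ->
  decays (V := C) (@cabs R) (fun t => ker (c +i* t)) (4 / d ^+ 2) 0.
Proof.
move=> d0 d1 ac.
have cC a b : contI (V := C) (@cabs R) (fun=> 1) a b.
  by move=> x _ e e0; exists 1 => // y _ _; rewrite subrr cabs0 ltW.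
have := @cint_decays R C (@cabs R) HC c (fun=> 1) 0 d 1 d0 d1.
rewrite subr0 mulr1 => /(_ ac cC); rewrite cabs1 => /(_ (fun=> lexx _)).
congr (decays _ _ _); apply/funext => t; rewrite subr0; exact: mulr1.
Qed.

(** Translating the parameter by [Im w] removes it, so for a constant function the Cauchy integral
    depends on [c - Re w] only. *)
Lemma is_impr_ker (V : lmodType R[i]) (N : V -> R) (HN : bnorm N) c w d v :
  0 < d -> d <= 1 -> away d (c - complex.Re w) ->
  is_impr N (fun t => ker (c +i* t - w) *: v) (Jline (c - complex.Re w) *: v).
Proof.
move=> d0 d1 aw; have D := Jline_decays d0 d1 aw.
have I2 := is_impr_shift HC (- complex.Im w) D.1 (imprP HC D).
have cS a b : contI (V := C) (@cabs R)
    (fun t => ker ((c - complex.Re w) +i* (t - complex.Im w))) a b.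
  move=> x xab e e0.
  have [|r r0 Hr] := D.1 (a - complex.Im w) (b - complex.Im w) (x - complex.Im w) _ e e0.
    by case/andP: xab => ? ?; apply/andP; split; lra.
  exists r => // y /andP[? ?] yx; apply: Hr; first by apply/andP; split; lra.
  by rewrite opprB addrA subrK.
have := is_impr_map HC HN (L := fun a : C => a *: v) (c := N v) _ _ cS I2.
have -> : (fun a : C => a *: v) \o (fun t => ker ((c - complex.Re w) +i* (t - complex.Im w)))
   = fun t => ker (c +i* t - w) *: v.
  by apply/funext => t /=; congr (ker _ *: _); case: (w).
apply=> [k p q|p]; first by rewrite scalerDl -scalerA.
by rewrite (bn_scale HN) mulrC.
Qed.

Lemma decay_le1 t : decay t <= 1.
Proof.
rewrite /decay invf_le1 ?exprn_gt0 ?norm1_gt0 // exprn_ege1 //.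
by have := normr_ge0 t; lra.
Qed.

Lemma ker_cdiff w z d (D : set R[i]) : 0 < d -> d <= 1 -> away d (complex.Re (z - w)) ->
  cdiff (V := C) (@cabs R) (fun z => ker (z - w)) D z.
Proof.
move=> d0 d1 az; exists (- dker (z - w)) => e e0.
have p0 : 0 < e * d ^+ 3 / 8 by rewrite divr_gt0 // mulr_gt0 // exprn_gt0.
exists (Num.min (d / 2) (e * d ^+ 3 / 8)); first by rewrite lt_min p0 andbT; lra.
move=> z' _; rewrite lt_min => /andP[l1 l2].
have := ker_taylor d0 d1 az (h := z - z') _; rewrite cabsB => /(_ (ltW l1)).
have -> : z - w - (z - z') = z' - w by ring.
have -> : ker (z' - w) - ker (z - w) - (z - z') * dker (z - w) =
   ker (z' - w) - ker (z - w) - (z' - z) * (- dker (z - w)) by ring.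
move=> /le_trans; apply.
have d3 : 0 < 8 / d ^+ 3 by rewrite divr_gt0 // exprn_gt0.
apply: (@le_trans _ _ (cabs (z' - z) ^+ 2 * (8 / d ^+ 3))).
  by rewrite ler_piMr ?decay_le1 // mulr_ge0 ?sqr_ge0 // ltW.
rewrite expr2 -mulrA mulrC; apply: ler_wpM2r; first exact: cabs_ge0.
move: l2; rewrite ltr_pdivlMr // => l2; rewrite mulrA ler_pdivrMr ?exprn_gt0 //.
by rewrite ltW.
Qed.

Lemma Jline_const a b d : a <= b -> 0 < d -> d <= 1 ->
  (forall s, a <= s <= b -> away d s) -> Jline a = Jline b.
Proof.
move=> ab d0 d1 aw.
have aa : away d a by apply: aw; rewrite lexx.
have ab' : away d b by apply: aw; rewrite lexx andbT.
have E0 : (fun z => ker (z - 0)) = @ker R by apply/funext => z; rewrite subr0.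
have kd z : a <= complex.Re z <= b -> cdiff (V := C) (@cabs R) (@ker R) (vstrip a b) z.
  by move=> zab; rewrite -E0; apply: ker_cdiff d0 d1 _; rewrite subr0; apply: aw.
have Ia := imprP HC (Jline_decays d0 d1 aa).
have Ib := imprP HC (Jline_decays d0 d1 ab').
apply: (line_shift HC (H := @ker R : R[i] -> C) (E := [::]) ab ltr01 (A := 1) _ _ _ Ia Ib).
- by move=> z zab; exact: (cdiff_cont HC (kd z zab)).
- by move=> z /andP[/ltW az /ltW zb] _; apply: kd; rewrite az.
- by move=> z _ h; rewrite mul1r; apply: ker_Im.
Qed.

(* [kappa] is [pi]: the jump of [Jline] across the pole at [0]. *)
Definition kappa : R[i] := Jline 1 - Jline (-1).

Lemma Int_Re_ge (g : R -> C) (m : R) a b : a <= b ->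
  contI (V := C) (@cabs R) g a b -> (forall t, m <= complex.Re (g t)) ->
  m * (b - a) <= complex.Re (Int (@cabs R) g a b).
Proof.
move=> ab cg gm; have [G pG ->] := Int_ex HC ab cg.
rewrite -lerN2; have -> : - (m * (b - a)) = - m * b - - m * a by ring.
apply: (prim_le HC (l := fun p : C => - complex.Re p) (phi := fun x => - m * x) ab _ _ _ pG).
- by move=> [? ?] [? ?] /=; rewrite opprD.
- by move=> c [x y] c0 /=; rewrite mul0r subr0 mulrN.
- by move=> p; apply: le_trans (Re_le_cabs _); rewrite -normrN ler_norm.
move=> x xab e e0; exists 1 => // u v *; rewrite -mulrBr; apply: ler_wpM2r; first lra.
by have := gm x; lra.
Qed.

Lemma kappa_integrand t :
  complex.Re (ker (1 +i* t) - ker ((-1) +i* t)) = 12 / ((1 + t ^+ 2) * (9 + t ^+ 2)).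
Proof.
have t2 : 0 <= t ^+ 2 by exact: sqr_ge0.
have -> : ker (1 +i* t) = ((1 + t ^+ 2) +i* 0)^-1.
  rewrite /ker; congr (_^-1); rewrite -[2 : R[i]](rmorph_nat (real_complex R)).
  by apply/eqP; rewrite eq_complex /=; apply/andP; split; apply/eqP; ring.
have -> : ker ((-1) +i* t) = ((t ^+ 2 - 3) +i* (4 * t))^-1.
  rewrite /ker; congr (_^-1); rewrite -[2 : R[i]](rmorph_nat (real_complex R)).
  by apply/eqP; rewrite eq_complex /=; apply/andP; split; apply/eqP; ring.
rewrite /= expr0n /= addr0.
have -> : (t ^+ 2 - 3) ^+ 2 + (4 * t) ^+ 2 = (1 + t ^+ 2) * (9 + t ^+ 2) by ring.
by field; apply/andP; split; apply: lt0r_neq0; lra.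
Qed.

(** The difference of the two integrands has real part [12 / ((1 + t^2) (9 + t^2))], which is
    nonnegative and at least [12 / 20] on [[0, 1]]. If [kappa] were [0], some integral over a
    segment containing [[0, 1]] would have modulus at most [1 / 4]. *)
Lemma kappa_neq0 : kappa != 0.
Proof.
have a1 : away 1 (1 : R) by split; rewrite ?normr1 // ger0_norm; lra.
have a2 : away 1 (-1 : R) by split; rewrite ?normrN ?normr1 // ger0_norm; lra.
have D1 := Jline_decays ltr01 (lexx 1) a1; have D2 := Jline_decays ltr01 (lexx 1) a2.
have I := is_impr_lin HC (-1) D2.1 D1.1 (imprP HC D2) (imprP HC D1).
have cI a b := contI_lin HC (-1) (D2.1 a b) (D1.1 a b).
set g := (fun t => _) in I cI.
have gE t : complex.Re (g t) = 12 / ((1 + t ^+ 2) * (9 + t ^+ 2)).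
  by rewrite -kappa_integrand /g; congr complex.Re; rewrite scaleN1r addrC.
have g0 t : 0 <= complex.Re (g t).
  by rewrite gE divr_ge0 // mulr_ge0 //; have := sqr_ge0 t; lra.
apply/eqP => k0.
have [M M0 HM] := I (1 / 4) ltac:(lra).
have := HM (- (M + 1)) (M + 1) ltac:(lra) ltac:(lra).
have -> : - 1 *: impr (V := C) (@cabs R) (fun t => ker ((-1) +i* t)) +
   impr (V := C) (@cabs R) (fun t => ker (1 +i* t)) = 0.
  by rewrite scaleN1r addrC.
rewrite subr0 => small.
have := le_trans (Re_le_cabs _) small; apply/negP; rewrite -ltNge.
apply: lt_le_trans (ler_norm _).
rewrite (@Int_cat _ _ _ HC g _ 0); [|lra|lra|exact: cI].
rewrite (@Int_cat _ _ _ HC g 0 1); [|lra|lra|exact: cI].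
have i1 : 0 <= complex.Re (Int (@cabs R) g (- (M + 1)) 0).
  by have := @Int_Re_ge g 0 (- (M + 1)) 0 ltac:(lra) (cI _ _) g0; rewrite mul0r.
have i3 : 0 <= complex.Re (Int (@cabs R) g 1 (M + 1)).
  by have := @Int_Re_ge g 0 1 (M + 1) ltac:(lra) (cI _ _) g0; rewrite mul0r.
have i2 : 6 / 10 <= complex.Re (Int (@cabs R) g 0 1).
  have [G pG ->] := Int_ex HC ler01 (cI 0 1).
  rewrite -lerN2; have -> : - (6 / 10) = - (6 / 10) * 1 - - (6 / 10) * 0 :> R by ring.
  apply: (prim_le HC (l := fun p : C => - complex.Re p)
    (phi := fun x => - (6 / 10) * x) ler01 _ _ _ pG).
  - by move=> [? ?] [? ?] /=; rewrite opprD.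
  - by move=> c [x y] c0 /=; rewrite mul0r subr0 mulrN.
  - by move=> p; apply: le_trans (Re_le_cabs _); rewrite -normrN ler_norm.
  move=> x /andP[x0 x1] e e0; exists 1 => // u v *; rewrite -mulrBr; apply: ler_wpM2r; first lra.
  suff : 6 / 10 <= complex.Re (g x) by lra.
  have x20 := sqr_ge0 x; have x21 : x ^+ 2 <= 1 by rewrite exprn_ile1.
  rewrite gE ler_pdivlMr; last by apply: mulr_gt0; lra.
  nra.
case: (Int _ _ _ _) i1 => ? ? /= i1; case: (Int _ _ _ _) i2 => ? ? /= i2.
by case: (Int _ _ _ _) i3 => ? ? /= i3; lra.
Qed.

End Kappa.

(** * Cauchy's formula on the strip *)

Section StripFormula.
Context (R : realType) (V : lmodType R[i]) (N : V -> R) (HN : bnorm N).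
Implicit Types (a b c d e s t : R) (w z : R[i]).
Local Notation S := (vstrip (0 : R) 1).
Variables (f : R[i] -> V) (B : R) (sg : R).
Hypothesis cf : ccont N f S.
Hypothesis fB : forall z, S z -> N (f z) <= B.
(** The line [Re z = sg] is exempted so that [removable] can apply the formula to a function with
    one doubtful point. For elements of the Calderon space [sg] is set to [0], which exempts
    nothing. *)
Hypothesis df : forall z, 0 < complex.Re z < 1 -> complex.Re z != sg -> cdiff N f S z.

Lemma line_contI c : 0 <= c <= 1 -> forall a b, contI N (fun t => f (c +i* t)) a b.
Proof.
move=> c01 a b x _ e e0; have [|r r0 Hr] := cf (z := c +i* x) _ e0; first by [].
exists r => // y _ yx; apply: Hr => //.
have -> : c +i* y - c +i* x = 0 +i* (y - x).
  by apply/eqP; rewrite eq_complex /= subrr !eqxx.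
by rewrite cabsI.
Qed.

Lemma contI_cst (p : V) a b : contI N (fun=> p) a b.
Proof. by move=> x _ e e0; exists 1 => // y _ _; rewrite subrr (bn0 HN) ltW. Qed.

Lemma ker_tail w z : 2 * `|complex.Im w| + 2 <= `|complex.Im z| ->
  cabs (ker (z - w)) <= 2 / `|complex.Im z|.
Proof.
move=> h; have h0 := normr_ge0 (complex.Im w).
have E : complex.Im (z - w) = complex.Im z - complex.Im w by case: (z) => ? ?; case: (w).
have h1 := ler_normD (complex.Im z - complex.Im w) (complex.Im w); rewrite subrK in h1.
have h2 : 1 <= `|complex.Im (z - w)| by rewrite E; lra.
apply: (le_trans (ker_Im h2)).
rewrite E in h2 *; rewrite ler_pdivlMr; last lra.
rewrite mulrC ler_pdivrMr; lra.
Qed.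

(** No pole of the kernel lies between the two lines, so the first can be shifted onto the second.
    This later gives the boundary values of a translated Cauchy integral on the side where it is not
    given by its own line. *)
Lemma strip_out w d : 0 < d -> d <= 1 -> (forall s, 0 <= s <= 1 -> away d (s - complex.Re w)) ->
  cint N 1 (fun t => f (1 +i* t)) w = cint N 0 (fun t => f (0 +i* t)) w.
Proof.
move=> d0 d1 aw; symmetry.
have i0 : (0 <= 0 :> R) && (0 <= 1 :> R) by apply/andP; split; lra.
have i1 : (0 <= 1 :> R) && (1 <= 1 :> R) by apply/andP; split; lra.
have aR z : S z -> away d (complex.Re (z - w)).
  by move=> Sz; have -> : complex.Re (z - w) = complex.Re z - complex.Re w;
    [case: (z) (w) => ? ? []|apply: aw].
have D0 := cint_decays HN d0 d1 (aw 0 i0) (line_contI i0) (fun t => fB (z := 0 +i* t) i0).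
have D1 := cint_decays HN d0 d1 (aw 1 i1) (line_contI i1) (fun t => fB (z := 1 +i* t) i1).
have M10 : 0 < 2 * `|complex.Im w| + 2 by have := normr_ge0 (complex.Im w); lra.
apply: (line_shift HN (H := fun z => ker (z - w) *: f z) (E := [:: sg]) (A := 2 * B)
  ler01 M10 _ _ _ (imprP HN D0) (imprP HN D1)).
- move=> z Sz; apply: (ccat_scale HN (L := (d ^+ 2)^-1) ltr01); last exact: cf.
  move=> z' Sz' _; have [z1 z2] := awayP (aR _ Sz); have [w1 w2] := awayP (aR _ Sz').
  apply: (le_trans (ker_lip d0 z1 z2 w1 w2)).
  by have -> : z' - w - (z - w) = z' - z by ring.
- move=> z z01; rewrite inE => zs.
  have Sz : S z by case/andP: z01 => /ltW ? /ltW ?; apply/andP.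
  apply: (cdiff_scale HN) => //; last exact: df.
  exact: (ker_cdiff _ d0 d1 (aR _ Sz)).
- move=> z Sz hz; rewrite (bn_scale HN) mulrAC.
  by apply: ler_pM; rewrite ?cabs_ge0 ?bn_ge0 ?ker_tail ?fB.
Qed.

(* Here [q] is meant to be the derivative of [f] at [w], which makes the quotient continuous. *)
Definition quotient_at (q : V) w z : V :=
  if z == w then 2^-1 *: q else ker (z - w) *: (f z - f w).

Lemma quotient_at_neq q w z : z != w -> quotient_at q w z = ker (z - w) *: (f z - f w).
Proof. by rewrite /quotient_at => /negbTE ->. Qed.

Lemma quotient_at_near q w z : z != w -> forall z', cabs (z' - z) < cabs (z - w) ->
  ker (z' - w) *: (f z' - f w) = quotient_at q w z'.
Proof.
move=> zw z' l; rewrite quotient_at_neq //; apply/eqP => E.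
by move: l; rewrite E cabsB ltxx.
Qed.

Lemma cabs_2sub w z : 0 < complex.Re w -> S z -> 1 <= cabs (2 - (z - w)).
Proof.
move=> w0 /andP[z0 z1]; apply: le_trans (Re_le_cabs _); rewrite Re2.
have -> : complex.Re (z - w) = complex.Re z - complex.Re w by case: (z) (w) => ? ? [].
rewrite ger0_norm; lra.
Qed.

Lemma cabs_sub_gt0 w z : z != w -> 0 < cabs (z - w).
Proof. by rewrite cabs_gt0 subr_eq0. Qed.

(** Since [ker u * u = (2 - u)^-1] tends to [1 / 2] at [0], the value [2^-1 *: q] is the right limit
    at [w]; elsewhere this is a product of continuous functions. Positivity of [Re w] keeps [z - w]
    away from the pole [2]. *)
Lemma quotient_at_cont q w : 0 < complex.Re w ->
  (forall e, 0 < e -> exists2 r, 0 < r & forall z', S z' -> cabs (z' - w) < r ->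
     N (f z' - f w - (z' - w) *: q) <= e * cabs (z' - w)) ->
  ccont N (quotient_at q w) S.
Proof.
move=> w0 Hq.
move=> z Sz; have [zw|zw] := eqVneq z w.
  subst z => e e0.
  have e2 : 0 < e / 2 by lra.
  have [r r0 Hr] := Hq _ e2; have q1 : 0 < N q + 1 by have := bn_ge0 HN q; lra.
  exists (Num.min r (e / (N q + 1))); first by rewrite lt_min r0 divr_gt0.
  move=> z' Sz'; rewrite lt_min ltr_pdivlMr // => /andP[l1 l2]; rewrite /quotient_at eqxx.
  have [_|z'w] := eqVneq z' w; first by rewrite subrr (bn0 HN) ltW.
  have x0 := cabs_sub_gt0 z'w; have h := Hr z' Sz' l1.
  have nz : z' - w != 0 by rewrite subr_eq0.
  have g2 := cabs_2sub w0 Sz'; have nz2 := cabs_neq0 ltr01 g2.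
  have -> : ker (z' - w) *: (f z' - f w) - 2^-1 *: q =
     ker (z' - w) *: (f z' - f w - (z' - w) *: q) + (2^-1 * ((z' - w) * (2 - (z' - w))^-1)) *: q.
    have -> : 2^-1 * ((z' - w) * (2 - (z' - w))^-1) = ker (z' - w) * (z' - w) - 2^-1.
      by rewrite /ker; field; rewrite nz nz2.
    by modring.
  have i2 : cabs (2 - (z' - w))^-1 <= 1 by have := cabs_inv_le ltr01 g2; rewrite invr1.
  apply: (le_trans (bn_triangle HN _ _)); rewrite !(bn_scale HN) !cabsM cabs_half.
  have b1 : cabs (ker (z' - w)) * N (f z' - f w - (z' - w) *: q) <= e / 2.
    rewrite /ker invfM cabsM cabsV.
    apply: (@le_trans _ _ ((cabs (z' - w))^-1 * 1 * (e / 2 * cabs (z' - w)))).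
      apply: ler_pM => //; rewrite ?bn_ge0 //.
        by rewrite mulr_ge0 ?invr_ge0 ?cabs_ge0.
      by apply: ler_wpM2l => //; rewrite invr_ge0 cabs_ge0.
    by rewrite mulr1 mulrCA mulVf ?mulr1 // gt_eqF.
  have b2 : 2^-1 * (cabs (z' - w) * cabs (2 - (z' - w))^-1) * N q <= e / 2.
    have : cabs (z' - w) * cabs (2 - (z' - w))^-1 <= cabs (z' - w).
      by apply: ler_piMr => //; exact: ltW.
    have := bn_ge0 HN q; move: (cabs (z' - w) * _) => y; nra.
  lra.
have x0 := cabs_sub_gt0 zw.
pose D := Num.min (cabs (z - w) / 2) 1.
have D0' : 0 < D by rewrite lt_min ltr01 andbT; lra.
have D1' : D <= cabs (z - w) / 2 by rewrite ge_min lexx.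
have D2' : D <= 1 by rewrite ge_min lexx orbT.
have cK : ccat N (fun z => ker (z - w) *: (f z - f w)) S z.
  apply: (ccat_scale HN (K := fun z => ker (z - w)) (H := fun z => f z - f w)
    (L := (D ^+ 2)^-1) (r0 := cabs (z - w) / 2)); first lra.
    move=> z' Sz' l.
    have t1 := cabs_triangle (z' - w) (z - z').
    have E1' : z' - w + (z - z') = z - w by ring.
    rewrite E1' [cabs (z - z')]cabsB in t1.
    have g1 := cabs_2sub w0 Sz; have g2 := cabs_2sub w0 Sz'.
    apply: (le_trans (ker_lip (d := D) (z := z - w) (w := z' - w) D0' _ _ _ _)); try lra.
    by have -> : z' - w - (z - w) = z' - z by ring.
  move=> e e0; have [r r0 Hr] := cf Sz e0; exists r => // z' Sz' l.
  have -> : f z' - f w - (f z - f w) = f z' - f z by modring.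
  exact: Hr.
move=> e e0; have [r r0 Hr] := cK e e0.
exists (Num.min r (cabs (z - w))); first by rewrite lt_min r0.
move=> z' Sz'; rewrite lt_min => /andP[l1 l2].
rewrite -(quotient_at_near q zw l2) -(quotient_at_near q zw (z' := z)) ?subrr ?cabs0 //.
exact: Hr.
Qed.

Lemma quotient_at_diff q w z : 0 < complex.Re w -> 0 < complex.Re z < 1 ->
  complex.Re z \notin [:: complex.Re w; sg] -> cdiff N (quotient_at q w) S z.
Proof.
move=> w0 z01.
rewrite !inE negb_or => /andP[zw zs].
have Sz : S z by case/andP: z01 => /ltW ? /ltW ?; apply/andP.
have zw' : z != w by apply: contraNneq zw => ->.
have ER : complex.Re (z - w) = complex.Re z - complex.Re w by case: (z) (w) => ? ? [].
pose D := Num.min `|complex.Re z - complex.Re w| 1.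
have D0' : 0 < D by rewrite lt_min ltr01 andbT normr_gt0 subr_eq0.
have D1' : D <= `|complex.Re z - complex.Re w| by rewrite ge_min lexx.
have D2' : D <= 1 by rewrite ge_min lexx orbT.
apply: (cdiff_local (cabs_sub_gt0 zw') (quotient_at_near q zw')).
apply: (cdiff_scale HN (K := fun z => ker (z - w)) (H := fun z => f z - f w)) => //.
  apply: (ker_cdiff _ D0' D2'); rewrite ER; split=> //.
  by case/andP: z01 => ? ?; rewrite ger0_norm; lra.
by apply: cdiff_addc; apply: df.
Qed.

Lemma quotient_at_tail q w z : S w -> S z ->
  2 * `|complex.Im w| + 2 <= `|complex.Im z| ->
  N (quotient_at q w z) <= 2 * (B + B) / `|complex.Im z|.
Proof.
move=> Sw Sz hz.
have zw : z != w.
  by apply/eqP => E; move: hz; rewrite E; have := normr_ge0 (complex.Im w); lra.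
rewrite /quotient_at (negbTE zw) (bn_scale HN) mulrAC.
apply: ler_pM; rewrite ?cabs_ge0 ?bn_ge0 ?ker_tail //.
by apply: (le_trans (bnB HN _ _)); apply: lerD; apply: fB.
Qed.

Lemma move_terms (j1 j2 : R[i]) (p x y : V) :
  - 1 *: (j2 *: p) + y = - 1 *: (j1 *: p) + x -> x - y = (j1 - j2) *: p.
Proof.
move=> E; have -> : x - y = (-1 *: (j1 *: p) + x) - (-1 *: (j2 *: p) + y) + (j1 - j2) *: p.
  by modring.
by rewrite E subrr add0r.
Qed.

(** Subtracting the constant [f w] cancels the pole, so the quotient has equal integrals over the
    two boundary lines. What remains are the integrals of the constant: they are [Jline 1] and
    [Jline (-1)], as [1 - Re w] and [- Re w] are joined to [1] and [-1] without crossing a pole. *)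
Lemma strip_in w : 0 < complex.Re w < 1 -> cdiff N f S w ->
  cint N 1 (fun t => f (1 +i* t)) w - cint N 0 (fun t => f (0 +i* t)) w = kappa R *: f w.
Proof.
move=> /andP[w0 w1] [q Hq].
have Sw : S w by rewrite /vstrip /= (ltW w0) (ltW w1).
have M10 : 0 < 2 * `|complex.Im w| + 2 by have := normr_ge0 (complex.Im w); lra.
have P1 := quotient_at_cont w0 Hq.
have P2 z := @quotient_at_diff q w z w0.
have P3 z := @quotient_at_tail q w z Sw.
pose d := Num.min (complex.Re w) (1 - complex.Re w).
have d0 : 0 < d by rewrite lt_min w0 subr_gt0.
have dw : d <= complex.Re w by rewrite ge_min lexx.
have dw1 : d <= 1 - complex.Re w by rewrite ge_min lexx orbT.
have d1 : d <= 1 by lra.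
have i0 : (0 <= 0 :> R) && (0 <= 1 :> R) by apply/andP; split; lra.
have i1 : (0 <= 1 :> R) && (1 <= 1 :> R) by apply/andP; split; lra.
have pos s : d <= s -> s <= 1 -> away d s.
  by move=> ds s1; split; rewrite ger0_norm; lra.
have neg s : s <= - d -> away d s.
  by move=> ds; split; [rewrite ler0_norm|rewrite ger0_norm]; lra.
have a1 : away d (1 - complex.Re w) by apply: pos; lra.
have a0 : away d (0 - complex.Re w) by apply: neg; lra.
have J1 : Jline (1 - complex.Re w) = Jline 1.
  by apply: (Jline_const _ d0 d1) => [|s /andP[? ?]]; [lra|apply: pos; lra].
have J0 : Jline (0 - complex.Re w) = Jline (-1).
  symmetry; apply: (Jline_const _ d0 d1) => [|s /andP[? ?]]; [lra|apply: neg; lra].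
have D0 := cint_decays HN d0 d1 a0 (line_contI i0) (fun t => fB (z := 0 +i* t) i0).
have D1 := cint_decays HN d0 d1 a1 (line_contI i1) (fun t => fB (z := 1 +i* t) i1).
have K0 := is_impr_ker HN (f w) d0 d1 a0; rewrite J0 in K0.
have K1 := is_impr_ker HN (f w) d0 d1 a1; rewrite J1 in K1.
have cst := contI_cst (f w).
have E0 := cint_decays HN d0 d1 a0 cst (fun=> lexx (N (f w))).
have E1 := cint_decays HN d0 d1 a1 cst (fun=> lexx (N (f w))).
have I0 := is_impr_lin HN (-1) E0.1 D0.1 K0 (imprP HN D0).
have I1 := is_impr_lin HN (-1) E1.1 D1.1 K1 (imprP HN D1).
pose H := quotient_at q w.
have Hline c t : c != complex.Re w -> - 1 *: (ker (c +i* t - w) *: f w) +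
    ker (c +i* t - w) *: f (c +i* t) = H (c +i* t).
  move=> cw; rewrite /H quotient_at_neq; last by apply: contraNneq cw => <-.
  by modring.
have n0 : 0 != complex.Re w by rewrite lt_eqF.
have n1 : 1 != complex.Re w by rewrite gt_eqF.
have {}I0 : is_impr N (fun t => H (0 +i* t)) (- 1 *: (Jline (-1) *: f w) +
    cint N 0 (fun t => f (0 +i* t)) w).
  by move: I0; congr (is_impr N _ _); apply/funext => t; apply: Hline.
have {}I1 : is_impr N (fun t => H (1 +i* t)) (- 1 *: (Jline 1 *: f w) +
    cint N 1 (fun t => f (1 +i* t)) w).
  by move: I1; congr (is_impr N _ _); apply/funext => t; apply: Hline.
exact: move_terms (line_shift HN ler01 M10 P1 P2 P3 I0 I1).
Qed.

End StripFormula.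

Lemma gt0_complex (R : realType) (e : R[i]) : 0 < e -> exists2 r : R, 0 < r & e = r%:C.
Proof. by case: e => a b; rewrite ltcE /= => /andP[/eqP -> a0]; exists a. Qed.

(** * The sum space of a couple *)

Section RNorm.
Context (R : realType) (V : normedModType R[i]).
Implicit Types (x y : V).

Lemma normr_rnorm x : `|x| = (rnorm x)%:C.
Proof.
rewrite /rnorm; have := normr_ge0 x; case: (`|x|) => a b /=.
by rewrite lecE /= => /andP[/eqP -> _].
Qed.

Lemma rnormD x y : rnorm (x + y) <= rnorm x + rnorm y.
Proof. by rewrite -lecR rmorphD /= -!normr_rnorm ler_normD. Qed.

Lemma rnormZ (a : R[i]) x : rnorm (a *: x) = cabs a * rnorm x.
Proof. by apply: (@complexI R); rewrite rmorphM /= -normr_cabs -!normr_rnorm normrZ. Qed.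

Lemma rnorm_eq0 x : rnorm x = 0 -> x = 0.
Proof. by move=> h; apply/eqP; rewrite -normr_eq0 normr_rnorm h. Qed.

Lemma continuous_rnormP (g : R -> V) : continuous g <->
  forall t (e : R), 0 < e -> exists2 d : R, 0 < d & forall s, `|s - t| < d -> rnorm (g s - g t) <= e.
Proof.
split=> [cg t e e0|H t].
  have /cvgrPdist_le/(_ e%:C) := cg t; rewrite ltcR => /(_ e0).
  rewrite -nbhs_nearE => /nbhs_ballP[d /= d0 Hd]; exists d => // s st.
  have := Hd s; rewrite /ball /= distrC => /(_ st).
  by rewrite distrC normr_rnorm lecR.
apply/cvgrPdist_le => e /gt0_complex[r r0 ->].
have [d d0 Hd] := H t r r0.
rewrite -nbhs_nearE; apply/nbhs_ballP; exists d => //= s; rewrite /ball /= distrC => st.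
by rewrite distrC normr_rnorm lecR; apply: Hd.
Qed.

End RNorm.

Lemma bnorm_rnorm (R : realType) (V : completeNormedModType R[i]) : bnorm (@rnorm R V).
Proof.
split; [exact: rnormD|exact: rnormZ|exact: rnorm_eq0|].
move=> u c Hu.
have p0 n : 0 < (2 : R) ^- n by rewrite invr_gt0 exprn_gt0.
have c0 : 0 <= c.
  have := Hu 0%N; rewrite expr0 invr1 mulr1; apply: le_trans.
  by rewrite -lecR -normr_rnorm normr_ge0.
have cauchy_bound n k : rnorm (u (n + k)%N - u n) <= 2 * c * (2 ^- n - 2 ^- (n + k)).
  elim: k => [|k IH]; first by rewrite addn0 !subrr mulr0 /rnorm normr0.
  have := rnormD (u (n + k).+1 - u (n + k)%N) (u (n + k)%N - u n).
  rewrite addrA subrK addnS; have := Hu (n + k)%N; rewrite [2 ^+ _.+1]exprS invfM.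
  have := p0 (n + k)%N; nra.
have cvu : cvg (u @ \oo).
  apply/cauchy_cvgP/cauchy_exP => e /gt0_complex[r r0 ->].
  have k1 : 0 < 2 * c + 1 by lra.
  have r1 : 0 < r / 2 / (2 * c + 1) by rewrite !divr_gt0.
  have [n Hn] := pow2_lt r1.
  have := Hn n (leqnn n); rewrite ler_pdivlMr // => hn.
  exists (u n); exists n => // m /= nm.
  rewrite -ball_normE /= distrC normr_rnorm ltcR.
  have := cauchy_bound n (m - n)%N; rewrite subnKC //.
  have := p0 m; have := p0 n; nra.
exists (lim (u @ \oo)) => e e0.
have /cvgrPdist_le/(_ e%:C) := cvu; rewrite ltcR => /(_ e0)[n0 _ Hn0].
exists n0 => n nn; have := Hn0 n nn.
by rewrite /= distrC normr_rnorm lecR.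
Qed.

Section SumSpace.
Context (R : realType) (X : couple R).
Implicit Types (w : amb X) (r e : R).

Lemma rnorm_ge0 (V : completeNormedModType R[i]) (x : V) : 0 <= rnorm x.
Proof. exact: bn_ge0 (bnorm_rnorm V) _. Qed.

Lemma sum_norm_le w (x0 : sp0 X) (x1 : sp1 X) : emb0 X x0 + emb1 X x1 = w -> sum_norm X w <= rnorm x0 + rnorm x1.
Proof.
move=> E; apply: ge_inf; last by exists x0, x1.
by exists 0 => _ [y0 [y1 [_ ->]]]; apply: addr_ge0; apply: rnorm_ge0.
Qed.

Lemma sum_norm_lt w r : in_sum X w -> sum_norm X w < r -> exists (x0 : sp0 X) (x1 : sp1 X),
  emb0 X x0 + emb1 X x1 = w /\ rnorm x0 + rnorm x1 < r.
Proof.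
move=> [y0 [y1 E]] l; rewrite -subr_gt0 in l.
have [|_ [x0 [x1 [E' ->]]]] := inf_adherent l (E := [set r : R | exists (x0 : sp0 X) (x1 : sp1 X),
  emb0 X x0 + emb1 X x1 = w /\ r = rnorm x0 + rnorm x1]); last first.
  by rewrite -/(sum_norm X w) => lt; exists x0, x1; split=> //; lra.
split; first by exists (rnorm y0 + rnorm y1); exists y0, y1.
by exists 0 => _ [z0 [z1 [_ ->]]]; apply: addr_ge0; apply: rnorm_ge0.
Qed.

Lemma in_sum_lin (a : R[i]) u v : in_sum X u -> in_sum X v -> in_sum X (a *: u + v).
Proof.
move=> [x0 [x1 <-]] [y0 [y1 <-]]; exists (a *: x0 + y0), (a *: x1 + y1).
by rewrite !linearP scalerDr addrACA.
Qed.

Lemma in_sum0 : in_sum X 0.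
Proof. by exists 0, 0; rewrite !linear0 addr0. Qed.

Lemma in_sumD u v : in_sum X u -> in_sum X v -> in_sum X (u + v).
Proof. by move=> hu hv; rewrite -[u]scale1r; apply: in_sum_lin. Qed.

Lemma in_sumZ a u : in_sum X u -> in_sum X (a *: u).
Proof. by move=> hu; rewrite -[_ *: _]addr0; apply: in_sum_lin => //; apply: in_sum0. Qed.

Lemma in_sumB u v : in_sum X u -> in_sum X v -> in_sum X (u - v).
Proof. by move=> hu hv; apply: in_sumD => //; rewrite -scaleN1r; apply: in_sumZ. Qed.

Lemma in_sum_emb0 (x0 : sp0 X) : in_sum X (emb0 X x0).
Proof. by exists x0, 0; rewrite linear0 addr0. Qed.

Lemma in_sum_emb1 (x1 : sp1 X) : in_sum X (emb1 X x1).
Proof. by exists 0, x1; rewrite linear0 add0r. Qed.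

Definition sum_pred : {pred amb X} := fun w => `[< in_sum X w >].

Lemma sum_pred_closed : submod_closed sum_pred.
Proof.
split; first by apply/asboolP/in_sum0.
by move=> a u v /asboolP hu /asboolP hv; apply/asboolP/in_sum_lin.
Qed.
HB.instance Definition _ := GRing.isSubmodClosed.Build R[i] (amb X) sum_pred sum_pred_closed.

(** The integration theory needs a module on which [N] is a norm, whereas the ambient space contains
    vectors outside the sum; hence a type for the sum itself. *)
Record sum_space := SumSpace { sum_val :> amb X; _ : sum_val \in sum_pred }.
HB.instance Definition _ := [isSub for sum_val].
HB.instance Definition _ := [Choice of sum_space by <:].
HB.instance Definition _ := [SubChoice_isSubLmodule of sum_space by <:].

(** Vectors outside the sum are sent to [0]. *)
Definition to_sum w : sum_space := insubd 0 w.

Lemma to_sumK w : in_sum X w -> sum_val (to_sum w) = w.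
Proof. by move=> h; rewrite /to_sum; apply: (@insubdK _ _ _ 0); apply/asboolP. Qed.

Lemma sum_valP (u : sum_space) : in_sum X (sum_val u).
Proof. by case: u => w /= /asboolP. Qed.

Definition nsum (u : sum_space) : R := sum_norm X (sum_val u).

Lemma sum_valD u v : sum_val (u + v) = sum_val u + sum_val v.
Proof. exact: (raddfD (val : sum_space -> amb X)). Qed.

Lemma sum_valZ a u : sum_val (a *: u) = a *: sum_val u.
Proof. exact: (linearZ_LR (val : sum_space -> amb X)). Qed.

Lemma sum_valN u : sum_val (- u) = - sum_val u.
Proof. by rewrite -scaleN1r sum_valZ scaleN1r. Qed.

Lemma sum_val_inj : injective sum_val.
Proof. exact: val_inj. Qed.

Lemma inf_ge0 (S : set R) : (forall r, S r -> 0 <= r) -> 0 <= inf S.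
Proof.
move=> S0; have [->|/set0P ne] := eqVneq S set0; first by rewrite inf0.
exact: lb_le_inf.
Qed.

Lemma sum_norm_ge0 w : 0 <= sum_norm X w.
Proof.
apply: inf_ge0 => _ [z0 [z1 [_ ->]]]; apply: addr_ge0; exact: rnorm_ge0.
Qed.

Lemma sum_norm0 : sum_norm X 0 = 0.
Proof.
apply/eqP; rewrite eq_le sum_norm_ge0 andbT.
have := @sum_norm_le 0 0 0; rewrite !linear0 addr0 => /(_ erefl).
by rewrite /rnorm !normr0 addr0.
Qed.

Lemma sum_normD u v : in_sum X u -> in_sum X v ->
  sum_norm X (u + v) <= sum_norm X u + sum_norm X v.
Proof.
move=> hu hv; apply/ler_addgt0Pr => e e0.
have [|x0 [x1 [Ex lx]]] := sum_norm_lt hu (r := sum_norm X u + e / 2); first lra.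
have [|y0 [y1 [Ey ly]]] := sum_norm_lt hv (r := sum_norm X v + e / 2); first lra.
have := @sum_norm_le (u + v) (x0 + y0) (x1 + y1); rewrite !linearD /= addrACA Ex Ey => /(_ erefl).
have := rnormD x0 y0; have := rnormD x1 y1; lra.
Qed.

Lemma sum_norm_scale_le (a : R[i]) u : in_sum X u ->
  sum_norm X (a *: u) <= cabs a * sum_norm X u.
Proof.
move=> hu; apply: (@ler_addeps _ _ _ (cabs a)); first exact: cabs_ge0.
move=> e e0.
have [|x0 [x1 [Ex lx]]] := sum_norm_lt hu (r := sum_norm X u + e); first lra.
have := @sum_norm_le (a *: u) (a *: x0) (a *: x1); rewrite !linearZ -scalerDr Ex => /(_ erefl).
rewrite !rnormZ -mulrDr => /le_trans; apply.
rewrite [e * _]mulrC -mulrDr; apply: ler_wpM2l; [exact: cabs_ge0|exact: ltW].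
Qed.

Lemma sum_normZ (a : R[i]) u : in_sum X u -> sum_norm X (a *: u) = cabs a * sum_norm X u.
Proof.
move=> hu; apply/eqP; rewrite eq_le sum_norm_scale_le //=.
have [->|a0] := eqVneq a 0; first by rewrite cabs0 mul0r sum_norm_ge0.
have := @sum_norm_scale_le a^-1 (a *: u) (in_sumZ _ hu).
rewrite scalerA mulVf // scale1r cabsV mulrC ler_pdivlMr ?cabs_gt0 //.
by rewrite mulrC.
Qed.

Lemma cvg_emb0 (a : nat -> sp0 X) : (forall n, rnorm (a n) <= 2 ^- n) ->
  emb0 X (a n) @[n --> \oo] --> (0 : amb X).
Proof.
move=> Ha; rewrite -(linear0 (emb0 X)).
apply: (cvg_comp a (emb0 X)); last exact: emb0_cont.
apply/cvgr0Pnorm_le => e /gt0_complex[r r0 ->].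
have [n0 Hn] := pow2_lt r0; exists n0 => // n /= nn.
by rewrite normr_rnorm lecR (le_trans (Ha n)) // Hn.
Qed.

Lemma cvg_emb1 (a : nat -> sp1 X) : (forall n, rnorm (a n) <= 2 ^- n) ->
  emb1 X (a n) @[n --> \oo] --> (0 : amb X).
Proof.
move=> Ha; rewrite -(linear0 (emb1 X)).
apply: (cvg_comp a (emb1 X)); last exact: emb1_cont.
apply/cvgr0Pnorm_le => e /gt0_complex[r r0 ->].
have [n0 Hn] := pow2_lt r0; exists n0 => // n /= nn.
by rewrite normr_rnorm lecR (le_trans (Ha n)) // Hn.
Qed.

(** Decompositions of [w] with norms below [2^-n] have both components tending to [0] in the ambient
    space, by continuity of the embeddings; their sum is constantly [w], and limits are unique in a
    Hausdorff space. *)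
Lemma sum_norm_sep w : in_sum X w -> sum_norm X w = 0 -> w = 0.
Proof.
move=> hw w0.
have dec n : exists xy : sp0 X * sp1 X, emb0 X xy.1 + emb1 X xy.2 = w /\
    rnorm xy.1 + rnorm xy.2 < 2 ^- n.
  have [|x0 [x1 h]] := sum_norm_lt hw (r := 2 ^- n).
    by rewrite w0 invr_gt0 exprn_gt0.
  by exists (x0, x1).
have [d Hd] := choice dec.
have c0 : emb0 X (d n).1 @[n --> \oo] --> (0 : amb X).
  apply: (@cvg_emb0 (fun n => (d n).1)) => n; have [_] := Hd n.
  by have := rnorm_ge0 (d n).2; lra.
have c1 : emb1 X (d n).2 @[n --> \oo] --> (0 : amb X).
  apply: (@cvg_emb1 (fun n => (d n).2)) => n; have [_] := Hd n.
  by have := rnorm_ge0 (d n).1; lra.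
have c2 : (emb0 X (d n).1 + emb1 X (d n).2) @[n --> \oo] --> (0 + 0 : amb X).
  apply: (@cvg_comp _ _ _ (fun n => (emb0 X (d n).1, emb1 X (d n).2))
    (fun p : amb X * amb X => p.1 + p.2) _ _ _ (cvg_pair c0 c1)).
  exact: (add_continuous (0, 0)).
apply: (cvg_unique (@amb_hausdorff _ X) _ _ (F := (emb0 X (d n).1 + emb1 X (d n).2) @[n --> \oo])).
  rewrite /=; under eq_cvg do rewrite (Hd _).1.
  exact: cvg_cst.
by rewrite /= -[0]addr0.
Qed.

(** Increments of the sequence are decomposed one by one, and the components are summed separately
    in [X_0] and [X_1]. The constant [c + 1] replaces [c] because the infimum in [sum_norm] need not
    be attained. *)
Lemma bnorm_nsum : bnorm nsum.
Proof.
rewrite /nsum; split.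
- by move=> u v; rewrite sum_valD sum_normD //; apply: sum_valP.
- by move=> a u; rewrite sum_valZ sum_normZ //; apply: sum_valP.
- by move=> u /(sum_norm_sep (sum_valP u)) h; apply: sum_val_inj.
move=> u c Hu.
have p0 n : 0 < (2 : R) ^- n by rewrite invr_gt0 exprn_gt0.
have dec n : exists xy : sp0 X * sp1 X,
    emb0 X xy.1 + emb1 X xy.2 = sum_val (u n.+1) - sum_val (u n) /\
    rnorm xy.1 + rnorm xy.2 < (c + 1) * 2 ^- n.
  have := Hu n; rewrite sum_valD sum_valN => h.
  have [||x0 [x1 H]] := @sum_norm_lt (sum_val (u n.+1) - sum_val (u n)) ((c + 1) * 2 ^- n).
  - by apply: in_sumB; apply: sum_valP.
  - by have := p0 n; lra.
  by exists (x0, x1).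
have [d Hd] := choice dec.
have [n|lA HA] := bn_complete (bnorm_rnorm (sp0 X)) (u := fun n => \sum_(k < n) (d k).1) (c := c + 1).
  rewrite big_ord_recr /= addrAC subrr add0r; have [_] := Hd n; have := rnorm_ge0 (d n).2; lra.
have [n|lB HB] := bn_complete (bnorm_rnorm (sp1 X)) (u := fun n => \sum_(k < n) (d k).2) (c := c + 1).
  rewrite big_ord_recr /= addrAC subrr add0r; have [_] := Hd n; have := rnorm_ge0 (d n).1; lra.
have uE n : sum_val (u n) = sum_val (u 0%N) + (emb0 X (\sum_(k < n) (d k).1) + emb1 X (\sum_(k < n) (d k).2)).
  elim: n => [|n IH]; first by rewrite !big_ord0 !linear0 !addr0.
  rewrite !big_ord_recr /= !linearD /= [X in _ = _ + X]addrACA [RHS]addrA -IH (Hd n).1.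
  by rewrite addrC subrK.
have hl : in_sum X (emb0 X lA + emb1 X lB) by exists lA, lB.
exists (u 0%N + to_sum (emb0 X lA + emb1 X lB)) => e e0.
have [n1 H1] := HA (e / 2) ltac:(lra); have [n2 H2] := HB (e / 2) ltac:(lra).
exists (maxn n1 n2) => n; rewrite geq_max => /andP[/H1 h1 /H2 h2].
rewrite sum_valD sum_valN sum_valD to_sumK // uE.
apply: (le_trans (sum_norm_le (x0 := \sum_(k < n) (d k).1 - lA) (x1 := \sum_(k < n) (d k).2 - lB) _)); last lra.
by rewrite !linearB /=; modring.
Qed.

End SumSpace.

(** * Calculus of continuity and complex differentiability *)

Section DiffLemmas.
Context (R : realType) (V : lmodType R[i]) (N : V -> R) (HN : bnorm N).
Implicit Types (D : set R[i]) (z w : R[i]) (H : R[i] -> V) (c d e B : R).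

Lemma ccat_cst (p : V) D z : ccat N (fun=> p) D z.
Proof. by move=> e e0; exists 1 => // z' _ _; rewrite subrr (bn0 HN) ltW. Qed.

Lemma cdiff_cst (p : V) D z : cdiff N (fun=> p) D z.
Proof.
exists 0 => e e0; exists 1 => // z' _ _; rewrite subrr scaler0 subrr (bn0 HN).
by rewrite mulr_ge0 ?cabs_ge0 // ltW.
Qed.

Lemma ccat_add H H' D z : ccat N H D z -> ccat N H' D z -> ccat N (fun z => H z + H' z) D z.
Proof.
move=> cH cH' e e0; have [r r0 Hr] := cH (e / 2) ltac:(lra).
have [r' r'0 Hr'] := cH' (e / 2) ltac:(lra).
exists (Num.min r r'); first by rewrite lt_min r0.
move=> z' Dz'; rewrite lt_min => /andP[l1 l2].
have -> : H z' + H' z' - (H z + H' z) = (H z' - H z) + (H' z' - H' z) by modring.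
apply: (le_trans (bn_triangle HN _ _)).
have := Hr _ Dz' l1; have := Hr' _ Dz' l2; lra.
Qed.

Lemma cdiff_add H H' D z : cdiff N H D z -> cdiff N H' D z -> cdiff N (fun z => H z + H' z) D z.
Proof.
move=> [q Hq] [q' Hq']; exists (q + q') => e e0.
have [r r0 Hr] := Hq (e / 2) ltac:(lra); have [r' r'0 Hr'] := Hq' (e / 2) ltac:(lra).
exists (Num.min r r'); first by rewrite lt_min r0.
move=> z' Dz'; rewrite lt_min => /andP[l1 l2].
have -> : H z' + H' z' - (H z + H' z) - (z' - z) *: (q + q') =
   (H z' - H z - (z' - z) *: q) + (H' z' - H' z - (z' - z) *: q') by modring.
apply: (le_trans (bn_triangle HN _ _)).
have := Hr _ Dz' l1; have := Hr' _ Dz' l2; lra.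
Qed.

Lemma ccat_scalec (a : R[i]) H D z : ccat N H D z -> ccat N (fun z => a *: H z) D z.
Proof.
by move=> cH; apply: (ccat_scale HN (K := fun=> a) (L := 0) ltr01) => // z' _ _;
  rewrite subrr cabs0 mulr0.
Qed.

Lemma cdiff_scalec (a : R[i]) H D z : D z -> cdiff N H D z -> cdiff N (fun z => a *: H z) D z.
Proof.
move=> Dz dH; apply: (cdiff_scale HN (K := fun=> a)) => //.
exists 0 => e e0; exists 1 => // z' _ _.
by rewrite subrr scaler0 subrr cabs0 mulr_ge0 ?cabs_ge0 // ltW.
Qed.

Lemma ccat_local H H' D z r : 0 < r -> (forall z', cabs (z' - z) < r -> H z' = H' z') ->
  ccat N H D z -> ccat N H' D z.
Proof.
move=> r0 E cH e e0; have [r1 r10 Hr] := cH e e0.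
exists (Num.min r r1); first by rewrite lt_min r0.
move=> z' Dz'; rewrite lt_min => /andP[l1 l2].
by rewrite -!E ?subrr ?cabs0 //; apply: Hr.
Qed.

Lemma ccat_comp (h : R[i]) H D z : (forall z, D z -> D (z + h)) -> ccat N H D (z + h) ->
  ccat N (fun z => H (z + h)) D z.
Proof.
move=> DD cH e e0; have [r r0 Hr] := cH e e0; exists r => // z' /DD Dz' l.
by apply: Hr => //; have -> : z' + h - (z + h) = z' - z by ring.
Qed.

Lemma cdiff_comp (h : R[i]) H D D' z : (forall z, D z -> D' (z + h)) -> cdiff N H D' (z + h) ->
  cdiff N (fun z => H (z + h)) D z.
Proof.
move=> DD [q Hq]; exists q => e e0; have [r r0 Hr] := Hq e e0; exists r => // z' /DD Dz' l.
have E : z' + h - (z + h) = z' - z by ring.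
by have := Hr _ Dz'; rewrite E; apply.
Qed.

Lemma cint_cdiff c g w d B D : 0 < d -> d <= 1 -> away d (c - complex.Re w) ->
  (forall a b, contI N g a b) -> (forall t, N (g t) <= B) ->
  cdiff N (cint N c g) D w.
Proof.
move=> d0 d1 aw cg gB; have [q Hq] := cint_diff HN d0 d1 aw cg gB; exists q => e e0.
have B0 : 0 <= B by apply: le_trans (gB 0); apply: bn_ge0.
set K := 16 / d ^+ 3 * B in Hq.
have K0 : 0 <= K by rewrite /K mulr_ge0 // divr_ge0 // exprn_ge0 // ltW.
have K1 : 0 < K + 1 by lra.
exists (Num.min (d / 2) (e / (K + 1))); first by rewrite lt_min; apply/andP; split; [lra|exact: divr_gt0].
move=> z' _; rewrite lt_min => /andP[/ltW l1]; rewrite ltr_pdivlMr // => l2.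
apply: (le_trans (Hq _ l1)); rewrite expr2 -mulrA mulrC; apply: ler_wpM2r; first exact: cabs_ge0.
by have := cabs_ge0 (z' - w); lra.
Qed.

Lemma inv_cdiff (w z : R[i]) D : z != w ->
  @cdiff R R[i]^o (@cabs R) (fun z => (z - w)^-1) D z.
Proof.
move=> zw; have z0 := cabs_sub_gt0 zw; exists (- (z - w) ^- 2) => e e0.
set m := cabs (z - w) in z0.
have p0 : 0 < e * m ^+ 3 / 2 by rewrite divr_gt0 // mulr_gt0 // exprn_gt0.
exists (Num.min (m / 2) (e * m ^+ 3 / 2)); first by rewrite lt_min p0 andbT; lra.
move=> z' _; rewrite lt_min => /andP[l1 l2].
have t1 := cabs_triangle (z' - w) (z - z').
have E1 : z' - w + (z - z') = z - w by ring.
rewrite E1 [cabs (z - z')]cabsB -/m in t1.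
have m2 : m / 2 <= cabs (z' - w) by lra.
have n1 : z - w != 0 by rewrite subr_eq0.
have m20 : 0 < m / 2 by lra.
have n2 := cabs_neq0 m20 m2.
have -> : (z' - w)^-1 - (z - w)^-1 - (z' - z) *: (- (z - w) ^- 2 : R[i]^o) =
  (z' - z) * ((z' - z) * ((z - w)^-1 * (z - w)^-1 * (z' - w)^-1)).
  by rewrite -[_ *: _]/(_ * _); field; rewrite n1 n2.
rewrite cabsM mulrC; apply: ler_wpM2r; first exact: cabs_ge0.
rewrite cabsM.
have b1 : cabs ((z - w)^-1 * (z - w)^-1 * (z' - w)^-1) <= 2 / m ^+ 3.
  rewrite !cabsM [cabs (z - w)^-1]cabsV -/m.
  have h := cabs_inv_le m20 m2.
  apply: (@le_trans _ _ (m^-1 * m^-1 * (m / 2)^-1)).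
    by apply: ler_wpM2l => //; rewrite mulr_ge0 // invr_ge0 ltW.
  by apply: eq_leW; field; rewrite gt_eqF.
apply: (le_trans (ler_wpM2l (cabs_ge0 _) b1)).
rewrite mulrA ler_pdivrMr ?exprn_gt0 // -ler_pdivlMr //.
exact: ltW.
Qed.

End DiffLemmas.

Lemma ccat_map (R : realType) (V W : lmodType R[i]) (N : V -> R) (N' : W -> R) (HN : bnorm N)
    (L : V -> W) (c : R) (H : R[i] -> V) (D : set R[i]) z :
  (forall p q, L (p - q) = L p - L q) ->
  (forall p, N' (L p) <= c * N p) -> ccat N H D z -> ccat N' (L \o H) D z.
Proof.
move=> LB Lc cH e e0; have c1 : 0 < `|c| + 1 by have := normr_ge0 c; lra.
have [r r0 Hr] := cH _ (divr_gt0 e0 c1); exists r => // z' Dz' l.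
have := Hr z' Dz' l; rewrite ler_pdivlMr // => h; rewrite /= -LB.
apply: (le_trans (Lc _)); have := ler_norm c; have := bn_ge0 HN (H z' - H z); nra.
Qed.

Lemma cdiff_map (R : realType) (V W : lmodType R[i]) (N : V -> R) (N' : W -> R) (HN : bnorm N)
    (L : V -> W) (c : R) (H : R[i] -> V) (D : set R[i]) z :
  (forall p q, L (p - q) = L p - L q) -> (forall (a : R[i]) p, L (a *: p) = a *: L p) ->
  (forall p, N' (L p) <= c * N p) -> cdiff N H D z -> cdiff N' (L \o H) D z.
Proof.
move=> LB LZ Lc [q Hq]; exists (L q) => e e0; have c1 : 0 < `|c| + 1 by have := normr_ge0 c; lra.
have [r r0 Hr] := Hq _ (divr_gt0 e0 c1); exists r => // z' Dz' l.
have := Hr z' Dz' l; rewrite mulrAC ler_pdivlMr // => h; rewrite /= -LZ -!LB.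
apply: (le_trans (Lc _)); apply: le_trans h; rewrite mulrC.
by apply: ler_wpM2l; [exact: bn_ge0|have := ler_norm c; lra].
Qed.

Lemma cint_map (R : realType) (V W : lmodType R[i]) (N : V -> R) (N' : W -> R)
    (HN : bnorm N) (HN' : bnorm N') (L : V -> W) (k : R) (g : R -> V) (c d B : R) (w : R[i]) :
  (forall (a : R[i]) p q, L (a *: p + q) = a *: L p + L q) ->
  (forall p, N' (L p) <= k * N p) ->
  0 < d -> d <= 1 -> away d (c - complex.Re w) ->
  (forall a b, contI N g a b) -> (forall t, N (g t) <= B) ->
  L (cint N c g w) = cint N' c (L \o g) w.
Proof.
move=> Ll Lk d0 d1 aw cg gB; have D := cint_decays HN d0 d1 aw cg gB.
have L0 : L 0 = 0.
  by have := Ll 1 0 0; rewrite !scale1r addr0 => /eqP; rewrite -[X in X == _]addr0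
    (inj_eq (addrI _)) => /eqP.
have := is_impr_map HN HN' Ll Lk D.1 (imprP HN D).
move=> /(impr_eq HN') <-; rewrite /cint; congr impr; apply/funext => t /=.
by rewrite -[_ *: g t]addr0 Ll L0 addr0.
Qed.

(** * Removable singularities in the strip *)

Section Removable.
Context (R : realType) (V : lmodType R[i]) (N : V -> R) (HN : bnorm N).
Local Notation S := (vstrip (0 : R) 1).

(** The Cauchy integral [G] of the boundary values is differentiable at [p]. It equals [f] at all
    other interior points, including those on the exempted line [Re z = Re p], and at [p] itself by
    continuity of both. *)
Lemma removable (f : R[i] -> V) (B : R) (p : R[i]) : 0 < complex.Re p < 1 ->
  ccont N f S -> (forall z, S z -> N (f z) <= B) ->
  (forall z, 0 < complex.Re z < 1 -> z != p -> cdiff N f S z) -> cdiff N f S p.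
Proof.
move=> p01 cf fB df; have /andP[p0 p1] := p01.
have df' z : 0 < complex.Re z < 1 -> complex.Re z != complex.Re p -> cdiff N f S z.
  by move=> z01 zp; apply: df => //; apply: contraNneq zp => ->.
pose d := Num.min (complex.Re p) (1 - complex.Re p).
have d0 : 0 < d by rewrite lt_min p0 subr_gt0.
have dp : d <= complex.Re p by rewrite ge_min lexx.
have dp1 : d <= 1 - complex.Re p by rewrite ge_min lexx orbT.
have d1 : d <= 1 by lra.
have i0 : (0 <= 0 :> R) && (0 <= 1 :> R) by apply/andP; split; lra.
have i1 : (0 <= 1 :> R) && (1 <= 1 :> R) by apply/andP; split; lra.
pose G w := (kappa R)^-1 *: (cint N 1 (fun t => f (1 +i* t)) w + - 1 *: cint N 0 (fun t => f (0 +i* t)) w).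
have Sp : S p by rewrite /vstrip /= !ltW.
have dG : cdiff N G S p.
  apply: (cdiff_scalec HN) => //; apply: (cdiff_add HN); last apply: (cdiff_scalec HN) => //.
    apply: (cint_cdiff HN _ d0 d1 _ (line_contI cf i1) (fun t => fB (1 +i* t) i1)).
    by split; rewrite ger0_norm; lra.
  apply: (cint_cdiff HN _ d0 d1 _ (line_contI cf i0) (fun t => fB (0 +i* t) i0)).
  by split; [rewrite ler0_norm|rewrite ger0_norm]; lra.
have fG z : 0 < complex.Re z < 1 -> z != p -> f z = G z.
  move=> z01 zp; rewrite /G scaleN1r (strip_in HN cf fB df' z01 (df z z01 zp)).
  by rewrite scalerA mulVf ?scale1r // kappa_neq0.
have near z : cabs (z - p) < d -> 0 < complex.Re z < 1.
  move=> h; have := le_lt_trans (Re_le_cabs _) h.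
  have -> : complex.Re (z - p) = complex.Re z - complex.Re p by case: (z) (p) => ? ? [].
  by rewrite ltr_norml => /andP[? ?]; apply/andP; split; lra.
have fGp : G p = f p.
  apply: (bn_eq HN) => e e0; have e2 : 0 < e / 2 by lra.
  have [r r0 Hr] := cf p Sp _ e2; have [r' r'0 Hr'] := cdiff_cont HN dG e2.
  pose s := Num.min (Num.min r r') d / 2.
  have s0 : 0 < Num.min (Num.min r r') d by rewrite lt_min d0 lt_min r0 r'0.
  have s1 : Num.min (Num.min r r') d <= r by rewrite !ge_min lexx.
  have s2 : Num.min (Num.min r r') d <= r' by rewrite !ge_min lexx orbT.
  have s3 : Num.min (Num.min r r') d <= d by rewrite ge_min lexx orbT.
  pose z := p + s%:C.
  have zE : cabs (z - p) = s by rewrite /z addrC addKr cabsR ger0_norm // /s; lra.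
  have zd : cabs (z - p) < d by rewrite zE /s; lra.
  have zp : z != p by rewrite -subr_eq0 -cabs_gt0 zE /s; lra.
  have z01 := near z zd.
  have Sz : S z by case/andP: z01 => /ltW ? /ltW ?; apply/andP.
  have h1 := Hr z Sz ltac:(rewrite zE /s; lra).
  have h2 := Hr' z Sz ltac:(rewrite zE /s; lra).
  have h3 : N (G p - f z) <= e / 2 by rewrite fG // (bn_sym HN (G p)).
  by have := bn_trans HN (f z) (G p) (f p); lra.
apply: (cdiff_local d0 _ dG) => z /near z01; have [->//|zp] := eqVneq z p.
by rewrite fG.
Qed.

End Removable.

(** * The Calderon space *)

Section CalF.
Context (R : realType) (X : couple R).
Implicit Types (f : R[i] -> amb X) (z w : R[i]) (B M e : R) (u v : amb X).
Local Notation S := (vstrip (0 : R) 1).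
Local Notation HS := (@bnorm_nsum R X).
Local Notation H0 := (bnorm_rnorm (sp0 X)).
Local Notation H1 := (bnorm_rnorm (sp1 X)).

Lemma to_sum_lin (a : R[i]) u v : in_sum X u -> in_sum X v ->
  to_sum (a *: u + v) = a *: to_sum u + to_sum v.
Proof.
move=> hu hv; apply: sum_val_inj.
by rewrite sum_valD sum_valZ !to_sumK //; apply: in_sum_lin.
Qed.

Lemma to_sum0 : to_sum (0 : amb X) = 0.
Proof. by apply: sum_val_inj; rewrite to_sumK //; apply: in_sum0. Qed.

Lemma to_sumZ (a : R[i]) u : in_sum X u -> to_sum (a *: u) = a *: to_sum u.
Proof.
by move=> hu; rewrite -[a *: u]addr0 to_sum_lin ?to_sum0 ?addr0 //; apply: in_sum0.
Qed.

Lemma to_sumD u v : in_sum X u -> in_sum X v -> to_sum (u + v) = to_sum u + to_sum v.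
Proof. by move=> hu hv; rewrite -[u]scale1r to_sum_lin // !scale1r. Qed.

Lemma to_sumB u v : in_sum X u -> in_sum X v -> to_sum (u - v) = to_sum u - to_sum v.
Proof.
move=> hu hv; rewrite -[- v]scaleN1r -[- to_sum v]scaleN1r -to_sumZ //.
by apply: to_sumD => //; apply: in_sumZ.
Qed.

Lemma nsumE u : in_sum X u -> nsum (to_sum u) = sum_norm X u.
Proof. by move=> hu; rewrite /nsum to_sumK. Qed.

Definition sum_in0 (x : sp0 X) : sum_space X := to_sum (emb0 X x).
Definition sum_in1 (x : sp1 X) : sum_space X := to_sum (emb1 X x).

Lemma sum_in0_lin (a : R[i]) x y : sum_in0 (a *: x + y) = a *: sum_in0 x + sum_in0 y.
Proof. by rewrite /sum_in0 linearP to_sum_lin //; apply: in_sum_emb0. Qed.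

Lemma sum_in1_lin (a : R[i]) x y : sum_in1 (a *: x + y) = a *: sum_in1 x + sum_in1 y.
Proof. by rewrite /sum_in1 linearP to_sum_lin //; apply: in_sum_emb1. Qed.

Lemma sum_in0_le x : nsum (sum_in0 x) <= 1 * rnorm x.
Proof.
rewrite mul1r /sum_in0 nsumE; last exact: in_sum_emb0.
apply: (le_trans (sum_norm_le (x0 := x) (x1 := 0) _)); first by rewrite linear0 addr0.
by rewrite /rnorm normr0 addr0.
Qed.

Lemma sum_in1_le x : nsum (sum_in1 x) <= 1 * rnorm x.
Proof.
rewrite mul1r /sum_in1 nsumE; last exact: in_sum_emb1.
apply: (le_trans (sum_norm_le (x0 := 0) (x1 := x) _)); first by rewrite linear0 add0r.
by rewrite /rnorm normr0 add0r.
Qed.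

Lemma sum_in0Z (a : R[i]) x : sum_in0 (a *: x) = a *: sum_in0 x.
Proof. by rewrite /sum_in0 linearZ to_sumZ //; apply: in_sum_emb0. Qed.

Lemma sum_in1Z (a : R[i]) x : sum_in1 (a *: x) = a *: sum_in1 x.
Proof. by rewrite /sum_in1 linearZ to_sumZ //; apply: in_sum_emb1. Qed.

Lemma sum_in0B x y : sum_in0 (x - y) = sum_in0 x - sum_in0 y.
Proof. by rewrite /sum_in0 linearB to_sumB //; apply: in_sum_emb0. Qed.

Lemma sum_in1B x y : sum_in1 (x - y) = sum_in1 x - sum_in1 y.
Proof. by rewrite /sum_in1 linearB to_sumB //; apply: in_sum_emb1. Qed.

(** Membership in the Calderon space with the boundary functions named and one bound [B] for both.
    Constants can then be followed without the infima and suprema of [calF_norm]. *)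
Record Fdata f (g0 : R -> sp0 X) (g1 : R -> sp1 X) B : Prop := FData {
  F_sum : forall z, S z -> in_sum X (f z);
  F_bnd : exists M, forall z, S z -> sum_norm X (f z) <= M;
  F_cont : ccont (@nsum R X) (fun z => to_sum (f z)) S;
  F_diff : forall z, 0 < complex.Re z < 1 -> cdiff (@nsum R X) (fun z => to_sum (f z)) S z;
  F_eq0 : forall t, emb0 X (g0 t) = f (0 +i* t);
  F_cont0 : forall a b, contI (@rnorm R (sp0 X)) g0 a b;
  F_le0 : forall t, rnorm (g0 t) <= B;
  F_eq1 : forall t, emb1 X (g1 t) = f (1 +i* t);
  F_cont1 : forall a b, contI (@rnorm R (sp1 X)) g1 a b;
  F_le1 : forall t, rnorm (g1 t) <= B }.

Lemma contI_all (V : normedModType R[i]) (g : R -> V) :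
  (forall a b, contI (@rnorm R V) g a b) <-> continuous g.
Proof.
split=> [cg|/continuous_rnormP cg a b x _ e e0].
  apply/continuous_rnormP => t e e0.
  have [|d d0 Hd] := cg (t - 1) (t + 1) t _ e e0; first by apply/andP; split; lra.
  exists (Num.min d 1); first by rewrite lt_min d0 ltr01.
  move=> s; rewrite lt_min => /andP[l]; rewrite ltr_norml => /andP[? ?].
  by apply: Hd; rewrite ?l //; apply/andP; split; lra.
have [d d0 Hd] := cg x e e0; exists d => // y _ l; exact: Hd.
Qed.

Lemma in_strip z : 0 < complex.Re z < 1 -> S z.
Proof. by case/andP => /ltW ? /ltW ?; apply/andP. Qed.

Lemma calF_Fdata f : calF X f -> exists g0 g1 B, Fdata f g0 g1 B.
Proof.
move=> [fs [[M fM] [fc [fd [[g0 [e0 [c0 [B0 b0]]]] [g1 [e1 [c1 [B1 b1]]]]]]]]].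
exists g0, g1, (Num.max B0 B1); split => //.
- by exists M.
- move=> z Sz e ep; have [d dp Hd] := fc z Sz e ep; exists d => // z' Sz' l.
  by rewrite /= -to_sumB ?nsumE ?ltW ?Hd //; try apply: in_sumB; apply: fs.
- move=> z z01; have [q hq Hq] := fd z z01; exists (to_sum q) => e ep.
  have [d dp Hd] := Hq e ep; exists d => // z' Sz' l.
  have Sz := in_strip z01.
  have hz := fs z Sz; have hz' := fs z' Sz'.
  have [->|zz] := eqVneq z' z; first by rewrite !subrr scale0r subrr (bn0 HS) cabs0 mulr0.
  have n0 : z' - z != 0 by rewrite subr_eq0.
  have := Hd (z' - z) n0 l; rewrite addrC subrK => /(_ Sz').
  rewrite /= -to_sumB // -to_sumZ // -to_sumB; [|exact: in_sumB|exact: in_sumZ].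
  rewrite nsumE; last by apply: in_sumB; [exact: in_sumB|exact: in_sumZ].
  have -> : f z' - f z - (z' - z) *: q = (z' - z) *: ((z' - z)^-1 *: (f z' - f z) - q).
    by rewrite scalerBr scalerA divff // scale1r.
  rewrite sum_normZ; last by apply: in_sumB => //; apply: in_sumZ; apply: in_sumB.
  by move=> /ltW h; rewrite mulrC ler_wpM2r // cabs_ge0.
- exact/contI_all.
- by move=> t; rewrite (le_trans (b0 t)) // le_max lexx.
- exact/contI_all.
- by move=> t; rewrite (le_trans (b1 t)) // le_max lexx orbT.
Qed.

Lemma Fdata_calF f g0 g1 B : Fdata f g0 g1 B -> calF X f.
Proof.
move=> [fs fM fc fd e0 c0 b0 e1 c1 b1]; do ![split => //].
- move=> z Sz e ep; have [d dp Hd] := fc z Sz (e / 2) ltac:(lra); exists d => // z' Sz' l.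
  have := Hd z' Sz' l; rewrite /= -to_sumB ?nsumE; try (apply: in_sumB); try exact: fs.
  lra.
- move=> z z01; have [q Hq] := fd z z01; exists (sum_val q); first exact: sum_valP.
  move=> e ep; have [d dp Hd] := Hq (e / 2) ltac:(lra); exists d => // h h0 hd Sz'.
  have Sz := in_strip z01.
  have hz := fs z Sz; have hz' := fs _ Sz'.
  have E : z + h - z = h by rewrite addrC addKr.
  have := Hd (z + h) Sz'; rewrite E /= => /(_ hd).
  have -> : h^-1 *: (f (z + h) - f z) - sum_val q = h^-1 *: (f (z + h) - f z - h *: sum_val q).
    by rewrite [RHS]scalerBr scalerA mulVf // scale1r.
  rewrite /nsum !sum_valD !sum_valN sum_valZ !to_sumK //.
  rewrite sum_normZ; last first.
    by apply: in_sumB; [exact: in_sumB|apply: in_sumZ; exact: sum_valP].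
  rewrite cabsV -ler_pdivrMr ?cabs_gt0 // mulrC => h1; apply: (le_lt_trans h1); lra.
- by exists g0; split=> //; split; [exact/contI_all|exists B].
- by exists g1; split=> //; split; [exact/contI_all|exists B].
Qed.

Lemma Fdata_lin (a : R[i]) f g0 g1 B f' g0' g1' B' : Fdata f g0 g1 B -> Fdata f' g0' g1' B' ->
  Fdata (fun z => a *: f z + f' z) (fun t => a *: g0 t + g0' t) (fun t => a *: g1 t + g1' t)
    (cabs a * B + B').
Proof.
move=> [fs [M fM] fc fd e0 c0 b0 e1 c1 b1] [fs' [M' fM'] fc' fd' e0' c0' b0' e1' c1' b1'].
have E z : S z -> to_sum (a *: f z + f' z) = a *: to_sum (f z) + to_sum (f' z).
  by move=> Sz; rewrite to_sum_lin //; [exact: fs|exact: fs'].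
split.
- by move=> z Sz; apply: in_sum_lin; [exact: fs|exact: fs'].
- exists (cabs a * M + M') => z Sz; have hz := fs z Sz; have hz' := fs' z Sz.
  apply: (le_trans (sum_normD (in_sumZ _ hz) hz')); rewrite sum_normZ //.
  by apply: lerD; [apply: ler_wpM2l; [exact: cabs_ge0|exact: fM]|exact: fM'].
- move=> z Sz e ep.
  have [d dp Hd] := ccat_add HS (ccat_scalec HS a (fc z Sz)) (fc' z Sz) ep.
  by exists d => // z' Sz' l; rewrite /= !E //; apply: Hd.
- move=> z z01; have Sz := in_strip z01.
  have [q Hq] := cdiff_add HS (cdiff_scalec HS a Sz (fd z z01)) (fd' z z01).
  exists q => e ep; have [d dp Hd] := Hq e ep.
  by exists d => // z' Sz' l; rewrite /= !E //; apply: Hd.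
- by move=> t; rewrite linearP e0 e0'.
- by move=> x y; apply: contI_lin H0 _ _ _ _ _ _ _.
- move=> t; apply: (le_trans (rnormD _ _)); rewrite rnormZ.
  by apply: lerD => //; apply: ler_wpM2l => //; exact: cabs_ge0.
- by move=> t; rewrite linearP e1 e1'.
- by move=> x y; apply: contI_lin H1 _ _ _ _ _ _ _.
- move=> t; apply: (le_trans (rnormD _ _)); rewrite rnormZ.
  by apply: lerD => //; apply: ler_wpM2l => //; exact: cabs_ge0.
Qed.

Lemma contI_shift (V : lmodType R[i]) (N : V -> R) (g : R -> V) s :
  (forall a b, contI N g a b) -> forall a b, contI N (fun t => g (t + s)) a b.
Proof.
move=> cg a b x /andP[ax xb] e ep.
have [|d dp Hd] := cg (a + s) (b + s) (x + s) _ e ep; first by apply/andP; split; lra.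
exists d => // y /andP[ay yb] l; apply: Hd; first by apply/andP; split; lra.
by have -> : y + s - (x + s) = y - x by ring.
Qed.

Lemma Fdata_shift s f g0 g1 B : Fdata f g0 g1 B ->
  Fdata (fun z => f (z + 0 +i* s)) (fun t => g0 (t + s)) (fun t => g1 (t + s)) B.
Proof.
move=> [fs [M fM] fc fd e0 c0 b0 e1 c1 b1].
have RE z : complex.Re (z + 0 +i* s) = complex.Re z by case: z => ? ? /=; rewrite addr0.
have SS z : S z -> S (z + 0 +i* s) by rewrite /vstrip /= RE.
have LE (c t : R) : c +i* t + 0 +i* s = c +i* (t + s).
  by apply/eqP; rewrite eq_complex /= addr0 !eqxx.
split=> //.
- by move=> z /SS /fs.
- by exists M => z /SS /fM.
- by move=> z Sz; apply: (ccat_comp (H := fun z => to_sum (f z)) SS); apply/fc/SS.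
- move=> z z01; apply: (cdiff_comp (H := fun z => to_sum (f z)) SS); apply: fd.
  by rewrite RE.
- by move=> t; rewrite e0 LE.
- exact: contI_shift.
- by move=> t; rewrite e1 LE.
- exact: contI_shift.
Qed.

(** This is how a vector of both end spaces enters every interpolation space. *)
Lemma Fdata_cst (x0 : sp0 X) (x1 : sp1 X) (w : amb X) : emb0 X x0 = w -> emb1 X x1 = w ->
  Fdata (fun=> w) (fun=> x0) (fun=> x1) (Num.max (rnorm x0) (rnorm x1)).
Proof.
move=> E0 E1; have hw : in_sum X w by rewrite -E0; exact: in_sum_emb0.
split=> //.
- by exists (sum_norm X w).
- by move=> z _; apply: (ccat_cst HS).
- by move=> z _; apply: (cdiff_cst HS).
- exact: contI_cst H0 _.
- by move=> _; rewrite le_max lexx.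
- exact: contI_cst H1 _.
- by move=> _; rewrite le_max lexx orbT.
Qed.

End CalF.

Lemma contI_map (R : realType) (V W : lmodType R[i]) (N : V -> R) (N' : W -> R) (HN : bnorm N)
    (L : V -> W) (c : R) (g : R -> V) (a b : R) :
  (forall p q, L (p - q) = L p - L q) ->
  (forall p, N' (L p) <= c * N p) -> contI N g a b -> contI N' (L \o g) a b.
Proof.
move=> LB Lc cg x xab e e0; have c1 : 0 < `|c| + 1 by have := normr_ge0 c; lra.
have [r r0 Hr] := cg x xab _ (divr_gt0 e0 c1); exists r => // y yab l.
have := Hr y yab l; rewrite ler_pdivlMr // => h; rewrite /= -LB.
apply: (le_trans (Lc _)); have := ler_norm c; have := bn_ge0 HN (g y - g x); nra.
Qed.

Lemma contI_scale_lip (R : realType) (V : lmodType R[i]) (N : V -> R) (HN : bnorm N)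
    (K : R -> R[i]) (L : R) (g : R -> V) :
  (forall t t', cabs (K t' - K t) <= `|t' - t| * L) ->
  (forall a b, contI N g a b) -> forall a b, contI N (fun t => K t *: g t) a b.
Proof.
move=> lipK cg a b; have [ab|ba] := leP a b; last by move=> x /andP[? ?]; lra.
apply: (contI_scale HN ab) => // x _ e e0.
have L1 : 0 < `|L| + 1 by have := normr_ge0 L; lra.
exists (e / (`|L| + 1)); first exact: divr_gt0.
move=> y _; rewrite ltr_pdivlMr // => h; apply: (le_trans (lipK _ _)).
by have := ler_norm L; have := normr_ge0 (y - x); nra.
Qed.

(** * Action of an operator on the Calderon space *)

Section Operator.
Context (R : realType) (X Y : couple R) (T : amb X -> amb Y) (HT : operator T).

Lemma op_lin (a : R[i]) u v : in_sum X u -> in_sum X v -> T (a *: u + v) = a *: T u + T v.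
Proof. exact: HT.1. Qed.

Lemma op0 : T 0 = 0.
Proof.
have := op_lin 1 (in_sum0 X) (in_sum0 X); rewrite !scale1r addr0 => /eqP.
by rewrite -[X in X == _]addr0 (inj_eq (addrI _)) => /eqP.
Qed.

Lemma opZ (a : R[i]) u : in_sum X u -> T (a *: u) = a *: T u.
Proof.
by move=> hu; rewrite -[a *: u]addr0 op_lin ?op0 ?addr0 //; exact: in_sum0.
Qed.

Lemma opB u v : in_sum X u -> in_sum X v -> T (u - v) = T u - T v.
Proof. by move=> hu hv; rewrite addrC -scaleN1r op_lin // scaleN1r addrC. Qed.

Lemma opD u v : in_sum X u -> in_sum X v -> T (u + v) = T u + T v.
Proof. by move=> hu hv; rewrite -[u]scale1r op_lin // !scale1r. Qed.

Lemma op_bound : exists (k : R) (T0 : sp0 X -> sp0 Y) (T1 : sp1 X -> sp1 Y),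
  [/\ 0 <= k, forall x, emb0 Y (T0 x) = T (emb0 X x), forall x, rnorm (T0 x) <= k * rnorm x,
      forall x, emb1 Y (T1 x) = T (emb1 X x) & forall x, rnorm (T1 x) <= k * rnorm x].
Proof.
have [_ [[T0 [E0 [c0 b0]]] [T1 [E1 [c1 b1]]]]] := HT.
exists (`|c0| + `|c1|), T0, T1; split=> // [x|x].
- apply: (le_trans (b0 x)); apply: ler_wpM2r; first exact: rnorm_ge0.
  by have := ler_norm c0; have := normr_ge0 c1; lra.
- apply: (le_trans (b1 x)); apply: ler_wpM2r; first exact: rnorm_ge0.
  by have := ler_norm c1; have := normr_ge0 c0; lra.
Qed.

Lemma in_sum_op w : in_sum X w -> in_sum Y (T w).
Proof.
have [k [T0 [T1 [_ E0 _ E1 _]]]] := op_bound.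
move=> [x0 [x1 <-]]; exists (T0 x0), (T1 x1).
by rewrite E0 E1 opD //; [exact: in_sum_emb0|exact: in_sum_emb1].
Qed.

(** On the boundary lines [T] acts through [T0] and [T1]; one constant [k], independent of [f],
    bounds both and also bounds [T] for the sum norms, which carries continuity and
    differentiability over to [T \o f]. *)
Lemma Fdata_op : exists2 k : R, 0 <= k & forall f g0 g1 B, Fdata f g0 g1 B ->
  exists g0' g1', Fdata (T \o f) g0' g1' (k * B).
Proof.
have [k [T0 [T1 [k0 E0 b0 E1 b1]]]] := op_bound.
have sumk w : in_sum X w -> sum_norm Y (T w) <= k * sum_norm X w.
  move=> hw; apply: (@ler_addeps _ _ _ k) => // e ep.
  have [|x0 [x1 [E l]]] := sum_norm_lt hw (r := sum_norm X w + e); first lra.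
  apply: (le_trans (sum_norm_le (x0 := T0 x0) (x1 := T1 x1) _)).
    by rewrite E0 E1 -opD ?E //; [exact: in_sum_emb0|exact: in_sum_emb1].
  have := b0 x0; have := b1 x1; nra.
(* [T0] is given as a bare function; its additivity comes from that of [T] through the injective
   embedding. *)
have T0B x y : T0 (x - y) = T0 x - T0 y.
  by apply: (@emb0_inj _ Y); rewrite E0 !linearB /= !E0 opB //; exact: in_sum_emb0.
have T1B x y : T1 (x - y) = T1 x - T1 y.
  by apply: (@emb1_inj _ Y); rewrite E1 !linearB /= !E1 opB //; exact: in_sum_emb1.
pose L (u : sum_space X) : sum_space Y := to_sum (T (sum_val u)).
have LB p q : L (p - q) = L p - L q.
  by rewrite /L sum_valD sum_valN opB ?to_sumB //; try apply: in_sum_op; exact: sum_valP.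
have LZ (a : R[i]) p : L (a *: p) = a *: L p.
  by rewrite /L sum_valZ opZ ?to_sumZ //; try apply: in_sum_op; exact: sum_valP.
have Lk p : nsum (L p) <= k * nsum p.
  by rewrite nsumE; [apply: sumk|apply: in_sum_op]; exact: sum_valP.
exists k => // f g0 g1 B [fs [M fM] fc fd e0 c0 d0 e1 c1 d1].
have fL z : vstrip 0 1 z -> L (to_sum (f z)) = to_sum (T (f z)).
  by move=> Sz; rewrite /L to_sumK //; apply: fs.
exists (T0 \o g0), (T1 \o g1); split.
- by move=> z Sz; apply/in_sum_op/fs.
- exists (k * M) => z Sz; apply: (le_trans (sumk _ (fs _ Sz))).
  by apply: ler_wpM2l => //; apply: fM.
- move=> z Sz e ep; have [d dp Hd] := ccat_map (@bnorm_nsum R X) LB Lk (fc z Sz) ep.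
  by exists d => // z' Sz' l; have := Hd z' Sz' l; rewrite /= !fL.
- move=> z z01; have [q Hq] := cdiff_map (@bnorm_nsum R X) LB LZ Lk (fd z z01).
  exists q => e ep; have [d dp Hd] := Hq e ep; have Sz := in_strip z01.
  by exists d => // z' Sz' l; have := Hd z' Sz' l; rewrite /= !fL.
- by move=> t; rewrite /= E0 e0.
- by move=> a b; apply: (contI_map (bnorm_rnorm _) T0B b0).
- by move=> t; apply: (le_trans (b0 _)); apply: ler_wpM2l.
- by move=> t; rewrite /= E1 e1.
- by move=> a b; apply: (contI_map (bnorm_rnorm _) T1B b1).
- by move=> t; apply: (le_trans (b1 _)); apply: ler_wpM2l.
Qed.

End Operator.

(** * Division by a linear factor *)

Section Division.
Context (R : realType) (X : couple R).
Local Notation S := (vstrip (0 : R) 1).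
Local Notation HS := (@bnorm_nsum R X).

Lemma contI_div (V : lmodType R[i]) (N : V -> R) (HN : bnorm N) (c th m : R) (g : R -> V) :
  0 < m -> m <= `|c - th| -> (forall a b, contI N g a b) ->
  forall a b, contI N (fun t => (c +i* t - th%:C)^-1 *: g t) a b.
Proof.
move=> m0 mc cg; apply: (contI_scale_lip HN (L := (m ^+ 2)^-1)) => // t t'.
rewrite -cabsI -(line_sub c t t' th%:C); apply: inv_lip => //;
  by apply: le_trans (Re_le_cabs _) => /=.
Qed.

Lemma le_div (V : lmodType R[i]) (N : V -> R) (HN : bnorm N) (c th m B : R) (g : R -> V) :
  0 < m -> m <= `|c - th| -> (forall t, N (g t) <= B) ->
  forall t, N ((c +i* t - th%:C)^-1 *: g t) <= B / m.
Proof.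
move=> m0 mc gB t; rewrite (bn_scale HN) mulrC.
apply: ler_pM; [exact: bn_ge0|exact: cabs_ge0|exact: gB|apply: cabs_inv_le => //].
exact: le_trans (Re_le_cabs _).
Qed.

(** Only the boundary values enter the bound, and there the divisor has modulus at least [m]. At
    [th] the quotient is completed by the derivative of [f], which makes it continuous; [removable]
    then makes it differentiable. *)
Lemma Fdata_div (th m : R) f (g0 : R -> sp0 X) (g1 : R -> sp1 X) B :
  0 < m -> m <= th -> m <= 1 - th -> Fdata f g0 g1 B -> f th%:C = 0 ->
  exists h g0' g1', Fdata h g0' g1' (B / m) /\
    forall z, S z -> f z = (z - th%:C) *: h z.
Proof.
move=> m0 mt mt1 [fs [M fM] fc fd e0 c0 d0 e1 c1 d1] fth.
pose p := th%:C : R[i].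
have p01 : 0 < complex.Re p < 1 by apply/andP; split => /=; lra.
have Sp : S p := in_strip p01.
have [q Hq] := fd p p01.
pose h z := if z == p then sum_val q else (z - p)^-1 *: f z.
pose hh z := if z == p then q else (z - p)^-1 *: to_sum (f z).
have hE z : S z -> to_sum (h z) = hh z.
  move=> Sz; rewrite /h /hh; case: eqP => [_|_]; last by rewrite to_sumZ //; apply: fs.
  by apply: sum_val_inj; rewrite to_sumK //; apply: sum_valP.
have hs z : S z -> in_sum X (h z).
  move=> Sz; rewrite /h; case: eqP => _; first exact: sum_valP.
  by apply: in_sumZ; apply: fs.
have near z : z != p -> forall z', cabs (z' - z) < cabs (z - p) ->
    (z' - p)^-1 *: to_sum (f z') = hh z'.
  move=> zp z' l; rewrite /hh ifF //; apply/negbTE/eqP => E.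
  by move: l; rewrite E cabsB ltxx.
have chp : ccat (@nsum R X) hh S p.
  move=> e ep; have [r r0 Hr] := Hq e ep; exists r => // z Sz l; rewrite /hh eqxx.
  have [_|zp] := eqVneq z p; first by rewrite subrr (bn0 HS) ltW.
  have z0 := cabs_sub_gt0 zp; have n0 : z - p != 0 by rewrite subr_eq0.
  have := Hr z Sz l; rewrite /= fth to_sum0 subr0 => h1.
  have -> : (z - p)^-1 *: to_sum (f z) - q = (z - p)^-1 *: (to_sum (f z) - (z - p) *: q).
    by rewrite [RHS]scalerBr scalerA mulVf // scale1r.
  by rewrite (bn_scale HS) cabsV mulrC ler_pdivrMr.
have chh : ccont (@nsum R X) hh S.
  move=> z Sz; have [->|zp] := eqVneq z p; first exact: chp.
  have z0 := cabs_sub_gt0 zp.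
  apply: (ccat_local z0 (near z zp)).
  have z20 : 0 < cabs (z - p) / 2 by lra.
  apply: (ccat_scale HS (K := fun z => (z - p)^-1) (H := fun z => to_sum (f z))
    (L := ((cabs (z - p) / 2) ^+ 2)^-1) z20); last exact: fc.
  move=> z' _ l.
  have t1 := cabs_triangle (z' - p) (z - z').
  have E1 : z' - p + (z - z') = z - p by ring.
  rewrite E1 [cabs (z - z')]cabsB in t1.
  have E2 : z' - z = z' - p - (z - p) by ring.
  by rewrite E2; apply: inv_lip => //; lra.
(* Within [r] of [p] continuity bounds the quotient, and beyond that the divisor has modulus at
   least [r]. *)
have [Mh hM] : exists M, forall z, S z -> nsum (hh z) <= M.
  have [r r0 Hr] := chp 1 ltr01.
  exists (nsum q + 1 + `|M| / r) => z Sz.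
  have q0 := bn_ge0 HS q; have M0 : 0 <= `|M| / r by rewrite divr_ge0 // ltW.
  have [l|l] := ltP (cabs (z - p)) r.
    have := Hr z Sz l; have := bn_triangle HS (hh z - hh p) (hh p).
    by rewrite subrK {2 4}/hh eqxx; lra.
  have zp : z != p by rewrite -subr_eq0 -cabs_gt0; lra.
  rewrite /hh (negbTE zp) (bn_scale HS).
  suff : cabs (z - p)^-1 * nsum (to_sum (f z)) <= `|M| / r by lra.
  rewrite mulrC; apply: ler_pM; [exact: (bn_ge0 HS)|exact: cabs_ge0| |exact: cabs_inv_le].
  rewrite nsumE; last exact: fs.
  by apply: (le_trans (fM z Sz)); apply: ler_norm.
have dhh z : 0 < complex.Re z < 1 -> z != p -> cdiff (@nsum R X) hh S z.
  move=> z01 zp; have z0 := cabs_sub_gt0 zp.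
  apply: (cdiff_local z0 (near z zp)).
  apply: (cdiff_scale HS (K := fun z => (z - p)^-1) (H := fun z => to_sum (f z))).
  - exact: in_strip.
  - exact: inv_cdiff.
  - exact: fd.
have m0' : m <= `|0 - th| by rewrite sub0r normrN ger0_norm; lra.
have m1' : m <= `|1 - th| by rewrite ger0_norm; lra.
have lineE (c t : R) : m <= `|c - th| -> h (c +i* t) = (c +i* t - p)^-1 *: f (c +i* t).
  move=> mc; rewrite /h ifF //; apply/negbTE/eqP => -[E _].
  by move: mc; rewrite E subrr normr0; lra.
exists h, (fun t => (0 +i* t - p)^-1 *: g0 t), (fun t => (1 +i* t - p)^-1 *: g1 t).
split; last first.
  move=> z Sz; rewrite /h; case: eqP => [->|/eqP zp]; first by rewrite fth subrr scale0r.
  by rewrite scalerA divff ?scale1r // subr_eq0.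
split=> //.
- by exists Mh => z Sz; rewrite -nsumE ?hE; [apply: hM| |apply: hs].
- move=> z Sz e ep; have [d dp Hd] := chh z Sz e ep.
  by exists d => // z' Sz' l; rewrite /= !hE //; apply: Hd.
- move=> z z01; have Sz := in_strip z01.
  have [qz Hqz] : cdiff (@nsum R X) hh S z.
    have [->|zp] := eqVneq z p; last exact: dhh.
    exact: (removable HS p01 chh hM).
  exists qz => e ep; have [d dp Hd] := Hqz e ep.
  by exists d => // z' Sz' l; rewrite /= !hE //; apply: Hd.
- by move=> t; rewrite linearZ e0 lineE.
- exact: (contI_div (bnorm_rnorm _) m0 m0').
- exact: (le_div (bnorm_rnorm _) m0 m0').
- by move=> t; rewrite linearZ e1 lineE.
- exact: (contI_div (bnorm_rnorm _) m0 m1').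
- exact: (le_div (bnorm_rnorm _) m0 m1').
Qed.

End Division.

Section CintLine.
Context (R : realType) (V : lmodType R[i]) (N : V -> R) (HN : bnorm N).
Variables (c d B : R) (g : R -> V) (a0 : R[i]) (x s : R).
Hypotheses (d0 : 0 < d) (d1 : d <= 1) (aw : away d (c - (x + s))).
Hypotheses (cg : forall a b, contI N g a b) (gB : forall t, N (g t) <= B).

Lemma cint_line_cont a b : contI N (fun t => a0 *: cint N c g (x +i* t + s%:C)) a b.
Proof.
pose H z := a0 *: cint N c g (z + s%:C).
apply: (@contI_v _ _ _ H x x); first by rewrite lexx.
move=> z /andP[/andP[z1 z2] _].
have zx : complex.Re z = x by apply/eqP; rewrite eq_le z1 z2.
apply: (ccat_scalec HN).
have : cdiff N (fun z => cint N c g (z + s%:C)) (box x x a b) z.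
  apply: (cdiff_comp (D' := setT)) => //; apply: (cint_cdiff HN _ d0 d1 _ cg gB).
  by have -> : complex.Re (z + s%:C) = x + s by rewrite -zx; case: (z).
by move=> dH; exact: (cdiff_cont HN dH).
Qed.

Lemma cint_line_le t : N (a0 *: cint N c g (x +i* t + s%:C)) <= cabs a0 * (8 / d ^+ 2 * B).
Proof.
rewrite (bn_scale HN); apply: ler_wpM2l; first exact: cabs_ge0.
exact: cint_le.
Qed.

End CintLine.

(** * Cauchy's formula in the Calderon space and the splitting *)

Section FCauchy.
Context (R : realType) (X : couple R).
Local Notation S := (vstrip (0 : R) 1).
Local Notation HS := (@bnorm_nsum R X).
Local Notation H0 := (bnorm_rnorm (sp0 X)).
Local Notation H1 := (bnorm_rnorm (sp1 X)).
Local Notation N0 := (@rnorm R (sp0 X)).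
Local Notation N1 := (@rnorm R (sp1 X)).

Lemma Fdata_mk (H : R[i] -> sum_space X) M (g0 : R -> sp0 X) (g1 : R -> sp1 X) B :
  (forall z, S z -> nsum (H z) <= M) ->
  (forall z, S z -> cdiff (@nsum R X) H S z) ->
  (forall t, sum_in0 (g0 t) = H (0 +i* t)) -> (forall a b, contI N0 g0 a b) ->
  (forall t, rnorm (g0 t) <= B) ->
  (forall t, sum_in1 (g1 t) = H (1 +i* t)) -> (forall a b, contI N1 g1 a b) ->
  (forall t, rnorm (g1 t) <= B) ->
  Fdata (fun z => sum_val (H z)) g0 g1 B.
Proof.
move=> HM dH e0 c0 b0 e1 c1 b1.
have E : (fun z => to_sum (sum_val (H z))) = H.
  by apply/funext => z; apply: sum_val_inj; rewrite to_sumK //; apply: sum_valP.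
split=> //.
- by move=> z _; apply: sum_valP.
- by exists M.
- by rewrite E => z Sz; exact: (cdiff_cont HS (dH z Sz)).
- by rewrite E => z z01; apply: dH; apply: in_strip.
- by move=> t; rewrite -e0 /sum_in0 to_sumK //; apply: in_sum_emb0.
- by move=> t; rewrite -e1 /sum_in1 to_sumK //; apply: in_sum_emb1.
Qed.

Variables (f : R[i] -> amb X) (g0 : R -> sp0 X) (g1 : R -> sp1 X) (B : R).
Hypothesis F : Fdata f g0 g1 B.

Lemma sum_in0_cint w d : 0 < d -> d <= 1 -> away d (0 - complex.Re w) ->
  sum_in0 (cint N0 0 g0 w) = cint (@nsum R X) 0 (fun t => to_sum (f (0 +i* t))) w.
Proof.
move=> d0 d1 aw.
rewrite (cint_map H0 HS (@sum_in0_lin R X) (@sum_in0_le R X) d0 d1 aw (F_cont0 F) (F_le0 F)).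
suff -> : @sum_in0 R X \o g0 = fun t => to_sum (f (0 +i* t)) by [].
by apply/funext => t; rewrite /= /sum_in0 (F_eq0 F).
Qed.

Lemma sum_in1_cint w d : 0 < d -> d <= 1 -> away d (1 - complex.Re w) ->
  sum_in1 (cint N1 1 g1 w) = cint (@nsum R X) 1 (fun t => to_sum (f (1 +i* t))) w.
Proof.
move=> d0 d1 aw.
rewrite (cint_map H1 HS (@sum_in1_lin R X) (@sum_in1_le R X) d0 d1 aw (F_cont1 F) (F_le1 F)).
suff -> : @sum_in1 R X \o g1 = fun t => to_sum (f (1 +i* t)) by [].
by apply/funext => t; rewrite /= /sum_in1 (F_eq1 F).
Qed.

Lemma nsum_bnd : exists M, forall z, S z -> nsum (to_sum (f z)) <= M.
Proof.
have [M fM] := F_bnd F; exists M => z Sz.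
by rewrite nsumE; [apply: fM|apply: (F_sum F)].
Qed.

(** The boundary integrals are formed in [X_0] and [X_1] and only then mapped to the sum, so the two
    terms of the formula lie in the end spaces. *)
Lemma Fdata_cauchy w d : 0 < d -> d <= 1 -> d <= complex.Re w -> d <= 1 - complex.Re w ->
  to_sum (f w) = (kappa R)^-1 *: (sum_in1 (cint N1 1 g1 w) - sum_in0 (cint N0 0 g0 w)).
Proof.
move=> d0 d1 dw dw1.
have w01 : 0 < complex.Re w < 1 by apply/andP; split; lra.
have a0 : away d (0 - complex.Re w) by split; [rewrite ler0_norm|rewrite ger0_norm]; lra.
have a1 : away d (1 - complex.Re w) by split; rewrite ger0_norm; lra.
have [M fM] := nsum_bnd.
rewrite (sum_in0_cint d0 d1 a0) (sum_in1_cint d0 d1 a1).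
have df z : 0 < complex.Re z < 1 -> complex.Re z != 0 ->
  cdiff (@nsum R X) (fun z => to_sum (f z)) S z by move=> z01 _; exact: (F_diff F).
rewrite (strip_in HS (F_cont F) fM df w01 (F_diff F w01)).
by rewrite scalerA mulVf ?scale1r // kappa_neq0.
Qed.

Lemma Fdata_out w d : 0 < d -> d <= 1 -> (forall s, 0 <= s <= 1 -> away d (s - complex.Re w)) ->
  sum_in1 (cint N1 1 g1 w) = sum_in0 (cint N0 0 g0 w).
Proof.
move=> d0 d1 aw; have [M fM] := nsum_bnd.
have i0 : (0 <= 0 :> R) && (0 <= 1 :> R) by apply/andP; split; lra.
have i1 : (0 <= 1 :> R) && (1 <= 1 :> R) by apply/andP; split; lra.
rewrite (sum_in0_cint d0 d1 (aw 0 i0)) (sum_in1_cint d0 d1 (aw 1 i1)).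
have df z : 0 < complex.Re z < 1 -> complex.Re z != 0 ->
  cdiff (@nsum R X) (fun z => to_sum (f z)) S z by move=> z01 _; exact: (F_diff F).
exact: (strip_out HS (F_cont F) fM df d0 d1 aw).
Qed.

Lemma Fdata_le w d : 0 < d -> d <= 1 -> d <= complex.Re w -> d <= 1 - complex.Re w ->
  sum_norm X (f w) <= (cabs (kappa R))^-1 * (16 / d ^+ 2) * B.
Proof.
move=> d0 d1 dw dw1.
have a0 : away d (0 - complex.Re w) by split; [rewrite ler0_norm|rewrite ger0_norm]; lra.
have a1 : away d (1 - complex.Re w) by split; rewrite ger0_norm; lra.
have Sw : S w by apply/andP; split; lra.
rewrite -nsumE; last exact: (F_sum F).
rewrite (Fdata_cauchy d0 d1 dw dw1) (bn_scale HS) cabsV -mulrA; apply: ler_wpM2l.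
  by rewrite invr_ge0 cabs_ge0.
have := bnB HS (sum_in1 (cint N1 1 g1 w)) (sum_in0 (cint N0 0 g0 w)).
have := sum_in1_le (cint N1 1 g1 w); have := sum_in0_le (cint N0 0 g0 w).
have := cint_le H0 d0 d1 a0 (F_cont0 F) (F_le0 F).
have := cint_le H1 d0 d1 a1 (F_cont1 F) (F_le1 F).
have -> : 16 / d ^+ 2 * B = 2 * (8 / d ^+ 2 * B) by field; rewrite gt_eqF.
rewrite !mul1r; lra.
Qed.

(** After translation by [- s] the singular line is [Re z = 1 + s], so the function is
    differentiable on the closed strip. On the right side it has values in [X_1] by construction. On
    the left side the integral is evaluated at real part [- s], outside the strip, where [Fdata_out]
    replaces it by the integral in [X_0]. The bound [1 - s] in [d] is the distance to the pole
    [2]. *)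
Lemma Fdata_right s : 0 < s -> s < 1 -> exists g0' g1' B',
  Fdata (fun z => emb1 X ((kappa R)^-1 *: cint N1 1 g1 (z + (- s)%:C))) g0' g1' B'.
Proof.
move=> s0 s1; pose d := Num.min s (1 - s).
have d0 : 0 < d by rewrite lt_min s0 subr_gt0.
have ds : d <= s by rewrite ge_min lexx.
have ds1 : d <= 1 - s by rewrite ge_min lexx orbT.
have d1 : d <= 1 by lra.
have awr x : s <= x <= 1 + s -> away d x.
  by move=> /andP[? ?]; split; rewrite ger0_norm; lra.
have Rs (z : R[i]) r : complex.Re (z + r%:C) = complex.Re z + r by case: z.
pose H z := sum_in1 ((kappa R)^-1 *: cint N1 1 g1 (z + (- s)%:C)).
have aS z : S z -> away d (1 - complex.Re (z + (- s)%:C)).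
  by move=> /andP[? ?]; apply: awr; rewrite Rs; apply/andP; split; lra.
exists (fun t => (kappa R)^-1 *: cint N0 0 g0 (0 +i* t + (- s)%:C)).
exists (fun t => (kappa R)^-1 *: cint N1 1 g1 (1 +i* t + (- s)%:C)).
exists (cabs (kappa R)^-1 * (8 / d ^+ 2 * B)).
have a1 : away d (1 - (1 - s)) by apply: awr; apply/andP; split; lra.
have a0 : away d (0 - (0 - s)) by apply: awr; apply/andP; split; lra.
have := @Fdata_mk H (1 * (cabs (kappa R)^-1 * (8 / d ^+ 2 * B)))
  (fun t => (kappa R)^-1 *: cint N0 0 g0 (0 +i* t + (- s)%:C))
  (fun t => (kappa R)^-1 *: cint N1 1 g1 (1 +i* t + (- s)%:C))
  (cabs (kappa R)^-1 * (8 / d ^+ 2 * B)).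
have -> : (fun z => sum_val (H z)) =
    (fun z => emb1 X ((kappa R)^-1 *: cint N1 1 g1 (z + (- s)%:C))).
  by apply/funext => z; rewrite /H /sum_in1 to_sumK //; exact: in_sum_emb1.
apply.
- move=> z Sz; apply: (le_trans (sum_in1_le _)); rewrite !mul1r rnormZ.
  apply: ler_wpM2l; first exact: cabs_ge0.
  exact: (cint_le H1 d0 d1 (aS z Sz) (F_cont1 F) (F_le1 F)).
- move=> z Sz.
  apply: (cdiff_map H1 (@sum_in1B R X) (@sum_in1Z R X) (@sum_in1_le R X)
    (H := fun z => (kappa R)^-1 *: cint N1 1 g1 (z + (- s)%:C))).
  apply: (cdiff_scalec H1) => //; apply: (cdiff_comp (D' := setT)) => //.
  exact: (cint_cdiff H1 _ d0 d1 (aS z Sz) (F_cont1 F) (F_le1 F)).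
- move=> t; rewrite /H sum_in0Z sum_in1Z; congr (_ *: _); symmetry.
  apply: (Fdata_out d0 d1) => r /andP[? ?]; apply: awr; rewrite Rs /=; apply/andP; split; lra.
- exact: (cint_line_cont H0 _ d0 d1 a0 (F_cont0 F) (F_le0 F)).
- exact: (cint_line_le H0 _ d0 d1 a0 (F_cont0 F) (F_le0 F)).
- by [].
- exact: (cint_line_cont H1 _ d0 d1 a1 (F_cont1 F) (F_le1 F)).
- exact: (cint_line_le H1 _ d0 d1 a1 (F_cont1 F) (F_le1 F)).
Qed.

(** The mirror image of [Fdata_right]: the singular line moves to [Re z = - s], and [Fdata_out] now
    supplies the values in [X_1] on the right side. *)
Lemma Fdata_left s : 0 < s -> s < 1 -> exists g0' g1' B',
  Fdata (fun z => emb0 X (- (kappa R)^-1 *: cint N0 0 g0 (z + s%:C))) g0' g1' B'.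
Proof.
move=> s0 s1; pose d := Num.min s (1 - s).
have d0 : 0 < d by rewrite lt_min s0 subr_gt0.
have ds : d <= s by rewrite ge_min lexx.
have ds1 : d <= 1 - s by rewrite ge_min lexx orbT.
have d1 : d <= 1 by lra.
have awr x : x <= - s -> away d x.
  by move=> ?; split; [rewrite ler0_norm|rewrite ger0_norm]; lra.
have Rs (z : R[i]) r : complex.Re (z + r%:C) = complex.Re z + r by case: z.
pose H z := sum_in0 (- (kappa R)^-1 *: cint N0 0 g0 (z + s%:C)).
have aS z : S z -> away d (0 - complex.Re (z + s%:C)).
  by move=> /andP[? ?]; apply: awr; rewrite Rs; lra.
exists (fun t => - (kappa R)^-1 *: cint N0 0 g0 (0 +i* t + s%:C)).
exists (fun t => - (kappa R)^-1 *: cint N1 1 g1 (1 +i* t + s%:C)).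
exists (cabs (- (kappa R)^-1) * (8 / d ^+ 2 * B)).
have a1 : away d (1 - (1 + s)) by apply: awr; lra.
have a0 : away d (0 - (0 + s)) by apply: awr; lra.
have := @Fdata_mk H (1 * (cabs (- (kappa R)^-1) * (8 / d ^+ 2 * B)))
  (fun t => - (kappa R)^-1 *: cint N0 0 g0 (0 +i* t + s%:C))
  (fun t => - (kappa R)^-1 *: cint N1 1 g1 (1 +i* t + s%:C))
  (cabs (- (kappa R)^-1) * (8 / d ^+ 2 * B)).
have -> : (fun z => sum_val (H z)) =
    (fun z => emb0 X (- (kappa R)^-1 *: cint N0 0 g0 (z + s%:C))).
  by apply/funext => z; rewrite /H /sum_in0 to_sumK //; exact: in_sum_emb0.
apply.
- move=> z Sz; apply: (le_trans (sum_in0_le _)); rewrite !mul1r rnormZ.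
  apply: ler_wpM2l; first exact: cabs_ge0.
  exact: (cint_le H0 d0 d1 (aS z Sz) (F_cont0 F) (F_le0 F)).
- move=> z Sz.
  apply: (cdiff_map H0 (@sum_in0B R X) (@sum_in0Z R X) (@sum_in0_le R X)
    (H := fun z => - (kappa R)^-1 *: cint N0 0 g0 (z + s%:C))).
  apply: (cdiff_scalec H0) => //; apply: (cdiff_comp (D' := setT)) => //.
  exact: (cint_cdiff H0 _ d0 d1 (aS z Sz) (F_cont0 F) (F_le0 F)).
- by [].
- exact: (cint_line_cont H0 _ d0 d1 a0 (F_cont0 F) (F_le0 F)).
- exact: (cint_line_le H0 _ d0 d1 a0 (F_cont0 F) (F_le0 F)).
- move=> t; rewrite /H sum_in0Z sum_in1Z; congr (_ *: _).
  by apply: (Fdata_out d0 d1) => r /andP[? ?]; apply: awr; rewrite Rs /=; lra.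
- exact: (cint_line_cont H1 _ d0 d1 a1 (F_cont1 F) (F_le1 F)).
- exact: (cint_line_le H1 _ d0 d1 a1 (F_cont1 F) (F_le1 F)).
Qed.

End FCauchy.

(** The two terms of Cauchy's formula at [th]. Each is also the value at [s] of a translated Cauchy
    integral, the translation carrying [s] back to [th]; the same vector thus serves for all [s] on
    one side. *)
Lemma cinterp_decomposition (R : realType) (X : couple R) (th : R) (x : amb X) :
  0 < th < 1 -> cinterp X th x -> exists (a : sp0 X) (b : sp1 X),
  [/\ x = emb0 X a + emb1 X b, forall s, 0 < s < th -> cinterp X s (emb0 X a) &
      forall s, th < s < 1 -> cinterp X s (emb1 X b)].
Proof.
move=> /andP[t0 t1] [f /calF_Fdata[g0 [g1 [B F]]] <-].
exists (- (kappa R)^-1 *: cint (@rnorm R (sp0 X)) 0 g0 th%:C).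
exists ((kappa R)^-1 *: cint (@rnorm R (sp1 X)) 1 g1 th%:C); split.
- pose d := Num.min th (1 - th).
  have d0 : 0 < d by rewrite lt_min t0 subr_gt0.
  have dt : d <= th by rewrite ge_min lexx.
  have dt1 : d <= 1 - th by rewrite ge_min lexx orbT.
  have d1 : d <= 1 by lra.
  have St : vstrip 0 1 th%:C by apply/andP; split => /=; lra.
  have := Fdata_cauchy F d0 d1 (w := th%:C) dt dt1 => /(congr1 (@sum_val R X)).
  rewrite to_sumK; last exact: (F_sum F).
  move=> ->; rewrite sum_valZ sum_valD sum_valN /sum_in0 /sum_in1.
  rewrite !to_sumK; [|exact: in_sum_emb0|exact: in_sum_emb1].
  by rewrite !linearZ /= scaleNr scalerBr addrC.
- move=> s /andP[s0 st]; have [||g0' [g1' [B' G]]] := Fdata_left F (s := th - s); [lra|lra|].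
  exists (fun z => emb0 X (- (kappa R)^-1 *: cint (@rnorm R (sp0 X)) 0 g0 (z + (th - s)%:C))).
    exact: Fdata_calF G.
  by congr (emb0 X (_ *: cint _ _ _ _)); rewrite -rmorphD /= addrC subrK.
- move=> s /andP[s0 st]; have [||g0' [g1' [B' G]]] := Fdata_right F (s := s - th); [lra|lra|].
  exists (fun z => emb1 X ((kappa R)^-1 *: cint (@rnorm R (sp1 X)) 1 g1 (z + (- (s - th))%:C))).
    exact: Fdata_calF G.
  by congr (emb1 X (_ *: cint _ _ _ _)); rewrite -rmorphD /= opprB addrC subrK.
Qed.

(** * Stability of the inverse *)

Section FB.
Context (R : realType).
Local Notation S := (vstrip (0 : R) 1).

(** The ball of radius [B] of the Calderon space; estimates are phrased with it in place of the
    quotient norm. *)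
Definition FB (X : couple R) (f : R[i] -> amb X) (B : R) := exists g0 g1, Fdata f g0 g1 B.

Section OneCouple.
Context (X : couple R).
Implicit Types (f : R[i] -> amb X) (B : R) (th s : R) (w : amb X).

Lemma FB_ge0 f B : FB f B -> 0 <= B.
Proof. by move=> [g0 [g1 F]]; apply: le_trans (F_le0 F 0); apply: rnorm_ge0. Qed.

Lemma FB_mono f B B' : B <= B' -> FB f B -> FB f B'.
Proof.
move=> BB' [g0 [g1 [fs fM fc fd e0 c0 d0 e1 c1 d1]]]; exists g0, g1; split=> // t.
- exact: le_trans (d0 t) BB'.
- exact: le_trans (d1 t) BB'.
Qed.

Lemma FB_lin (a : R[i]) f B f' B' : FB f B -> FB f' B' ->
  FB (fun z => a *: f z + f' z) (cabs a * B + B').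
Proof.
move=> [g0 [g1 F]] [g0' [g1' F']]; do 2!eexists; exact: (Fdata_lin a F F').
Qed.

Lemma FB_scale (a : R[i]) f B : FB f B -> FB (fun z => a *: f z) (cabs a * B).
Proof.
move=> F; have z0 : FB (fun=> 0 : amb X) 0.
  have := @Fdata_cst R X 0 0 0; rewrite !linear0 => /(_ erefl erefl) h.
  do 2!eexists; move: h; rewrite /rnorm !normr0 maxxx; exact.
have := FB_lin a F z0; rewrite addr0.
have -> // : (fun z => a *: f z + 0) = (fun z => a *: f z).
by apply/funext => z; rewrite addr0.
Qed.

Lemma FB_sub f B f' B' : FB f B -> FB f' B' -> FB (fun z => f z - f' z) (B + B').
Proof.
move=> F F'; have := FB_lin (-1) F' F; rewrite cabsN cabs1 mul1r addrC.
have -> // : (fun z => -1 *: f' z + f z) = (fun z => f z - f' z).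
by apply/funext => z; rewrite scaleN1r addrC.
Qed.

Lemma FB_shift s f B : FB f B -> FB (fun z => f (z + 0 +i* s)) B.
Proof. by move=> [g0 [g1 F]]; do 2!eexists; exact: (Fdata_shift s F). Qed.

Lemma FB_div th m f B : 0 < m -> m <= th -> m <= 1 - th -> FB f B -> f th%:C = 0 ->
  exists h, FB h (B / m) /\ forall z, S z -> f z = (z - th%:C) *: h z.
Proof.
move=> m0 mt mt1 [g0 [g1 F]] fth.
have [h [g0' [g1' [H E]]]] := Fdata_div m0 mt mt1 F fth.
by exists h; split=> //; exists g0', g1'.
Qed.

Lemma FB_in_sum f B z : FB f B -> S z -> in_sum X (f z).
Proof. by move=> [g0 [g1 F]] Sz; apply: (F_sum F). Qed.

Lemma FB_sum_norm (d : R) : 0 < d -> d <= 1 -> exists2 C : R, 0 < C & forall f B (w : R[i]), FB f B ->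
  d <= complex.Re w -> d <= 1 - complex.Re w -> sum_norm X (f w) <= C * B.
Proof.
move=> d0 d1; exists ((cabs (kappa R))^-1 * (16 / d ^+ 2)).
  by rewrite mulr_gt0 ?invr_gt0 ?cabs_gt0 ?kappa_neq0 // divr_gt0 // exprn_gt0.
by move=> f B w [g0 [g1 F]] dw dw1; apply: (Fdata_le F d0 d1 dw dw1).
Qed.

Lemma calF_FB f : calF X f -> exists B, FB f B.
Proof. by move=> /calF_Fdata[g0 [g1 [B F]]]; exists B, g0, g1. Qed.

Lemma FB_calF f B : FB f B -> calF X f.
Proof. by move=> [g0 [g1 F]]; exact: Fdata_calF F. Qed.

Lemma norm0_emb (x : sp0 X) : norm0 X (emb0 X x) = rnorm x.
Proof.
rewrite /norm0 (_ : [set _ | _ in _] = [set rnorm x]) ?inf1 //.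
apply/seteqP; split=> [_ [y /= E <-]|_ ->]; last by exists x.
by rewrite (emb0_inj E).
Qed.

Lemma norm1_emb (x : sp1 X) : norm1 X (emb1 X x) = rnorm x.
Proof.
rewrite /norm1 (_ : [set _ | _ in _] = [set rnorm x]) ?inf1 //.
apply/seteqP; split=> [_ [y /= E <-]|_ ->]; last by exists x.
by rewrite (emb1_inj E).
Qed.

Lemma calF_norm_le f B : FB f B -> calF_norm X f <= B.
Proof.
move=> [g0 [g1 F]]; rewrite /calF_norm ge_max; apply/andP; split.
  apply: ge_sup; first by exists (norm0 X (f (0 +i* 0))); exists 0.
  by move=> _ [t _ <-]; rewrite -(F_eq0 F) norm0_emb; exact: (F_le0 F).
apply: ge_sup; first by exists (norm1 X (f (1 +i* 0))); exists 0.
by move=> _ [t _ <-]; rewrite -(F_eq1 F) norm1_emb; exact: (F_le1 F).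
Qed.

Lemma FB_calF_norm f : calF X f -> FB f (calF_norm X f).
Proof.
move=> /calF_Fdata[g0 [g1 [B F]]]; exists g0, g1.
have u0 : has_ubound [set norm0 X (f (0 +i* t)) | t in [set: R]].
  by exists B => _ [t _ <-]; rewrite -(F_eq0 F) norm0_emb; exact: (F_le0 F).
have u1 : has_ubound [set norm1 X (f (1 +i* t)) | t in [set: R]].
  by exists B => _ [t _ <-]; rewrite -(F_eq1 F) norm1_emb; exact: (F_le1 F).
case: F => fs fM fc fd e0 c0 d0 e1 c1 d1; split=> // t; rewrite /calF_norm le_max; apply/orP.
  by left; apply: ub_le_sup => //; exists t => //; rewrite -e0 norm0_emb.
by right; apply: ub_le_sup => //; exists t => //; rewrite -e1 norm1_emb.
Qed.

Lemma cinterp_norm_le th w f B : FB f B -> f th%:C = w -> cinterp_norm X th w <= B.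
Proof.
move=> F E; apply: (@le_trans _ _ (calF_norm X f)); last exact: calF_norm_le.
apply: ge_inf; last by exists f => //; split=> //; exact: FB_calF F.
exists 0 => _ [h [/FB_calF_norm H _] <-]; exact: FB_ge0 H.
Qed.

Lemma cinterp_norm_lt th w B : cinterp X th w -> cinterp_norm X th w < B ->
  exists2 f, FB f B & f th%:C = w.
Proof.
move=> [f Ff E] l; rewrite -subr_gt0 in l.
have [|_ [h [Fh Eh] <-]] := inf_adherent l
    (E := [set calF_norm X f | f in [set f | calF X f /\ f th%:C = w]]).
  split; first by exists (calF_norm X f); exists f.
  by exists 0 => _ [h [/FB_calF_norm H _] <-]; exact: FB_ge0 H.
rewrite -/(cinterp_norm X th w) => lt; exists h => //.
by apply: FB_mono (FB_calF_norm Fh); lra.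
Qed.

Lemma cinterp_sub th u v : cinterp X th u -> cinterp X th v -> cinterp X th (u - v).
Proof.
move=> [f /calF_FB[B F] <-] [g /calF_FB[B' G] <-].
exists (fun z => f z - g z) => //; exact: FB_calF (FB_sub F G).
Qed.

Lemma cinterp_in_sum th u : 0 <= th <= 1 -> cinterp X th u -> in_sum X u.
Proof. by move=> t01 [f /calF_FB[B F] <-]; apply: (FB_in_sum F). Qed.

End OneCouple.

Section TwoCouples.
Context (X Y : couple R) (T : amb X -> amb Y) (HT : operator T).

(** The inequality [|x| <= c |T x|] in terms of representatives: if [T (f th)] is represented in the
    ball of radius [B], then [f th] is represented in the ball of radius [c * B]. Requiring [0 < B]
    makes up for infima that are not attained. *)
Definition lower_bound_at (th c : R) := forall f h B, calF X f -> FB h B -> 0 < B ->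
  h th%:C = T (f th%:C) -> exists2 f', FB f' (c * B) & f' th%:C = f th%:C.

Lemma FB_op : exists2 k : R, 0 <= k & forall f B, FB f B -> FB (T \o f) (k * B).
Proof.
have [k k0 Hk] := Fdata_op HT; exists k => // f B [g0 [g1 F]].
exact: Hk F.
Qed.

(** The constant is [|c0| + 1] and not [c0] so that the quotient norm is strictly below [c * B], as
    choosing a representative requires. *)
Lemma invertible_lower_bound th : invertible_at T th ->
  exists2 c, 0 <= c & lower_bound_at th c.
Proof.
move=> [_ [_ [_ [_ [c0 Hc]]]]]; exists (`|c0| + 1); first by have := normr_ge0 c0; lra.
move=> f h B Ff Fh B0 E.
have fx : cinterp X th (f th%:C) by exists f.
apply: (cinterp_norm_lt fx); apply: (le_lt_trans (Hc _ fx)).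
rewrite -E; have := cinterp_norm_le Fh (erefl (h th%:C)).
have : 0 <= cinterp_norm Y th (h th%:C).
  by apply: inf_ge0 => _ [g [/FB_calF_norm G _] <-]; exact: FB_ge0 G.
have := ler_norm c0; have := normr_ge0 c0; nra.
Qed.

Lemma invertible_lift th : invertible_at T th -> exists2 c, 0 <= c &
  forall h B, FB h B -> 0 < B -> exists2 f, FB f (c * B) & T (f th%:C) = h th%:C.
Proof.
move=> inv; have [c c0 Hc] := invertible_lower_bound inv; exists c => // h B Fh B0.
have [_ [_ [_ [surj _]]]] := inv.
have [|x [f Ff <-] E] := surj (h th%:C); first by exists h => //; exact: FB_calF Fh.
have [f' Ff' E'] := Hc f h B Ff Fh B0 (esym E).
by exists f' => //; rewrite E'.
Qed.

Lemma real_strip s : 0 < s < 1 -> S s%:C.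
Proof. by case/andP => /ltW ? /ltW ?; apply/andP. Qed.

(** The norms at [s] and [th] cannot be compared directly, but a representative can be carried from
    one point to the other by division, at a cost proportional to [|s - th|]. The lower bound at
    [th] thus improves any representative at [s], and iterating removes the dependence on the
    initial one. *)
Lemma lower_bound_stable th c : 0 < th < 1 -> 0 <= c -> lower_bound_at th c ->
  exists rho c', [/\ 0 < rho, 0 <= c' &
    forall s, `|s - th| < rho -> 0 < s < 1 /\ lower_bound_at s c'].
Proof.
move=> t01 c0 LB; have /andP[t0 t1] := t01; have [k k0 Hk] := FB_op.
(* Half the distance of [th] to the boundary, so that [s] too keeps distance [m]. *)
pose m := Num.min th (1 - th) / 2.
have mt : m <= th / 2 by rewrite ler_wpM2r // ge_min lexx.
have mt1 : m <= (1 - th) / 2 by rewrite ler_wpM2r // ge_min lexx orbT.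
have m0 : 0 < m by rewrite divr_gt0 // lt_min t0 subr_gt0.
(* Chosen so that [eta * (2 * c * k + 1) = 1 / 2]: this is the coefficient of [M] after one
   improvement step. *)
pose eta := (2 * (2 * c * k + 1))^-1.
have ck : 0 <= c * k by exact: mulr_ge0.
have eta0 : 0 < eta by rewrite invr_gt0; lra.
have etaE : eta * (2 * (2 * c * k + 1)) = 1 by rewrite mulVf // gt_eqF //; lra.
have eta1 : eta <= 1 / 2 by nra.
exists (eta * m), (8 * c + 1); split; [exact: mulr_gt0|lra|] => s sth.
have sm : `|s - th| < m by apply: (lt_le_trans sth); nra.
have /andP[sm1 sm2] : - m < s - th < m by rewrite -ltr_norml.
have ms : m <= s by lra.
have ms1 : m <= 1 - s by lra.
have s01 : 0 < s < 1 by apply/andP; split; lra.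
split=> // f h B Ff Fh B0 hs.
(* [T g - h] vanishes at [s], so [T (g th)] is represented by [h] plus a multiple [th - s] of its
   quotient. The lower bound at [th] gives [g2] agreeing with [g] at [th]; then [g - g2] is divided
   by [z - th], and the result is read at [s]. *)
have step g M : FB g M -> g s%:C = f s%:C ->
    exists2 g', FB g' (4 * c * B + M / 2) & g' s%:C = f s%:C.
  move=> Fg gs; have M0 := FB_ge0 Fg.
  have F1 := FB_sub (Hk _ _ Fg) Fh.
  have [|l1 [Fl1 El1]] := FB_div m0 ms ms1 F1; first by rewrite /= gs hs subrr.
  have F2 := FB_lin (th%:C - s%:C) Fl1 Fh.
  have E2 : (th%:C - s%:C) *: l1 th%:C + h th%:C = T (g th%:C).
    by rewrite -El1 ?subrK //; exact: real_strip.
  have cE : cabs (th%:C - s%:C) = `|s - th| by rewrite -rmorphB /= cabsR distrC.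
  have b2 : 0 < cabs (th%:C - s%:C) * ((k * M + B) / m) + B.
    suff : 0 <= cabs (th%:C - s%:C) * ((k * M + B) / m) by lra.
    rewrite mulr_ge0 ?cabs_ge0 // divr_ge0 ?(ltW m0) // addr_ge0 ?(ltW B0) //.
    exact: mulr_ge0.
  have [g2 Fg2 Eg2] := LB g _ _ (FB_calF Fg) F2 b2 E2.
  have F3 := FB_sub Fg Fg2.
  have mth : m <= th by lra.
  have mth1 : m <= 1 - th by lra.
  have [|l2 [Fl2 El2]] := FB_div m0 mth mth1 F3; first by rewrite Eg2 subrr.
  have F4 := FB_lin (s%:C - th%:C) Fl2 Fg2.
  exists (fun z => (s%:C - th%:C) *: l2 z + g2 z); last first.
    by rewrite -El2 ?subrK //; exact: real_strip.
  apply: FB_mono F4; rewrite [cabs (s%:C - _)]cabsB cE.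
  set x := `|s - th| in sth *.
  have x0 : 0 <= x by exact: normr_ge0.
  have q1 a : 0 <= a -> x * (a / m) <= eta * a.
    by move=> a0; rewrite mulrA mulrAC ler_wpM2r // ?ler_pdivrMr // ltW.
  have kMB : 0 <= k * M + B by apply: addr_ge0; [exact: mulr_ge0|exact: ltW].
  set B1 := c * _.
  have B1le : B1 <= c * (eta * (k * M + B) + B).
    by apply: ler_wpM2l => //; rewrite lerD2r q1.
  have B10 : 0 <= B1.
    by apply: mulr_ge0 => //; have := mulr_ge0 x0 (divr_ge0 kMB (ltW m0)); lra.
  have := q1 (M + B1) (addr_ge0 M0 B10).
  have e1 : 0 <= eta * M by rewrite mulr_ge0 // ltW.
  have e2 : 0 <= c * B by rewrite mulr_ge0 // ltW.
  have e3 : eta * B1 <= 1 / 2 * B1 by rewrite ler_wpM2r.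
  have e4 : eta * (c * B) <= 1 / 2 * (c * B) by rewrite ler_wpM2r.
  have e5 : c * (eta * (k * M + B) + B) = c * k * (eta * M) + eta * (c * B) + c * B by ring.
  have e6 : (c * k * (eta * M)) * 4 + 2 * (eta * M) = M.
    by have e := congr1 (fun x => x * M) etaE; rewrite mul1r in e; rewrite -[RHS]e; ring.
  rewrite e5 in B1le; rewrite mulrDr; lra.
have [M FM] := calF_FB Ff; have M0 := FB_ge0 FM.
(* [8 * c * B] is the fixed point of [M |-> 4 * c * B + M / 2]. The iteration stops once
   [M / 2 ^+ n <= B], whence the constant [8 * c + 1]. *)
have iterate n : exists2 g, FB g (8 * c * B + M / 2 ^+ n) & g s%:C = f s%:C.
  elim: n => [|n [g Fg gs]].
    exists f => //; apply: FB_mono FM; rewrite expr0 divr1.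
    suff : 0 <= 8 * c * B by lra.
    by apply: mulr_ge0; lra.
  have [g' Fg' gs'] := step g _ Fg gs; exists g' => //.
  apply: FB_mono Fg'; rewrite exprS invfM; lra.
have M1 : 0 < M + 1 by lra.
have [n /(_ n (leqnn n))] := pow2_lt (divr_gt0 B0 M1).
rewrite ler_pdivlMr // => hn; have [g Fg gs] := iterate n; exists g => //.
apply: FB_mono Fg; have p0 : 0 < (2 : R) ^- n by rewrite invr_gt0 exprn_gt0.
by rewrite mulrDl mul1r; nra.
Qed.

End TwoCouples.
End FB.

(** * First-order expansion and constancy of the inverse *)

Section Agreement.
Context (R : realType) (X Y : couple R) (T : amb X -> amb Y) (HT : operator T).
Local Notation S := (vstrip (0 : R) 1).
Local Notation HS := (@bnorm_nsum R X).

(** The first quotient [g1] need not vanish at [th]; [f1] is lifted so that [T (f1 th) = g1 th], and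
    [g1 - T \o f1] can be divided again. *)
Lemma taylor_expansion th w f0 : 0 < th < 1 -> invertible_at T th ->
  (exists B, FB (fun=> w : amb Y) B) -> calF X f0 -> T (f0 th%:C) = w ->
  exists f1 g2 B, [/\ calF X f1, FB g2 B, 0 < B & forall z, S z ->
    w = T (f0 z) + (z - th%:C) *: T (f1 z) + (z - th%:C) ^+ 2 *: g2 z].
Proof.
move=> /andP[t0 t1] inv [B0 Fw] /calF_FB[B1 F0] E0.
have [k k0 Hk] := FB_op HT.
pose m := Num.min th (1 - th).
have mt : m <= th by rewrite ge_min lexx.
have mt1 : m <= 1 - th by rewrite ge_min lexx orbT.
have m0 : 0 < m by rewrite lt_min t0 subr_gt0.
have [|g1 [G1 E1]] := FB_div m0 mt mt1 (FB_sub Fw (Hk _ _ F0)); first by rewrite /= E0 subrr.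
have [c c0 Hc] := invertible_lift inv.
(* Bounds are raised by [1] because lifting asks for a positive radius. *)
have p1 b (g : R[i] -> amb Y) : FB g b -> FB g (b + 1) by apply: FB_mono; lra.
have b1 : 0 < (B0 + k * B1) / m + 1.
  by have := FB_ge0 G1; lra.
have [f1 F1 E1'] := Hc _ _ (p1 _ _ G1) b1.
have [|g2 [G2 E2]] := FB_div m0 mt mt1 (FB_sub (p1 _ _ G1) (Hk _ _ F1)); first by rewrite /= E1' subrr.
exists f1, g2; eexists; split; [exact: FB_calF F1|exact: p1 G2| |].
  by have := FB_ge0 G2; lra.
move=> z Sz; rewrite -[w in LHS](subrK (T (f0 z))) (E1 z Sz) expr2 -scalerA -(E2 z Sz).
by rewrite /= scalerBr -addrA [X in _ = _ + X]addrC subrK addrC.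
Qed.

(** [Phi] is an approximate solution: [T (Phi z)] misses [w] by a quadratic term. Lower bounds turn
    this into a quadratic distance to the true solution, at [s] on the real axis and at [th] after a
    vertical translation; the second case shows that [Phi] is stationary at [th]. *)
Lemma first_order th (w : amb Y) (x : amb X) : 0 < th < 1 -> invertible_at T th ->
  (exists B, FB (fun=> w : amb Y) B) -> cinterp X th x -> T x = w ->
  forall e, 0 < e -> exists2 r : R, 0 < r & forall s a, `|s - th| < r ->
    cinterp X s a -> T a = w -> sum_norm X (a - x) <= e * `|s - th|.
Proof.
move=> t01 inv Fw [f0 F0 <-] Tx; have /andP[t0 t1] := t01.
have [f1 [g2 [B [F1 G2 B0 Ew]]]] := taylor_expansion t01 inv Fw F0 Tx.
have [c c0 LB] := invertible_lower_bound inv.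
have [rho [c' [rho0 c'0 LBs]]] := lower_bound_stable HT t01 c0 LB.
pose d := Num.min th (1 - th) / 2.
have dt : d <= th / 2 by rewrite ler_wpM2r // ge_min lexx.
have dt1 : d <= (1 - th) / 2 by rewrite ler_wpM2r // ge_min lexx orbT.
have d0 : 0 < d by rewrite divr_gt0 // lt_min t0 subr_gt0.
have [C C0 HC] := FB_sum_norm X d0 (ltac:(lra) : d <= 1).
have [b0 FB0] := calF_FB F0; have [b1 FB1] := calF_FB F1.
have St : S th%:C by apply: real_strip.
have hs0 z : S z -> in_sum X (f0 z) by exact: FB_in_sum FB0.
have hs1 z : S z -> in_sum X (f1 z) by exact: FB_in_sum FB1.
pose Phi z : amb X := f0 z + (z - th%:C) *: f1 z.
have hPhi z : S z -> in_sum X (Phi z).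
  by move=> Sz; apply: in_sumD; [exact: hs0|apply: in_sumZ; exact: hs1].
have TPhi z : S z -> w - T (Phi z) = (z - th%:C) ^+ 2 *: g2 z.
  move=> Sz; rewrite [in LHS](Ew z Sz) /Phi opD //; [|exact: hs0|by apply: in_sumZ; exact: hs1].
  by rewrite (opZ HT); [rewrite addrC addKr|exact: hs1].
(* On the real axis the error is controlled by the lower bound at the nearby point. *)
have real_est s a : `|s - th| < Num.min rho d -> cinterp X s a -> T a = w ->
    sum_norm X (a - Phi s%:C) <= C * (c' * B) * `|s - th| ^+ 2.
  rewrite lt_min => /andP[s1 s2] [fa Fa <-] Ta.
  have [s01 LBsc] := LBs s s1; have Ss := real_strip s01.
  have [ba FBa] := calF_FB Fa.
  (* For [s = th] the radius [|s - th| ^+ 2 * B] is not positive, so injectivity of [T_th] is used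
     instead of the lower bound. *)
  have [E|sth] := eqVneq s th.
    have -> : fa s%:C = f0 th%:C.
      have [_ [_ [inj _]]] := inv; apply: inj; [|by exists f0|by rewrite Tx].
      by rewrite -E; exists fa.
    rewrite /Phi E !subrr scale0r addr0 subrr sum_norm0 normr0 expr0n /=.
    by rewrite mulr0.
  have Fe := FB_sub FBa (FB_lin (s%:C - th%:C) FB1 FB0).
  have cE : cabs (s%:C - th%:C) = `|s - th| by rewrite -rmorphB /= cabsR.
  have Gh := FB_scale ((s%:C - th%:C) ^+ 2) G2.
  have cE2 : cabs ((s%:C - th%:C) ^+ 2) = `|s - th| ^+ 2 by rewrite !expr2 cabsM cE.
  rewrite cE2 in Gh.
  have bp : 0 < `|s - th| ^+ 2 * B.
    by rewrite mulr_gt0 // exprn_gt0 // normr_gt0 subr_eq0.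
  have ePhi : (s%:C - th%:C) *: f1 s%:C + f0 s%:C = Phi s%:C by rewrite /Phi addrC.
  have [|e' Fe' Ee'] := LBsc _ _ _ (FB_calF Fe) Gh bp.
    rewrite ePhi (opB HT) ?Ta ?TPhi //; last exact: hPhi.
    exact: FB_in_sum FBa Ss.
  rewrite -ePhi -Ee'.
  have /andP[? ?] : - d < s - th < d by rewrite -ltr_norml.
  apply: (le_trans (HC _ _ _ Fe' _ _)) => /=; [lra|lra|].
  by apply: eq_leW; ring.
(* Vertical translation fixes the fibre over th, so x itself solves the equation at th + it. *)
have imag_est t : t != 0 -> sum_norm X (f0 th%:C - Phi (th +i* t)) <= C * (c * B) * `|t| ^+ 2.
  move=> tn0.
  have zE : th%:C + 0 +i* t = th +i* t.
    by apply/eqP; rewrite eq_complex /= addr0 add0r !eqxx.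
  have zB : th +i* t - th%:C = 0 +i* t.
    by apply/eqP; rewrite eq_complex /= subrr subr0 !eqxx.
  have Sz : S (th +i* t) by apply/andP; split => /=; lra.
  (* Being built from vertical translates, this element takes the value [f0 th - Phi (th + it)] at
     [th], where the lower bound is available. *)
  have Fe := FB_sub FB0 (FB_lin (0 +i* t) (FB_shift t FB1) (FB_shift t FB0)).
  have Gh := FB_scale ((0 +i* t) ^+ 2) (FB_shift t G2).
  have cE2 : cabs ((0 +i* t) ^+ 2) = `|t| ^+ 2 by rewrite !expr2 cabsM cabsI.
  rewrite cE2 in Gh.
  have bp : 0 < `|t| ^+ 2 * B by rewrite mulr_gt0 // exprn_gt0 // normr_gt0.
  have ePhi : (0 +i* t) *: f1 (th%:C + 0 +i* t) + f0 (th%:C + 0 +i* t) = Phi (th +i* t).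
    by rewrite /Phi zE zB addrC.
  have [|e' Fe' Ee'] := LB _ _ _ (FB_calF Fe) Gh bp.
    rewrite /= ePhi (opB HT) ?Tx ?TPhi ?zB ?zE //; [exact: hs0|exact: hPhi].
  rewrite -ePhi -Ee'.
  apply: (le_trans (HC _ _ _ Fe' _ _)) => /=; [lra|lra|].
  by apply: eq_leW; ring.
pose h0 z := to_sum (f0 z); pose h1 z := to_sum (f1 z).
have hPhiE z : S z -> to_sum (Phi z) = h0 z + (z - th%:C) *: h1 z.
  by move=> Sz; rewrite to_sumD ?to_sumZ //; [exact: hs1|exact: hs0|apply: in_sumZ; exact: hs1].
have [g00 [g01 [b0' D0]]] := calF_Fdata F0; have [g10 [g11 [b1' D1]]] := calF_Fdata F1.
have [q Hq] := F_diff D0 (z := th%:C) t01.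
(* The derivative of [Phi] at [th], in the sum norm. *)
pose v := q + h1 th%:C.
have lin_est e : 0 < e -> exists2 r, 0 < r & forall z, S z -> cabs (z - th%:C) < r ->
    nsum (to_sum (Phi z) - h0 th%:C - (z - th%:C) *: v) <= e * cabs (z - th%:C).
  move=> e0; have e2 : 0 < e / 2 by lra.
  have [r r0 Hr] := Hq _ e2; have [r' r'0 Hr'] := F_cont D1 St e2.
  exists (Num.min r r'); first by rewrite lt_min r0.
  move=> z Sz; rewrite lt_min => /andP[l1 l2]; rewrite hPhiE //.
  have -> : h0 z + (z - th%:C) *: h1 z - h0 th%:C - (z - th%:C) *: v =
    (h0 z - h0 th%:C - (z - th%:C) *: q) + (z - th%:C) *: (h1 z - h1 th%:C).
    by rewrite /v; modring.
  apply: (le_trans (bn_triangle HS _ _)); rewrite (bn_scale HS).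
  have := Hr z Sz l1; have := ler_wpM2l (cabs_ge0 (z - th%:C)) (Hr' z Sz l2).
  rewrite /= -/(h0 z) -/(h0 th%:C) -/(h1 z) -/(h1 th%:C); lra.
(* Along [th + it] the increment of [Phi] is [it v] up to [o(t)], and by [imag_est] it is [O(t^2)].
   Dividing by [t] leaves [nsum v <= K * t + e / 2]. *)
have v0 : v = 0.
  rewrite -[v]subr0; apply/eqP; rewrite subr_eq0; apply/eqP; apply: (bn_eq HS) => e e0.
  rewrite subr0.
  have [r r0 Hr] := lin_est (e / 2) ltac:(lra).
  pose K := C * (c * B); have K0 : 0 <= K by rewrite !mulr_ge0 // ltW.
  have K1 : 0 < 2 * (K + 1) by lra.
  pose t := Num.min r (e / (2 * (K + 1))) / 2.
  have tp : 0 < Num.min r (e / (2 * (K + 1))) by rewrite lt_min r0 divr_gt0.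
  have tr : Num.min r (e / (2 * (K + 1))) <= r by rewrite ge_min lexx.
  have te : Num.min r (e / (2 * (K + 1))) <= e / (2 * (K + 1)) by rewrite ge_min lexx orbT.
  have t0' : 0 < t by rewrite /t; lra.
  have Sz : S (th +i* t) by apply/andP; split => /=; lra.
  have zB : th +i* t - th%:C = 0 +i* t.
    by apply/eqP; rewrite eq_complex /= subrr subr0 !eqxx.
  have := Hr _ Sz; rewrite zB cabsI (ger0_norm (ltW t0')) => /(_ ltac:(rewrite /t; lra)) n1.
  have := imag_est t (lt0r_neq0 t0'); rewrite (ger0_norm (ltW t0')) => n2.
  have n3 : nsum (to_sum (Phi (th +i* t)) - h0 th%:C) <= K * t ^+ 2.
    by rewrite (bn_sym HS) -to_sumB ?nsumE //; [apply: in_sumB; [exact: hs0|exact: hPhi]|exact: hs0|exact: hPhi].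
  have := bnB HS (to_sum (Phi (th +i* t)) - h0 th%:C)
    (to_sum (Phi (th +i* t)) - h0 th%:C - (0 +i* t) *: v).
  have -> : to_sum (Phi (th +i* t)) - h0 th%:C -
    (to_sum (Phi (th +i* t)) - h0 th%:C - (0 +i* t) *: v) = (0 +i* t) *: v by modring.
  rewrite (bn_scale HS) cabsI (ger0_norm (ltW t0')) => n4.
  have te' : t * (2 * (K + 1)) <= e / 2.
    by move: te; rewrite ler_pdivlMr // /t; lra.
  have : t * nsum v <= t * (K * t + e / 2) by rewrite mulrDr mulrCA -expr2; lra.
  rewrite ler_pM2l // => n5; apply: (le_trans n5); nra.
move=> e e0; have [r r0 Hr] := lin_est (e / 2) ltac:(lra).
pose K := C * (c' * B); have K0 : 0 <= K by rewrite !mulr_ge0 // ltW.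
have K1 : 0 < 2 * (K + 1) by lra.
exists (Num.min (Num.min r (e / (2 * (K + 1)))) (Num.min rho d)).
  by rewrite !lt_min r0 d0 rho0 divr_gt0.
move=> s a; rewrite lt_min => /andP[]; rewrite lt_min => /andP[s1 s2] s3 ha Ta.
have := real_est s a s3 ha Ta; rewrite -/K => n1.
have rmin : Num.min rho d <= rho by rewrite ge_min lexx.
have [s01 _] := LBs s (lt_le_trans s3 rmin).
have Ss := real_strip s01.
have cE : cabs (s%:C - th%:C) = `|s - th| by rewrite -rmorphB /= cabsR.
have := Hr _ Ss; rewrite cE v0 scaler0 subr0 => /(_ s1) n2.
have ain : in_sum X a by apply: cinterp_in_sum ha; case/andP: s01 => /ltW -> /ltW ->.
have n2' : sum_norm X (Phi s%:C - f0 th%:C) <= e / 2 * `|s - th|.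
  by move: n2; rewrite /h0 -to_sumB ?nsumE //; [apply: in_sumB; [exact: hPhi|exact: hs0]|exact: hPhi|exact: hs0].
have := sum_normD (in_sumB ain (hPhi _ Ss)) (in_sumB (hPhi _ Ss) (hs0 _ St)).
rewrite addrA subrK => n3; apply: (le_trans n3).
move: s2; rewrite ltr_pdivlMr // => s2; have x0 := normr_ge0 (s - th).
rewrite expr2 in n1; nra.
Qed.

Lemma sum_norm_eq u v : in_sum X u -> in_sum X v ->
  (forall e, 0 < e -> sum_norm X (u - v) <= e) -> u = v.
Proof.
move=> hu hv H; apply/eqP; rewrite -subr_eq0; apply/eqP; apply: sum_norm_sep.
  exact: in_sumB.
by apply/eqP; rewrite eq_le sum_norm_ge0 andbT; apply/ler_addgt0Pr => e /H; rewrite add0r.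
Qed.

(** A fixed [a] solving the equation in [[X]_s] for [s] arbitrarily close to [th] is [T_th^-1 w] by
    [first_order]. Membership of [a] in [[X]_th] is a conclusion, not a hypothesis. *)
Lemma limit_agrees th w x a : 0 < th < 1 -> invertible_at T th ->
  (exists B, FB (fun=> w : amb Y) B) -> cinterp X th x -> T x = w -> in_sum X a -> T a = w ->
  (forall r, 0 < r -> exists2 s, `|s - th| < r & cinterp X s a) -> a = x.
Proof.
move=> t01 inv Fw hx Tx ain Ta near.
have xin : in_sum X x by apply: cinterp_in_sum hx; case/andP: t01 => /ltW -> /ltW ->.
apply: sum_norm_eq => // e e0.
have [r r0 Hr] := first_order t01 inv Fw hx Tx e0.
have [|s sr ha] := near (Num.min r 1); first by rewrite lt_min r0 ltr01.
move: sr; rewrite lt_min => /andP[s1 s2].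
apply: (le_trans (Hr s a s1 ha Ta)); rewrite ler_piMr //; exact: ltW.
Qed.

(** By [first_order] the solution, viewed in the sum space, is a primitive of the zero function, so
    the mean value inequality makes it constant. *)
Lemma inverse_constant a b w xa xb : a <= b ->
  (forall s, a <= s <= b -> 0 < s < 1 /\ invertible_at T s) ->
  (exists B, FB (fun=> w : amb Y) B) ->
  cinterp X a xa -> T xa = w -> cinterp X b xb -> T xb = w -> xa = xb.
Proof.
move=> ab Hinv Fw hxa Txa hxb Txb.
have ex s : exists x, a <= s <= b -> cinterp X s x /\ T x = w.
  have [sab|nsab] := boolP (a <= s <= b); last by exists 0.
  have [_ [_ [_ [_ [surj _]]]]] := Hinv s sab.
  have [|x hx Tx] := surj w; last by exists x.
  by have [B F] := Fw; exists (fun=> w) => //; exact: FB_calF F.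
have [U HU] := choice ex.
have aab : a <= a <= b by rewrite lexx.
have bab : a <= b <= b by rewrite lexx andbT.
have Uin s : a <= s <= b -> in_sum X (U s).
  move=> sab; apply: cinterp_in_sum (HU s sab).1.
  by have [/andP[/ltW -> /ltW ->]] := Hinv s sab.
have p : prim (@nsum R X) (fun=> 0) (fun s => to_sum (U s)) a b.
  move=> s sab e e0; have [s01 inv] := Hinv s sab; have [hs Ts] := HU s sab.
  have [r r0 Hr] := first_order s01 inv Fw hs Ts e0; exists r => // y yab yr.
  rewrite scaler0 subr0 -to_sumB ?nsumE; try (apply: in_sumB); try exact: Uin.
  by have [hy Ty] := HU y yab; exact: Hr.
have h : nsum (to_sum (U b) - to_sum (U a)) <= 0 * (b - a).
  by apply: (prim_norm_cst HS ab p) => s _; rewrite (bn0 HS).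
rewrite mul0r in h.
have inj s x : a <= s <= b -> cinterp X s x -> T x = w -> x = U s.
  move=> sab hx Tx; have [_ [_ [_ [inj _]]]] := Hinv s sab.
  by apply: inj => //; [exact: (HU s sab).1|rewrite (HU s sab).2].
rewrite (inj a xa) // (inj b xb) //; symmetry.
apply: sum_norm_eq; try exact: Uin; move=> e e0; apply: le_trans (ltW e0).
by rewrite -nsumE ?to_sumB //; try apply: in_sumB; exact: Uin.
Qed.

End Agreement.

(* For theta0, theta1 in I and y in [Y]_theta0 /\ [Y]_theta1, the preimages
   T_theta0^{-1} y = x0 in [X]_theta0 and T_theta1^{-1} y = x1 in [X]_theta1
   coincide. *)
Theorem theorem4p10 (R : realType) (X Y : couple R) (T : amb X -> amb Y)
  (HT : operator T) (I : set R) (HI : interval_of_invertibility T I)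
  (theta0 theta1 : R) (H0 : I theta0) (H1 : I theta1)
  (y : amb Y) (Hy0 : cinterp Y theta0 y) (Hy1 : cinterp Y theta1 y)
  (x0 x1 : amb X) (Hx0 : cinterp X theta0 x0) (Hx1 : cinterp X theta1 x1)
  (Tx0 : T x0 = y) (Tx1 : T x1 = y) :
  x0 = x1.
Proof.
have Iinv s : I s -> 0 < s < 1 /\ invertible_at T s.
  by have [th _ ->] := HI => /connected_component_sub.
have Iint : is_interval I.
  by have [th _ ->] := HI; apply/connected_intervalP; apply: component_connected.
wlog t01 : theta0 theta1 H0 H1 Hy0 Hy1 x0 x1 Hx0 Hx1 Tx0 Tx1 / theta0 <= theta1.
  move=> W; have [le|/ltW le] := leP theta0 theta1; first exact: (W theta0 theta1).
  by symmetry; apply: (W theta1 theta0).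
have [t0 inv0] := Iinv _ H0; have [t1 inv1] := Iinv _ H1.
have [a0 [b0 [E0 A0 B0]]] := cinterp_decomposition t0 Hx0.
have [a1 [b1 [E1 A1 B1]]] := cinterp_decomposition t1 Hx1.
have ina (a : sp0 X) := in_sum_emb0 a; have inb (b : sp1 X) := in_sum_emb1 b.
pose a := emb0 X a0 - emb0 X a1; pose b := emb1 X b1 - emb1 X b0.
have ab : x0 - x1 = a - b by rewrite E0 E1 /a /b; modring.
have ain : in_sum X a by apply: in_sumB.
have bin : in_sum X b by apply: in_sumB.
pose w := T a.
have Tb : T b = w.
  have xin0 : in_sum X x0 by rewrite E0; apply: in_sumD.
  have xin1 : in_sum X x1 by rewrite E1; apply: in_sumD.
  have : T (a - b) = 0 by rewrite -ab (opB HT) // Tx0 Tx1 subrr.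
  by rewrite (opB HT) // => /eqP; rewrite subr_eq0 => /eqP.
(* [w] comes from [a0 - a1] through [T0] and from [b1 - b0] through [T1], hence lies in both end
   spaces. *)
have Fw : exists B, FB (fun=> w : amb Y) B.
  have [k [T0 [T1 [_ ET0 _ ET1 _]]]] := op_bound HT.
  have e0 : emb0 Y (T0 (a0 - a1)) = w by rewrite ET0 linearB.
  have e1 : emb1 Y (T1 (b1 - b0)) = w by rewrite ET1 linearB.
  by eexists; do 2!eexists; exact: (Fdata_cst e0 e1).
have wY s : cinterp Y s w by have [B F] := Fw; exists (fun=> w) => //; exact: FB_calF F.
have [xa hxa Txa] : exists2 x, cinterp X theta0 x & T x = w.
  by have [_ [_ [_ [surj _]]]] := inv0; apply: surj.
have [xb hxb Txb] : exists2 x, cinterp X theta1 x & T x = w.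
  by have [_ [_ [_ [surj _]]]] := inv1; apply: surj.
have /andP[t00 t01'] := t0; have /andP[t10 t11] := t1.
have Ea : a = xa.
  apply: (limit_agrees HT t0 inv0 Fw hxa Txa ain) => // r r0.
  (* [theta0 - k] is positive and below [theta0 <= theta1], so both [A0] and [A1] apply there. *)
  pose k := Num.min r theta0 / 2.
  have k0 : 0 < Num.min r theta0 by rewrite lt_min r0.
  have kr : Num.min r theta0 <= r by rewrite ge_min lexx.
  have kt : Num.min r theta0 <= theta0 by rewrite ge_min lexx orbT.
  exists (theta0 - k).
    by rewrite addrAC subrr add0r normrN ger0_norm /k; lra.
  by apply: cinterp_sub; [apply: A0|apply: A1]; apply/andP; split; rewrite /k; lra.
have Eb : b = xb.
  apply: (limit_agrees HT t1 inv1 Fw hxb Txb bin) => // r r0.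
  (* Symmetrically, [theta1 + k] is below [1] and above both parameters, so [B0] and [B1] apply. *)
  pose k := Num.min r (1 - theta1) / 2.
  have k0 : 0 < Num.min r (1 - theta1) by rewrite lt_min r0 subr_gt0.
  have kr : Num.min r (1 - theta1) <= r by rewrite ge_min lexx.
  have kt : Num.min r (1 - theta1) <= 1 - theta1 by rewrite ge_min lexx orbT.
  exists (theta1 + k).
    by rewrite addrC addKr ger0_norm /k; lra.
  by apply: cinterp_sub; [apply: B1|apply: B0]; apply/andP; split; rewrite /k; lra.
have Eab : xa = xb.
  apply: (inverse_constant HT t01 _ Fw hxa Txa hxb Txb) => s s01.
  by apply: Iinv; exact: (Iint _ _ H0 H1).
by apply/eqP; rewrite -subr_eq0 ab Ea Eb Eab subrr.
Qed.
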